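(* Let $F=\rho B$, $A$, $C$ satisfy conditions I–III and condition (IV) of the context, fix one of the sectors $\Gamma_\kappa$ described in the context, and let $b_1,\dots,b_n$ be numbered so that $\mathrm{Re}(\lambda b_1)\ge \mathrm{Re}(\lambda b_2)\ge\dots\ge \mathrm{Re}(\lambda b_n)$ for all $\lambda\in\overline{\Gamma_\kappa}$. Then for every $\alpha\ge 0$ there exists $\lambda_\alpha>0$ such that, with $\Gamma_\kappa^\alpha:=\{\lambda\in\Gamma_\kappa: |\lambda|>\lambda_\alpha\}$, for $\lambda\in\overline{\Gamma_\kappa^\alpha}$ there exists a fundamental system of solutions $Y_\alpha(x,\lambda)=[y_{jk}(x,\lambda)]_{j,k=1}^n$ of the system $$\mathbf y'=\big(\lambda F(x)+A(x)+C(x,\lambda)\big)\mathbf y,\qquad x\ge 0,$$ with the following properties. 1. For $j,k=1,\dots,n$, $x\ge\alpha$ and $\lambda\in\overline{\Gamma_\kappa^\alpha}$, $$y_{jk}(x,\lambda)=e^{\lambda b_k(p(x)-p(\alpha))}\big(m_{jk}(x)+s_{jk}(x,\lambda)\big),$$ where $s_{jk}(x,\lambda)=o(1)$ as $\lambda\to\infty$, $\lambda\in\overline{\Gamma_\kappa^\alpha}$, uniformly in $x\ge\alpha$. Here $p(x)=\int_0^x\rho(t)\,dt$ and $m_{jk}$ are the entries of the matrix $M_\alpha$ defined in the context. 2. For each fixed $x\ge 0$, the functions $\lambda\mapsto y_{jk}(x,\lambda)$, $j,k=1,\dots,n$, are continuous on $\overline{\Gamma_\kappa^\alpha}$ and analytic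 in $\Gamma_\kappa^\alpha$. 3. $y_{jk}(\alpha,\lambda)=\delta_{jk}$ for $k=1,\dots,n$ and $j=k,\dots,n$ (Kronecker delta). Moreover, the numbers $\lambda_\alpha$ can be taken so that $\lambda_\alpha\to0$ as $\alpha\to\infty$.
   Context: Notation: $\mathbb C_0=\mathbb C\setminus\{0\}$; $L[\alpha,\infty)$ is the space of (complex-valued) Lebesgue integrable functions on $[\alpha,\infty)$; for a matrix function $X=[x_{jk}]$, $\|X\|_{L[\alpha,\infty)}:=\max_{j,k}\|x_{jk}\|_{L[\alpha,\infty)}$. Conditions on the $n\times n$ matrix functions $F,A,C$: I. $F(x)=\rho(x)B$, where $\rho\in L[0,T)$ for every $T>0$, $\rho(x)>0$ a.e. on $[0,\infty)$, and $B=\mathrm{diag}\{b_j\}_{j=1}^n$ is constant with $b_j\in\mathbb C$ (not necessarily distinct). II. $A(x)=[a_{jk}(x)]_{j,k=1}^n$ with $a_{jk}\in L[0,\infty)$. III. $C(x,\lambda)=[c_{jk}(x,\lambda)]_{j,k=1}^n$, where each $\lambda\mapsto c_{jk}(\cdot,\lambda)$ is a holomorphic mapping from $\mathbb C_0$ to the Banach space $L[0,\infty)$, and $\|C(\cdot,\lambda)\|_{L[0,\infty)}\to0$ as $\lambda\to\infty$. Condition (IV): there is a function $\varphi:[0,\infty)\to(0,\infty)$ such that $\varphi(\alpha)\to0$ and $\sup_{|\lambda|\ge\varphi(\alpha)}\|C(\cdot,\lambda)\|_{L[\alpha,\infty)}\to0$ as $\alpha\to\infty$. A solution of the system (for a given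 $\lambda\in\mathbb C_0$) is a vector function $\mathbf y=[y_j]_{j=1}^n$ with $y_j\in AC[0,T]$ for every $T>0$ satisfying the system a.e. A fundamental system of solutions is an $n\times n$ matrix whose columns are solutions linearly independent on $[0,\infty)$. Sectors: the lines $\mathrm{Re}(\lambda b_j)=\mathrm{Re}(\lambda b_l)$, over all $j,l$ with $b_j\ne b_l$, pass through the origin and split the $\lambda$-plane into finitely many open sectors $\Gamma_\kappa=\{\lambda\in\mathbb C_0:\beta_{\kappa-1}<\arg\lambda<\beta_\kappa\}$ (the connected components of the complement in $\mathbb C_0$ of the union of these lines). For each $\Gamma_\kappa$ the numbers $b_j$ can be renumbered (with the corresponding permutation of rows and columns in the system) so that the ordering required in the claim holds on $\overline{\Gamma_\kappa}$. Matrix $M_\alpha$: let $D(x)=[d_{jk}(x)]$ with $d_{jk}=a_{jk}$ if $b_j=b_k$ and $d_{jk}=0$ if $b_j\ne b_k$. $M_\alpha(x)=[m_{jk}(x)]_{j,k=1}^n$ is the unique (absolutely continuous) solution of $M_\alpha'(x)=D(x)M_\alpha(x)$, $x\ge0$, $M_\alpha(\alpha)=I$. *)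

(* Defs.v *)
From HB Require Import structures.
From mathcomp Require Import all_boot all_order all_algebra.
From mathcomp Require Import complex.
From mathcomp Require Import all_classical all_reals all_analysis.

Set Implicit Arguments.
Unset Strict Implicit.
Unset Printing Implicit Defensive.

Import Order.TTheory GRing.Theory Num.Theory.
Import numFieldNormedType.Exports.

Local Open Scope classical_set_scope.
Local Open Scope ring_scope.
Local Open Scope complex_scope.

(* The topology and the norm of the field R[i]. *)
HB.instance Definition _ (R : rcfType) := PseudoPointedMetric.copy R[i] R[i]^o.
HB.instance Definition _ (R : rcfType) := NormedModule.copy R[i] R[i]^o.

(* Functions of the real variable x are total on R; only their values on
   [0, +oo[ are ever constrained.  For z : R[i], Normc.normc z : R is the
   modulus, whereas `|z| would be the same number seen in R[i]. *)

Section Lebesgue.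
Variable R : realType.
Let mu : {measure set (measurableTypeR R) -> \bar R} := lebesgue_measure.

Definition cintegrable (D : set R) (f : R -> R[i]) : Prop :=
  mu.-integrable D (fun x => (complex.Re (f x))%:E) /\
  mu.-integrable D (fun x => (complex.Im (f x))%:E).

Definition L1norm (a : R) (f : R -> R[i]) : \bar R :=
  (\int[mu]_(x in `[a, +oo[) (Normc.normc (f x))%:E)%E.

Definition mxL1norm (n : nat) (a : R) (X : R -> 'M[R[i]]_n) : \bar R :=
  \big[maxe/0%E]_(j < n) \big[maxe/0%E]_(k < n) L1norm a (fun x => X x j k).

(* Complex differentiability on C \ {0} with respect to the norm of the Banach
   space L[0, +oo[, whose elements are given by representatives. *)
Definition holomorphic_L1 (f : R[i] -> R -> R[i]) : Prop :=
  (forall l : R[i], l != 0 -> cintegrable `[0, +oo[ (f l)) /\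
  forall l0 : R[i], l0 != 0 ->
    exists2 g : R -> R[i], cintegrable `[0, +oo[ g &
      L1norm 0 (fun x => (l - l0)^-1 * (f l x - f l0 x) - g x)
        @[l --> l0^'] --> 0%E.

Definition vanishes_at_infinity (f : R[i] -> \bar R) : Prop :=
  forall e : R, 0 < e ->
    exists r : R, forall l, r < Normc.normc l -> (f l < e%:E)%E.

(* The intervals ]u i, v i[ may be empty. *)
Definition absolutely_continuous_on (a b : R) (f : R -> R[i]) : Prop :=
  forall e : R, 0 < e -> exists2 d : R, 0 < d &
    forall (m : nat) (u v : 'I_m -> R),
      (forall i, [/\ a <= u i, u i <= v i & v i <= b]) ->
      trivIset [set: 'I_m] (fun i => [set` `]u i, v i[]) ->
      \sum_(i < m) (v i - u i) < d ->
      \sum_(i < m) Normc.normc (f (v i) - f (u i)) < e.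

Definition has_cderiv (f : R -> R[i]) (x : R) (v : R[i]) : Prop :=
  is_derive x (1 : R) (fun t => complex.Re (f t)) (complex.Re v) /\
  is_derive x (1 : R) (fun t => complex.Im (f t)) (complex.Im v).

(* Each column of Y solves y' = G y on [0, +oo[.  The point x = 0 and the
   values of Y on ]-oo, 0[ are irrelevant, as the equation holds a.e. *)
Definition solves (n m : nat) (G : R -> 'M[R[i]]_n) (Y : R -> 'M[R[i]]_(n, m)) :
    Prop :=
  (forall (T : R) j k, 0 < T ->
     absolutely_continuous_on 0 T (fun x => Y x j k)) /\
  {ae mu, forall x : R, 0 <= x ->
     forall j k, has_cderiv (fun t => Y t j k) x ((G x *m Y x) j k)}.

Definition fundamental_system (n : nat) (G : R -> 'M[R[i]]_n)
    (Y : R -> 'M[R[i]]_n) : Prop :=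
  solves G Y /\
  forall c : 'cV[R[i]]_n, (forall x : R, 0 <= x -> Y x *m c = 0) -> c = 0.

Definition primitive (rho : R -> R) (x : R) : R :=
  (\int[mu]_(t in `[0%R, x]) rho t)%R.

End Lebesgue.

Section System.
Variables (R : realType) (n : nat).
Let mu : {measure set (measurableTypeR R) -> \bar R} := lebesgue_measure.

Definition cexp (z : R[i]) : R[i] :=
  (expR (complex.Re z))%:C * (cos (complex.Im z) +i* sin (complex.Im z)).

Definition Fmx (rho : R -> R) (b : 'I_n -> R[i]) (x : R) : 'M[R[i]]_n :=
  (rho x)%:C *: diag_mx (\row_j b j).

Definition cond_I (rho : R -> R) : Prop :=
  (forall T : R, 0 < T -> mu.-integrable `[0, T[ (fun x => (rho x)%:E)) /\
  {ae mu, forall x : R, 0 <= x -> 0 < rho x}.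

Definition cond_II (A : R -> 'M[R[i]]_n) : Prop :=
  forall j k, cintegrable `[0, +oo[ (fun x => A x j k).

Definition cond_III (C : R -> R[i] -> 'M[R[i]]_n) : Prop :=
  (forall j k, holomorphic_L1 (fun l x => C x l j k)) /\
  vanishes_at_infinity (fun l => mxL1norm 0 (fun x => C x l)).

Definition cond_IV (C : R -> R[i] -> 'M[R[i]]_n) : Prop :=
  exists phi : R -> R,
    [/\ forall a, 0 <= a -> 0 < phi a,
        phi a @[a --> +oo] --> 0 &
        ereal_sup [set mxL1norm a (fun x => C x l) |
                     l in [set l : R[i] | phi a <= Normc.normc l]]
          @[a --> +oo] --> 0%E].

Definition off_lines (b : 'I_n -> R[i]) : set R[i] :=
  [set l | l != 0 /\ forall j k, b j != b k ->
     complex.Re (l * b j) != complex.Re (l * b k)].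

Definition is_sector (b : 'I_n -> R[i]) (Gamma : set R[i]) : Prop :=
  exists2 l, off_lines b l & Gamma = connected_component (off_lines b) l.

Definition truncated (Gamma : set R[i]) (r : R) : set R[i] :=
  [set l | Gamma l /\ r < Normc.normc l].

Definition Dmx (b : 'I_n -> R[i]) (A : R -> 'M[R[i]]_n) (x : R) : 'M[R[i]]_n :=
  \matrix_(j, k) (if b j == b k then A x j k else 0).

Definition is_Malpha (b : 'I_n -> R[i]) (A : R -> 'M[R[i]]_n) (a : R)
    (M : R -> 'M[R[i]]_n) : Prop :=
  solves (Dmx b A) M /\ M a = 1%:M.

End System.

(* Main.v *)
(* On [a, +oo[ write the k-th column as y = exp(l b_k (p - p(a))) M z.  As M is
   block-diagonal along equal b_j, it commutes with B, and z solves the integral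
   equation z = e_k + T z with T = T(l): the j-th component of T z is the integral
   of exp(l (b_j - b_k) (p(x) - p(t))) (Q z)_j(t), over [a, x] for j >= k and from
   +oo to x for j < k, where Q = M^-1 (A - D + C) M.  By the ordering of the
   Re(l b_j), the exponentials are bounded by 1 on the closed sector.  The entries
   of M^-1 (A - D) M vanish where b_j = b_k, and each component of T z solves a
   scalar equation y' = l (b_m - b_k) rho y + f, so that a Riemann-Lebesgue lemma
   in which a primitive of rho replaces x, uniform in the interval of integration,
   makes T^2 small as l tends to infinity.  When a is large, T itself is small for
   |l| >= phi(a) by condition (IV).  In both cases 1 - T is invertible with a
   locally uniform bound, and z inherits continuity and, where the exponentials
   decay, differentiability in l.  The solution is continued to [0, a] by a
   Volterra equation. *)
Require Import Defs.
From HB Require Import structures.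
From mathcomp Require Import all_boot all_order all_algebra.
From mathcomp Require Import complex.
From mathcomp Require Import all_classical all_reals all_analysis.
From mathcomp Require Import measurable_realfun ring lra.

Set Implicit Arguments.
Unset Strict Implicit.
Unset Printing Implicit Defensive.

Import Order.TTheory GRing.Theory Num.Theory.
Import numFieldNormedType.Exports.

Local Open Scope classical_set_scope.
Local Open Scope ring_scope.
Local Open Scope complex_scope.

Import Normc.
Local Notation Re := (@complex.Re _).
Local Notation Im := (@complex.Im _).

(** * Complex-valued integrals *)

(** On the boundary of the sector some of the numbers Re(l b_j) with different b_j coincide, so the
    exponentials need not decay and only oscillation can make the operator small. Oscillation of the
    kernel alone is not enough: a bounded f may cancel its phase, and then T f is as large as the L1
    norm of Q permits. A function in the range of T cannot do so: its component m carries the phase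
    l (b_m - b_k) p, the kernel of row j the phase - l (b_j - b_k) p, and the net phase l (b_m -
    b_j) p is nontrivial exactly where b_m and b_j differ. Hence T^2 instead of T, and hence the
    frame M, which removes the entries with b_m = b_j. Since l multiplies rho, integration by parts
    is available for densities of the form rho times the indicator of an interval; the rest of L1 is
    reached by density, which uses rho > 0 almost everywhere. For the thresholds to tend to 0, the
    bounds must not depend on the base point: Gronwall's estimate bounds M and its inverse on [a,
    +oo[ by one constant for all a. Since Q is cut off below a, all operators can live on the single
    half-line [0, +oo[. *)

Section Modulus.
Variable R : realType.
Implicit Types (x y : R) (z w : R[i]).

Lemma normc_ge0 z : 0 <= normc z.
Proof. by case: z => a b; rewrite /= sqrtr_ge0. Qed.

Lemma normcB_sym z w : normc (z - w) = normc (w - z).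
Proof. by rewrite -normcN opprB. Qed.

Lemma le_normcB z w : normc (z - w) <= normc z + normc w.
Proof. by rewrite -(normcN w) le_normcD. Qed.

Lemma normc_triangle z w u : normc (z - w) <= normc (z - u) + normc (u - w).
Proof. by rewrite (_ : z - w = (z - u) + (u - w)) ?le_normcD//; ring. Qed.

Lemma ler_normc_dist z w : normc z - normc w <= normc (z - w).
Proof. by rewrite lerBlDr -{1}(subrK w z) le_normcD. Qed.

Lemma normc_real x : normc x%:C = `|x|.
Proof. by rewrite /= expr0n/= addr0 sqrtr_sqr. Qed.

Lemma normc_eq0 z : (normc z == 0) = (z == 0).
Proof. by apply/eqP/eqP => [/eq0_normc//|->]; rewrite normc0. Qed.

Lemma normc_gt0 z : (0 < normc z) = (z != 0).
Proof. by rewrite lt_neqAle normc_ge0 eq_sym normc_eq0 andbT. Qed.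

Lemma normc_sum (I : Type) (s : seq I) (P : pred I) (F : I -> R[i]) :
  normc (\sum_(i <- s | P i) F i) <= \sum_(i <- s | P i) normc (F i).
Proof.
elim/big_rec2 : _ => [|i u v _ uv]; first by rewrite normc0.
by rewrite (le_trans (le_normcD _ _))// lerD2l.
Qed.

Lemma normr_le_normc z : `|Re z| <= normc z /\ `|Im z| <= normc z.
Proof.
case: z => a b /=; rewrite -!sqrtr_sqr !ler_sqrt ?addr_ge0 ?sqr_ge0//.
by split; rewrite ?lerDl ?lerDr sqr_ge0.
Qed.

Lemma normc_le_ReIm z : normc z <= `|Re z| + `|Im z|.
Proof.
case: z => a b /=; rewrite -(@ger0_norm _ (`|a| + `|b|)) ?addr_ge0//.
rewrite -sqrtr_sqr ler_sqrt ?sqr_ge0// sqrrD !real_normK ?num_real//.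
by rewrite -addrA lerD2l lerDr mulrn_wge0// mulr_ge0.
Qed.

Lemma normcE z : `|z| = (normc z)%:C.
Proof. by case: z. Qed.

Lemma ReD z w : Re (z + w) = Re z + Re w. Proof. by case: z; case: w. Qed.
Lemma ImD z w : Im (z + w) = Im z + Im w. Proof. by case: z; case: w. Qed.
Lemma ReN z : Re (- z) = - Re z. Proof. by case: z. Qed.
Lemma ImN z : Im (- z) = - Im z. Proof. by case: z. Qed.
Lemma ReB z w : Re (z - w) = Re z - Re w. Proof. by rewrite ReD ReN. Qed.
Lemma ImB z w : Im (z - w) = Im z - Im w. Proof. by rewrite ImD ImN. Qed.
Lemma ReM z w : Re (z * w) = Re z * Re w - Im z * Im w.
Proof. by case: z; case: w. Qed.
Lemma ImM z w : Im (z * w) = Re z * Im w + Im z * Re w.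
Proof. by case: z => a b; case: w => c d /=. Qed.
Lemma complexP z w : Re z = Re w -> Im z = Im w -> z = w.
Proof. by case: z => a b; case: w => c d /= -> ->. Qed.

Lemma normc_cexp z : normc (cexp z) = expR (Re z).
Proof.
rewrite /cexp normcM normc_real ger0_norm ?expR_ge0//=.
by rewrite cos2Dsin2 sqrtr1 mulr1.
Qed.

Lemma cexpD z w : cexp (z + w) = cexp z * cexp w.
Proof.
rewrite /cexp ReD ImD expRD cosD sinD.
by apply: complexP; rewrite !(ReM, ImM)/=; ring.
Qed.

Lemma cexp0 : cexp 0 = 1 :> R[i].
Proof. by rewrite /cexp/= expR0 cos0 sin0; apply: complexP => /=; ring. Qed.

Lemma cexpN z : cexp z * cexp (- z) = 1.
Proof. by rewrite -cexpD subrr cexp0. Qed.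

Lemma Re_cexp z : Re (cexp z) = expR (Re z) * cos (Im z).
Proof. by rewrite /cexp ReM/=; ring. Qed.
Lemma Im_cexp z : Im (cexp z) = expR (Re z) * sin (Im z).
Proof. by rewrite /cexp ImM/=; ring. Qed.

End Modulus.

Arguments normc : simpl never.
Arguments cexp : simpl never.

Section ComplexIntegral.
Variable R : realType.
Let mu : {measure set (measurableTypeR R) -> \bar R} := lebesgue_measure.
Implicit Types (D J : set (measurableTypeR R)) (f g : R -> R[i]) (h : R -> R).

Definition cmeas D f : Prop :=
  measurable_fun D (Re \o f) /\ measurable_fun D (Im \o f).

Definition cint D f : R[i] :=
  (\int[mu]_(t in D) Re (f t)) +i* (\int[mu]_(t in D) Im (f t)).

Lemma cmeasS D J f : measurable D -> J `<=` D -> cmeas D f -> cmeas J f.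
Proof. by move=> mD JD [mr mi]; split; exact: measurable_funS JD _. Qed.

Lemma eq_cmeas D f g : (forall x, D x -> f x = g x) -> cmeas D f -> cmeas D g.
Proof.
move=> fg [mr mi]; split; [apply: eq_measurable_fun mr|apply: eq_measurable_fun mi];
by move=> x /set_mem Dx /=; rewrite fg.
Qed.

Lemma cmeas_cst D (z : R[i]) : cmeas D (fun=> z).
Proof. by split; exact: measurable_cst. Qed.

Lemma cmeas_real D h : measurable_fun D h -> cmeas D (fun x => (h x)%:C).
Proof. by move=> mh; split => //; exact: measurable_cst. Qed.

Lemma cmeasD D f g : cmeas D f -> cmeas D g -> cmeas D (fun x => f x + g x).
Proof.
move=> [fr fi] [gr gi]; split.
  by rewrite (_ : _ \o _ = (Re \o f) \+ (Re \o g)) ?funeqE => [|x/=];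
    [exact: measurable_funD|rewrite ReD].
by rewrite (_ : _ \o _ = (Im \o f) \+ (Im \o g)) ?funeqE => [|x/=];
    [exact: measurable_funD|rewrite ImD].
Qed.

Lemma cmeasM D f g : cmeas D f -> cmeas D g -> cmeas D (fun x => f x * g x).
Proof.
move=> [fr fi] [gr gi]; split.
  rewrite (_ : _ \o _ = ((Re \o f) \* (Re \o g)) \- ((Im \o f) \* (Im \o g))) ?funeqE => [|x/=].
    by apply: measurable_funB; exact: measurable_funM.
  by rewrite ReM.
rewrite (_ : _ \o _ = ((Re \o f) \* (Im \o g)) \+ ((Im \o f) \* (Re \o g))) ?funeqE => [|x/=].
  by apply: measurable_funD; exact: measurable_funM.
by rewrite ImM.
Qed.

Lemma cmeasN D f : cmeas D f -> cmeas D (fun x => - f x).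
Proof.
move=> mf; apply: (@eq_cmeas _ (fun x => -1 * f x)) => [x _|]; first by rewrite mulN1r.
by apply: cmeasM => //; exact: cmeas_cst.
Qed.

Lemma cmeasB D f g : cmeas D f -> cmeas D g -> cmeas D (fun x => f x - g x).
Proof. by move=> mf mg; apply: cmeasD => //; exact: cmeasN. Qed.

Lemma cmeas_sum D (I : Type) (s : seq I) (F : I -> R -> R[i]) :
  (forall i, cmeas D (F i)) -> cmeas D (fun x => \sum_(i <- s) F i x).
Proof.
move=> mF; elim: s => [|i s ih].
  by apply: (@eq_cmeas _ (fun=> 0)); [move=> x _; rewrite big_nil|exact: cmeas_cst].
apply: (@eq_cmeas _ (fun x => F i x + \sum_(j <- s) F j x)); last exact: cmeasD.
by move=> x _; rewrite big_cons.
Qed.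

Lemma cmeas_prod D (I : Type) (s : seq I) (F : I -> R -> R[i]) :
  (forall i, cmeas D (F i)) -> cmeas D (fun x => \prod_(i <- s) F i x).
Proof.
move=> mF; elim: s => [|i s ih].
  by apply: (@eq_cmeas _ (fun=> 1)); [move=> x _; rewrite big_nil|exact: cmeas_cst].
apply: (@eq_cmeas _ (fun x => F i x * \prod_(j <- s) F j x)); last exact: cmeasM.
by move=> x _; rewrite big_cons.
Qed.

Lemma cmeas_cexp D f : cmeas D f -> cmeas D (fun x => cexp (f x)).
Proof.
move=> [fr fi]; split.
  rewrite (_ : _ \o _ = (expR \o (Re \o f)) \* (cos \o (Im \o f))) ?funeqE => [|x/=].
    apply: measurable_funM; apply: measurableT_comp => //.
    by apply: continuous_measurable_fun; exact: continuous_cos.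
  exact: Re_cexp.
rewrite (_ : _ \o _ = (expR \o (Re \o f)) \* (sin \o (Im \o f))) ?funeqE => [|x/=].
  apply: measurable_funM; apply: measurableT_comp => //.
  by apply: continuous_measurable_fun; exact: continuous_sin.
exact: Im_cexp.
Qed.

Lemma measurable_normc D f : cmeas D f -> measurable_fun D (fun x => normc (f x)).
Proof.
move=> [fr fi].
rewrite (_ : (fun _ => _) = (@Num.sqrt R) \o (((Re \o f) \* (Re \o f)) \+ ((Im \o f) \* (Im \o f)))); last first.
  by apply/funext => x /=; case: (f x) => a b; rewrite /normc /= !expr2.
apply: measurableT_comp; first by apply: continuous_measurable_fun; exact: sqrt_continuous.
by apply: measurable_funD; exact: measurable_funM.
Qed.

Lemma cintegrable_meas D f : cintegrable D f -> cmeas D f.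
Proof. by move=> [/measurable_int/measurable_EFinP ? /measurable_int/measurable_EFinP ?]. Qed.

Lemma cintegrableS D J f : measurable D -> measurable J ->
  J `<=` D -> cintegrable D f -> cintegrable J f.
Proof. by move=> mD mJ JD [fr fi]; split; [exact: integrableS fr|exact: integrableS fi]. Qed.

Lemma le_cintegrable D f h : measurable D -> cmeas D f ->
  (forall x, D x -> normc (f x) <= h x) -> mu.-integrable D (EFin \o h) ->
  cintegrable D f.
Proof.
move=> mD [fr fi] fh ih; split; (apply: le_integrable ih => //; first exact/measurable_EFinP);
move=> x Dx /=; rewrite lee_fin (le_trans _ (ler_norm _))// (le_trans _ (fh _ Dx))//;
by have [] := normr_le_normc (f x).
Qed.

Lemma integrable_fctD D h1 h2 : measurable D ->
  mu.-integrable D (EFin \o h1) -> mu.-integrable D (EFin \o h2) ->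
  mu.-integrable D (EFin \o (fun x => h1 x + h2 x)).
Proof. by move=> mD i1 i2; exact: (integrableD mD i1 i2). Qed.

Lemma integrable_fctZ D (k : R) h : measurable D ->
  mu.-integrable D (EFin \o h) ->
  mu.-integrable D (EFin \o (fun x => k * h x)).
Proof. by move=> mD i1; exact: (integrableZl mD k i1). Qed.

Lemma integrable_normc D f : measurable D -> cintegrable D f ->
  mu.-integrable D (EFin \o (fun x => normc (f x))).
Proof.
move=> mD cf; have [fr fi] := cf.
apply: (@le_integrable _ _ _ _ _ mD _ (EFin \o (fun x => `|Re (f x)| + `|Im (f x)|))).
- by apply/measurable_EFinP; apply: measurable_normc; exact: cintegrable_meas.
- move=> x Dx /=.
  by rewrite lee_fin (ger0_norm (normc_ge0 _)) (le_trans (normc_le_ReIm _))// ler_norm.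
- by apply: integrable_fctD => //; exact: integrable_norm.
Qed.

Lemma eq_cintegrable D f g : measurable D -> (forall x, D x -> f x = g x) -> cintegrable D f -> cintegrable D g.
Proof.
move=> mD fg [fr fi]; split; [apply: eq_integrable fr|apply: eq_integrable fi] => //;
by move=> x /set_mem Dx /=; rewrite fg.
Qed.

Lemma eq_cint D f g : (forall x, D x -> f x = g x) -> cint D f = cint D g.
Proof.
by move=> fg; rewrite /cint; congr (_ +i* _); apply: eq_Rintegral => x /set_mem Dx; rewrite fg.
Qed.

Lemma cintegrableD D f g : measurable D -> cintegrable D f -> cintegrable D g ->
  cintegrable D (fun x => f x + g x).
Proof.
move=> mD cf cg; apply: (@le_cintegrable _ _ (fun x => normc (f x) + normc (g x))) => //.
- by apply: cmeasD; exact: cintegrable_meas.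
- by move=> x _; exact: le_normcD.
- by apply: integrable_fctD => //; exact: integrable_normc.
Qed.

Lemma cintegrableM D f g (c : R) : measurable D -> cmeas D g ->
  (forall x, D x -> normc (g x) <= c) -> cintegrable D f ->
  cintegrable D (fun x => g x * f x).
Proof.
move=> mD mg gc cf; apply: (@le_cintegrable _ _ (fun x => c * normc (f x))) => //.
- by apply: cmeasM => //; exact: cintegrable_meas.
- by move=> x Dx; rewrite normcM ler_wpM2r ?normc_ge0// gc.
- by apply: integrable_fctZ => //; exact: integrable_normc.
Qed.

Lemma cintegrableZ D f (c : R[i]) : measurable D -> cintegrable D f ->
  cintegrable D (fun x => c * f x).
Proof. by move=> mD; apply: cintegrableM => //; exact: cmeas_cst. Qed.

Lemma cintegrableN D f : measurable D -> cintegrable D f ->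
  cintegrable D (fun x => - f x).
Proof. by move=> mD cf; under eq_fun do rewrite -mulN1r; exact: cintegrableZ. Qed.

Lemma cintegrableB D f g : measurable D -> cintegrable D f -> cintegrable D g ->
  cintegrable D (fun x => f x - g x).
Proof. by move=> mD cf cg; apply: cintegrableD => //; exact: cintegrableN. Qed.

Lemma cintegrable0 D : cintegrable D (fun=> 0).
Proof. by split; exact: (integrable0 mu). Qed.

Lemma cintegrable_sum D (I : Type) (s : seq I) (F : I -> R -> R[i]) :
  measurable D ->
  (forall i, cintegrable D (F i)) -> cintegrable D (fun x => \sum_(i <- s) F i x).
Proof.
move=> mD mF; elim: s => [|i s ih].
  by apply: (@eq_cintegrable _ (fun=> 0)) => //; [move=> x _; rewrite big_nil|exact: cintegrable0].
apply: (@eq_cintegrable _ (fun x => F i x + \sum_(j <- s) F j x)) => //; last exact: cintegrableD.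
by move=> x _; rewrite big_cons.
Qed.

Lemma cintD D f g : measurable D -> cintegrable D f -> cintegrable D g ->
  cint D (fun x => f x + g x) = cint D f + cint D g.
Proof.
move=> mD [fr fi] [gr gi]; rewrite /cint; apply: complexP => /=.
  by under eq_Rintegral do rewrite ReD; rewrite RintegralD.
by under eq_Rintegral do rewrite ImD; rewrite RintegralD.
Qed.

Lemma cintZ D f c : measurable D -> cintegrable D f ->
  cint D (fun x => c * f x) = c * cint D f.
Proof.
move=> mD [fr fi]; rewrite /cint; apply: complexP; rewrite ?ReM ?ImM /=.
  under eq_Rintegral do rewrite ReM.
  by rewrite RintegralB// ?RintegralZl//; exact: integrable_fctZ.
under eq_Rintegral do rewrite ImM.
by rewrite RintegralD// ?RintegralZl//; exact: integrable_fctZ.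
Qed.

Lemma cintB D f g : measurable D -> cintegrable D f -> cintegrable D g ->
  cint D (fun x => f x - g x) = cint D f - cint D g.
Proof.
move=> mD cf cg; under eq_cint do rewrite -[- g _]mulN1r.
by rewrite cintD ?cintZ ?mulN1r//; exact: cintegrableZ.
Qed.

Lemma cint_sum D (I : Type) (s : seq I) (F : I -> R -> R[i]) :
  measurable D -> (forall i, cintegrable D (F i)) ->
  cint D (fun x => \sum_(i <- s) F i x) = \sum_(i <- s) cint D (F i).
Proof.
move=> mD cF; elim: s => [|i s ih].
  rewrite big_nil; under eq_cint do rewrite big_nil.
  by rewrite /cint/= /Rintegral integral0.
rewrite big_cons -ih -cintD//; last exact: cintegrable_sum.
by apply: eq_cint => x _; rewrite big_cons.
Qed.

(* Rotating the integral to the positive real axis reduces to the real case. *)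
Lemma le_normc_cint D f : measurable D -> cintegrable D f ->
  normc (cint D f) <= \int[mu]_(t in D) normc (f t).
Proof.
move=> mD cf; set I := cint D f.
have [->|I0] := eqVneq I 0.
  by rewrite normc0; apply: Rintegral_ge0 => x _; exact: normc_ge0.
rewrite -(@ler_pM2l _ (normc I)) ?normc_gt0//.
have H : normc I * normc I = Re (cint D (fun x => I^* * f x)).
  rewrite cintZ// -/I; case: I {I0} => a b /=; rewrite /normc.
  by rewrite -expr2 sqr_sqrtr ?addr_ge0 ?sqr_ge0// !expr2; ring.
have cI : cintegrable D (fun x => I^* * f x) by exact: cintegrableZ.
have nf := integrable_normc mD cf.
rewrite H /= -RintegralZl//; apply: le_Rintegral => //.
- exact: (cI.1).
- exact: integrable_fctZ.
- move=> x Dx; apply: le_trans (ler_norm _) _.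
  have [+ _] := normr_le_normc (I^* * f x) => /le_trans; apply.
  by rewrite normcM; case: I {I0 H cI} => a b /=; rewrite /normc /= sqrrN.
Qed.

(** The majorant is integrated over the fixed [D], so the bound does not move with [J], which in the
    operators below depends on x. *)
Lemma cint_le D J f h : measurable D -> measurable J ->
  J `<=` D -> cmeas J f -> mu.-integrable D (EFin \o h) -> (forall x, D x -> 0 <= h x) ->
  (forall x, J x -> normc (f x) <= h x) ->
  normc (cint J f) <= \int[mu]_(t in D) h t.
Proof.
move=> mD mJ JD mf ih h0 fh.
have ihJ : mu.-integrable J (EFin \o h) by exact: integrableS ih.
have cf : cintegrable J f by exact: le_cintegrable fh ihJ.
apply: le_trans (le_normc_cint _ cf) _ => //.
apply: (@le_trans _ _ (\int[mu]_(t in J) h t)).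
  by apply: le_Rintegral => //; exact: integrable_normc.
rewrite /Rintegral fine_le//; try exact: integrable_fin_num.
apply: ge0_subset_integral => //.
by move: ih => /measurable_int.
Qed.

End ComplexIntegral.

(** * Mean value estimates for the complex exponential *)

Section ComplexDerivative.
Variable R : realType.
Implicit Types (f g : R -> R[i]) (x : R).

Lemma is_derive_fctD (f g : R -> R) x a b :
  is_derive x 1 f a -> is_derive x 1 g b -> is_derive x 1 (fun t => f t + g t) (a + b).
Proof. by move=> df dg; exact: (is_deriveD df dg). Qed.

Lemma is_derive_fctB (f g : R -> R) x a b :
  is_derive x 1 f a -> is_derive x 1 g b -> is_derive x 1 (fun t => f t - g t) (a - b).
Proof. by move=> df dg; exact: (is_deriveB df dg). Qed.

Lemma is_derive_fctM (f g : R -> R) x a b :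
  is_derive x 1 f a -> is_derive x 1 g b ->
  is_derive x 1 (fun t => f t * g t) (f x * b + g x * a).
Proof. by move=> df dg; exact: (is_deriveM df dg). Qed.

Lemma has_cderiv_cst (z : R[i]) x : has_cderiv (fun=> z) x 0.
Proof. by split; exact: is_derive_cst. Qed.

Lemma has_cderiv_eq f x v w : has_cderiv f x v -> v = w -> has_cderiv f x w.
Proof. by move=> ? <-. Qed.

Lemma has_cderivD f g x v w : has_cderiv f x v -> has_cderiv g x w ->
  has_cderiv (fun t => f t + g t) x (v + w).
Proof.
move=> [fr fi] [gr gi]; rewrite /has_cderiv ReD ImD; split.
  by under eq_fun do rewrite ReD; exact: is_derive_fctD.
by under eq_fun do rewrite ImD; exact: is_derive_fctD.
Qed.

Lemma has_cderivM f g x v w : has_cderiv f x v -> has_cderiv g x w ->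
  has_cderiv (fun t => f t * g t) x (v * g x + f x * w).
Proof.
move=> [fr fi] [gr gi]; rewrite /has_cderiv !(ReD, ImD, ReM, ImM); split.
  under eq_fun do rewrite ReM.
  apply: (is_derive_eq (is_derive_fctB (is_derive_fctM fr gr) (is_derive_fctM fi gi))).
  ring.
under eq_fun do rewrite ImM.
apply: (is_derive_eq (is_derive_fctD (is_derive_fctM fr gi) (is_derive_fctM fi gr))).
ring.
Qed.

Lemma has_cderivZ f (c : R[i]) x v : has_cderiv f x v ->
  has_cderiv (fun t => c * f t) x (c * v).
Proof.
move=> df; apply: has_cderiv_eq (has_cderivM (has_cderiv_cst c x) df) _.
by rewrite mul0r add0r.
Qed.

Lemma has_cderivB f g x v w : has_cderiv f x v -> has_cderiv g x w ->
  has_cderiv (fun t => f t - g t) x (v - w).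
Proof.
move=> df dg; under eq_fun do rewrite -(mulN1r (g _)).
by rewrite -(mulN1r w); apply: has_cderivD => //; exact: has_cderivZ.
Qed.

Lemma has_cderiv_cexp f x v : has_cderiv f x v ->
  has_cderiv (fun t => cexp (f t)) x (v * cexp (f x)).
Proof.
move=> [fr fi]; rewrite /has_cderiv (ReM v (cexp (f x))) (ImM v (cexp (f x))) (Re_cexp (f x)) (Im_cexp (f x)).
have dr := is_derive1_comp (is_derive_expR (Re (f x))) fr.
have ds := is_derive1_comp (is_derive_sin (Im (f x))) fi.
have dc := is_derive1_comp (is_derive_cos (Im (f x))) fi.
split.
  under eq_fun do rewrite Re_cexp.
  by apply: (is_derive_eq (is_derive_fctM dr dc)) => /=; ring.
under eq_fun do rewrite Im_cexp.
by apply: (is_derive_eq (is_derive_fctM dr ds)) => /=; ring.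
Qed.

Lemma has_cderiv_affine (a b : R[i]) x : has_cderiv (fun t : R => b + t%:C * a) x a.
Proof.
have H : has_cderiv (fun t : R => t%:C) x 1.
  by split => /=; [exact: is_derive_id|exact: is_derive_cst].
apply: has_cderiv_eq (has_cderivD (has_cderiv_cst b x) (has_cderivM H (has_cderiv_cst a x))) _.
by rewrite mul1r mulr0 addr0 add0r.
Qed.

(** The real mean value theorem is applied to the real and the imaginary part separately, whence the
    factor 2. *)
Lemma complex_MVT f (f' : R -> R[i]) (B : R) :
  (forall t, has_cderiv f t (f' t)) ->
  (forall t : R, 0 <= t <= 1 -> normc (f' t) <= B) ->
  normc (f 1 - f 0) <= B *+ 2.
Proof.
move=> df f'B.
have key (g g' : R -> R) : (forall t : R, is_derive t (1 : R) g (g' t)) ->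
    (forall t : R, 0 <= t <= 1 -> `|g' t| <= B) -> `|g 1 - g 0| <= B.
  move=> dg gB.
  have cg : {within `[0, 1], continuous g}.
    by apply: derivable_within_continuous => t _; exact: (@ex_derive _ _ _ _ _ _ _ (dg t)).
  have [c] := @MVT_segment R g g' 0 1 ler01 (fun t _ => dg t) cg.
  by rewrite in_itv /= => /gB c01 ->; rewrite subr0 mulr1.
apply: le_trans (normc_le_ReIm _) _; rewrite ReB ImB mulr2n; apply: lerD.
- apply: (key (fun t => Re (f t)) (fun t => Re (f' t))) => t; first exact: (df t).1.
  by move/f'B; apply: le_trans; have [] := normr_le_normc (f' t).
- apply: (key (fun t => Im (f t)) (fun t => Im (f' t))) => t; first exact: (df t).2.
  by move/f'B; apply: le_trans; have [] := normr_le_normc (f' t).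
Qed.

(** Mean value estimate along the segment from [b] to [a], which stays in the half-plane Re <= [B].
    With [B] = 0 it compares two kernels of modulus at most 1. *)
Lemma cexp_lipschitz (a b : R[i]) (B : R) : Re a <= B -> Re b <= B ->
  normc (cexp a - cexp b) <= normc (a - b) * expR B *+ 2.
Proof.
move=> aB bB.
have d t := has_cderiv_cexp (has_cderiv_affine (a - b) b t).
rewrite (_ : cexp a - cexp b = cexp (b + 1%:C * (a - b)) - cexp (b + 0%:C * (a - b))); last first.
  by congr (cexp _ - cexp _); ring.
apply: (complex_MVT d) => t /andP[t0 t1].
rewrite normcM ler_wpM2l ?normc_ge0// normc_cexp ler_expR ReD ReM ReB/= mul0r subr0.
by nra.
Qed.

Lemma cexp_sub1 (w : R[i]) : normc (cexp w - 1) <= normc w * expR (normc w) *+ 2.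
Proof.
rewrite -cexp0 -{2}(subr0 w); apply: cexp_lipschitz; last exact: normc_ge0.
by rewrite (le_trans (ler_norm _))//; have [] := normr_le_normc w.
Qed.

(** The derivative of t |-> exp(t w) - t w is w (exp(t w) - 1), which [cexp_sub1] bounds to first
    order; each of the two mean value steps contributes a factor 2. *)
Lemma cexp_sub1_linear (w : R[i]) :
  normc (cexp w - 1 - w) <= normc w ^+ 2 * expR (normc w) *+ 4.
Proof.
have d t := has_cderivB (has_cderiv_cexp (has_cderiv_affine w 0 t)) (has_cderiv_affine w 0 t).
have -> : cexp w - 1 - w = (cexp (0 + 1%:C * w) - (0 + 1%:C * w)) - (cexp (0 + 0%:C * w) - (0 + 0%:C * w)).
  have -> : 0 + 0%:C * w = 0 by ring.
  rewrite cexp0; have -> : 0 + 1%:C * w = w by ring.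
  by ring.
rewrite (_ : _ *+ 4 = normc w ^+ 2 * expR (normc w) *+ 2 *+ 2); last by rewrite -mulrnA.
apply: (complex_MVT d) => t /andP[t0 t1].
have -> : w * cexp (0 + t%:C * w) - w = w * (cexp (t%:C * w) - 1).
  by rewrite add0r mulrBr mulr1.
rewrite normcM expr2 -mulrA -mulrnAr ler_wpM2l ?normc_ge0//.
apply: le_trans (cexp_sub1 _) _.
have tw : normc (t%:C * w) <= normc w.
  by rewrite normcM normc_real ger0_norm// ler_piMl ?normc_ge0.
by rewrite ler_wMn2r// ler_pM ?normc_ge0 ?expR_ge0// ler_expR.
Qed.

End ComplexDerivative.

(** * Absolutely continuous functions *)

Section AbsolutelyContinuous.
Variable R : realType.
Let mu : {measure set (measurableTypeR R) -> \bar R} := lebesgue_measure.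
Implicit Types (f g h : R -> R[i]) (a b x y : R).

(** Sums, products and exponentials all follow from this criterion; [f1] and [f2] are then the two
    operands, or the same function twice. *)
Lemma AC_dominated a b f1 f2 g (L : R) : 0 <= L ->
  absolutely_continuous_on a b f1 -> absolutely_continuous_on a b f2 ->
  (forall x y, a <= x <= b -> a <= y <= b ->
    normc (g x - g y) <= L * (normc (f1 x - f1 y) + normc (f2 x - f2 y))) ->
  absolutely_continuous_on a b g.
Proof.
move=> L0 ac1 ac2 gL e e0.
(* The 1 added to [L] covers the case [L] = 0. *)
have e'0 : 0 < e / (L + 1) / 2 by rewrite !divr_gt0// ltr_wpDl.
have [d1 d10 h1] := ac1 _ e'0; have [d2 d20 h2] := ac2 _ e'0.
exists (Num.min d1 d2); first by rewrite lt_min d10.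
move=> m u v uv tuv; rewrite lt_min => /andP[s1 s2].
have {}h1 := h1 m u v uv tuv s1; have {}h2 := h2 m u v uv tuv s2.
apply: (@le_lt_trans _ _ (L * (\sum_(i < m) normc (f1 (v i) - f1 (u i)) +
                               \sum_(i < m) normc (f2 (v i) - f2 (u i))))).
  rewrite -big_split /= mulr_sumr; apply: ler_sum => i _.
  by have [? ? ?] := uv i; apply: gL; apply/andP; split => //;
    [exact: le_trans (_ : u i <= _)|exact: le_trans (_ : v i <= _)].
apply: (@le_lt_trans _ _ (L * (e / (L + 1)))).
  by rewrite ler_wpM2l// (splitr (e / (L + 1))) lerD// ltW.
by rewrite mulrCA gtr_pMr// ltr_pdivrMr ?ltr_wpDl// mul1r ltrDl.
Qed.

Lemma AC_cst a b (z : R[i]) : absolutely_continuous_on a b (fun=> z).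
Proof.
move=> e e0; exists 1 => // m u v _ _ _.
by rewrite big1// => i _; rewrite subrr normc0.
Qed.

Lemma AC_add a b f g : absolutely_continuous_on a b f -> absolutely_continuous_on a b g ->
  absolutely_continuous_on a b (fun x => f x + g x).
Proof.
move=> acf acg; apply: (AC_dominated ler01 acf acg) => x y _ _.
rewrite mul1r (le_trans _ (le_normcD _ _))// le_eqVlt; apply/orP; left.
by apply/eqP; congr normc; ring.
Qed.

Lemma AC_unif a b f : absolutely_continuous_on a b f -> forall e, 0 < e ->
  exists2 d, 0 < d & forall x y, a <= x <= b -> a <= y <= b -> `|x - y| < d ->
    normc (f x - f y) < e.
Proof.
move=> acf e /acf[d d0 H]; exists d => //.
move=> x y; wlog xy : x y / y <= x => [hw xab yab|].
  have [/hw|xy] := leP y x; first exact.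
  by rewrite distrC normcB_sym; apply: hw => //; exact: ltW.
move=> /andP[ax xb] /andP[ay yb]; rewrite ger0_norm ?subr_ge0// => xyd.
have := H 1%N (fun=> y) (fun=> x); rewrite !big_ord1; apply => //.
by move=> i j _ _ _; rewrite !ord1.
Qed.

(** Composition with this 1-Lipschitz retraction onto [a, b] extends a function continuously to the
    line, where the extreme value theorem and the measurability of continuous functions apply. *)
Let clamp a b x := Num.max a (Num.min x b).

Let clamp_itv a b x : a <= b -> a <= clamp a b x <= b.
Proof. by move=> ab; rewrite /clamp le_max lexx /= ge_max ab ge_min lexx orbT. Qed.

Let clamp_id a b x : a <= x <= b -> clamp a b x = x.
Proof. by move=> /andP[ax xb]; rewrite /clamp (min_l xb) (max_r ax). Qed.

Let clamp_dist a b x y : `|clamp a b x - clamp a b y| <= `|x - y|.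
Proof.
have H u v c : u - v <= c -> v - u <= c -> 0 <= c ->
    `|Num.max a u - Num.max a v| <= c /\ `|Num.min u b - Num.min v b| <= c.
  move=> h1 h2 h3; split; rewrite ler_norml.
    by case: (leP a u) => ?; case: (leP a v) => ?; apply/andP; split; lra.
  by case: (leP u b) => ?; case: (leP v b) => ?; apply/andP; split; lra.
have [_ h2] := H x y `|x - y| (ler_norm _) (ltac:(by rewrite distrC ler_norm)) (normr_ge0 _).
rewrite /clamp; have [h3 _] := H (Num.min x b) (Num.min y b) `|x - y|
  (le_trans (ler_norm _) h2) (ltac:(by rewrite distrC in h2; exact: le_trans (ler_norm _) h2)) (normr_ge0 _).
exact: h3.
Qed.

Let cont_unif (k : R -> R) : (forall e, 0 < e -> exists2 d, 0 < d & forall x y, `|x - y| < d -> `|k x - k y| < e) -> continuous k.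
Proof.
move=> H x; apply/cvgrPdist_lt => e /H[d d0 kd].
by apply/nbhs_ballP; exists d => //= y xy; exact: kd.
Qed.

Lemma AC_bounded a b f : a <= b -> absolutely_continuous_on a b f ->
  exists2 B, 0 < B & forall x, a <= x <= b -> normc (f x) <= B.
Proof.
move=> ab acf; pose k x := normc (f (clamp a b x)).
have ck : continuous k.
  apply: cont_unif => e /(AC_unif acf)[d d0 fd]; exists d => // x y xy.
  have H : normc (f (clamp a b x) - f (clamp a b y)) < e.
    by apply: fd; rewrite ?clamp_itv// (le_lt_trans (clamp_dist _ _ _ _)).
  have h1 := ler_normc_dist (f (clamp a b x)) (f (clamp a b y)).
  have h2 := ler_normc_dist (f (clamp a b y)) (f (clamp a b x)).
  rewrite (normcB_sym (f (clamp a b y))) in h2.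
  rewrite /k ltr_norml; move: (normc (f (clamp a b x))) (normc (f (clamp a b y))) h1 h2 => p q h1 h2.
  by apply/andP; split; lra.
have [c _ kc] := EVT_max ab (continuous_subspaceT ck).
exists (k c + 1); first by rewrite ltr_wpDl// normc_ge0.
move=> x xab; rewrite -(clamp_id xab); apply: (le_trans (kc x _)); first by rewrite in_itv.
by rewrite lerDl.
Qed.

Lemma AC_cmeas a b f : a <= b -> absolutely_continuous_on a b f -> cmeas `[a, b] f.
Proof.
move=> ab acf; apply: (@eq_cmeas _ _ (f \o clamp a b)).
  by move=> x; rewrite /= in_itv => xab /=; rewrite clamp_id.
apply: (@cmeasS _ setT) => //; split; apply: continuous_measurable_fun;
apply: cont_unif => e /(AC_unif acf)[d d0 fd]; exists d => // x y xy /=.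
- rewrite -ReB; have [/le_lt_trans + _] := normr_le_normc (f (clamp a b x) - f (clamp a b y)).
  by apply; apply: fd; rewrite ?clamp_itv// (le_lt_trans (clamp_dist _ _ _ _)).
- rewrite -ImB; have [_ /le_lt_trans] := normr_le_normc (f (clamp a b x) - f (clamp a b y)).
  by apply; apply: fd; rewrite ?clamp_itv// (le_lt_trans (clamp_dist _ _ _ _)).
Qed.

Lemma AC_mul a b f g : a <= b -> absolutely_continuous_on a b f ->
  absolutely_continuous_on a b g -> absolutely_continuous_on a b (fun x => f x * g x).
Proof.
move=> ab acf acg; have [B B0 fB] := AC_bounded ab acf.
have [B' B'0 gB] := AC_bounded ab acg.
apply: (@AC_dominated _ _ f g _ (B + B')) => // [|x y xab yab]; first by rewrite addr_ge0 ?ltW.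
have -> : f x * g x - f y * g y = (f x - f y) * g x + f y * (g x - g y) by ring.
apply: le_trans (le_normcD _ _) _; rewrite !normcM.
have := gB _ xab; have := fB _ yab.
have := normc_ge0 (f y); have := normc_ge0 (g x).
have := normc_ge0 (f x - f y); have := normc_ge0 (g x - g y); nra.
Qed.

Lemma AC_cexp a b f : a <= b -> absolutely_continuous_on a b f ->
  absolutely_continuous_on a b (fun x => cexp (f x)).
Proof.
move=> ab acf; have [B B0 fB] := AC_bounded ab acf.
apply: (@AC_dominated _ _ f f _ (expR B *+ 2)) => // x y xab yab.
have Ref z : a <= z <= b -> Re (f z) <= B.
  move=> /fB; apply: le_trans; apply: le_trans (ler_norm _) _.
  by have [] := normr_le_normc (f z).
apply: le_trans (cexp_lipschitz (Ref _ xab) (Ref _ yab)) _.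
rewrite mulrnAl ler_wMn2r// mulrC ler_wpM2l ?expR_ge0// lerDl.
exact: normc_ge0.
Qed.

(** Cousin's lemma, by a supremum: around the supremum of the t with [P a t] a local interval links
    a point just below to a point just above, so the supremum is [b] and is attained. *)
Lemma cousin (P : R -> R -> Prop) a b : a <= b ->
  (forall x y z, a <= x <= y -> y <= z <= b -> P x y -> P y z -> P x z) ->
  (forall x, a <= x <= b -> exists2 d, 0 < d & forall u v, a <= u -> u <= x <= v -> v <= b ->
    x - d < u -> v < x + d -> P u v) -> P a b.
Proof.
move=> ab Padd Ploc; pose S := [set t | a <= t <= b /\ P a t].
have Sa : S a.
  split; first by rewrite lexx.
  have [|d d0 H] := Ploc a; first by rewrite lexx.
  by apply: H; rewrite ?lexx ?ltrDl// gtrBl.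
have ubS : ubound S b by move=> t [/andP[]].
have hsS : has_sup S by split; [exists a|exists b].
have as_ : a <= sup S by apply: ub_le_sup => //; case: hsS.
have sb : sup S <= b by apply: ge_sup => //; exists a.
have [|d d0 H] := Ploc (sup S); first by rewrite as_.
have [t [/andP[at_ tb] Pat] dt] := sup_adherent d0 hsS.
have ts : t <= sup S by apply: ub_le_sup => //; [case: hsS|split => //; apply/andP].
pose v := Num.min b (sup S + d / 2).
have sv : sup S <= v by rewrite le_min sb/= lerDl divr_ge0// ltW.
have vb : v <= b by rewrite ge_min lexx.
have Pav : P a v.
  apply: (Padd _ t) => //; first by rewrite lexx.
    by rewrite vb (le_trans ts).
  apply: H => //; first by rewrite ts.
  rewrite /v (le_lt_trans (_ : _ <= sup S + d / 2))//; first by rewrite ge_min lexx orbT.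
  by rewrite ltrD2l ltr_pdivrMr// ltr_pMr// ltr1n.
have : v <= sup S.
  apply: ub_le_sup => //; first by case: hsS.
  by split => //; rewrite vb (le_trans as_).
rewrite /v ge_min => /orP[bs|]; last by rewrite gerDl leNgt divr_gt0.
by have <- : v = b by rewrite /v min_l// (le_trans bs)// lerDl divr_ge0// ltW.
Qed.

(** Collects, in increasing order, the intervals around points of an exceptional null set. The order
    gives disjointness, and concatenation provides the additivity that [cousin] requires. *)
Fixpoint chain (U : set R) u v (s : seq (R * R)) : Prop :=
  if s is (p, q) :: s' then [/\ u <= p, p <= q, `]p, q[ `<=` U & chain U q v s']
  else u <= v.

Lemma chain_le U u v s : chain U u v s -> u <= v.
Proof.
elim: s u => [|[p q] s ih] u //= [up pq _ /ih qv].
by rewrite (le_trans up)// (le_trans pq).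
Qed.

Lemma chain_cat U u v w s s' : chain U u v s -> chain U v w s' -> chain U u w (s ++ s').
Proof.
elim: s u => [|[p q] s ih] u /=; last by move=> [? ? ? ?] ?; split => //; exact: ih.
case: s' => [|[p q] s'] /=; first exact: le_trans.
by move=> uv [vp ? ? ?]; split => //; exact: le_trans vp.
Qed.

Lemma chain_nth U u v s i : chain U u v s -> (i < size s)%N ->
  [/\ u <= (nth (0, 0) s i).1, (nth (0, 0) s i).1 <= (nth (0, 0) s i).2 &
      (nth (0, 0) s i).2 <= v].
Proof.
elim: s u i => [|[p q] s ih] u [|i]//= [up pq _ c] si.
  by split => //; exact: chain_le c.
have [h1 h2 h3] := ih _ _ c si; split => //.
by rewrite (le_trans up)// (le_trans pq).
Qed.

Lemma chain_ordered U u v s i j : chain U u v s -> (i < j)%N -> (j < size s)%N ->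
  (nth (0, 0) s i).2 <= (nth (0, 0) s j).1.
Proof.
elim: s u i j => [|[p q] s ih] u [|i] [|j]//= [up pq _ c] ij sj.
  by have [] := chain_nth c sj.
exact: ih c _ _.
Qed.

(** The first interval is charged to the part of [U] to the left of its right end [q], the remaining
    ones to the part to the right of [q]. *)
Lemma chain_length U u v s : measurable (U : set (measurableTypeR R)) -> chain U u v s ->
  ((\sum_(i < size s) ((nth (0, 0) s i).2 - (nth (0, 0) s i).1))%:E <= mu (U `&` `]u, +oo[))%E.
Proof.
move=> mU; elim: s u => [|[p q] s ih] u /= c; first by rewrite big_ord0.
case: c => up pq pqU c.
rewrite big_ord_recl /= EFinD.
have pqE : ((q - p)%:E <= mu `]p, q[%classic)%E.
  have -> : mu `]p, q[%classic = (if (p%:E < q%:E)%E then q%:E - p%:E else 0)%E.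
    exact: lebesgue_measure_itv.
  rewrite lte_fin; case: ltP => // qp.
  by rewrite lee_fin subr_le0.
apply: le_trans (leeD pqE (ih _ c)) _.
rewrite -measureU//; last 2 first.
- exact: measurableI.
- apply/seteqP; split => // x /= [] /[!in_itv]/= /andP[_ xq] [_] /andP[qx _].
  by have := lt_trans xq qx; rewrite ltxx.
apply: le_measure; rewrite ?inE.
- by apply: measurableU => //; exact: measurableI.
- exact: measurableI.
- move=> x /= [|[Ux]]; rewrite /= !in_itv/= ?andbT.
    move=> /andP[px xq]; split; last by rewrite (le_lt_trans up).
    by apply: pqU; rewrite /= in_itv /= px.
  by move=> qx; split => //; rewrite (le_lt_trans _ qx)// (le_trans up).
Qed.

Lemma is_derive0_small (k : R -> R) (x e : R) : is_derive x (1 : R) k 0 -> 0 < e ->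
  exists2 d, 0 < d & forall y, `|y - x| < d -> `|k y - k x| <= e * `|y - x|.
Proof.
move=> /is_derive1_caratheodory[g [kg cg g0]] e0.
move: cg => /cvgrPdist_lt /(_ _ e0); rewrite g0 => /nbhs_ballP[d /= d0 H].
exists d => // y yd; rewrite kg normrM ler_wpM2r//.
by have := H y; rewrite /ball /= distrC sub0r normrN => /(_ yd)/ltW.
Qed.

(** Off the null set, increments over short intervals are small compared with their length. The null
    set is covered by an open set of measure below the modulus [d] of absolute continuity, in which
    the increments add up to less than [e]. Cousin's lemma patches the two kinds of intervals
    together. *)
Lemma AC_derive0_cst a b h (N : set R) : a <= b -> absolutely_continuous_on a b h ->
  mu.-negligible N -> (forall x, a <= x <= b -> ~ N x -> has_cderiv h x 0) ->
  h b = h a.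
Proof.
move=> ab ach negN dh0.
suff H e : 0 < e -> normc (h b - h a) <= e * (2 * (b - a) + 1).
  apply/eqP; rewrite -subr_eq0 -normc_eq0 eq_le normc_ge0 andbT.
  apply/ler_addgt0Pl => e e0; rewrite addr0.
  have c0 : 0 < 2 * (b - a) + 1 by rewrite ltr_wpDl// mulr_ge0// subr_ge0.
  by have := H (e / (2 * (b - a) + 1)); rewrite divr_gt0// divfK ?gt_eqF// => /(_ isT).
move=> e0; have [d d0 hd] := ach _ e0.
have [N' [mN' N'0 NN']] := negN.
have N'oo : (mu N' < +oo)%E by rewrite [mu N'](_ : _ = 0%E) ?ltey.
have [U [oU N'U Ud]] := lebesgue_regularity_outer mN' N'oo d0.
have mU : measurable (U : set (measurableTypeR R)) by exact: open_measurable.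
have muU : (mu U < d%:E)%E.
  rewrite -(setDUK N'U) setUC measureU0//; exact: measurableD.
pose dh (pq : R * R) := normc (h pq.2 - h pq.1).
(* Increments over the intervals of [s] are kept as they are; all others are already estimated by 2
   [e] per unit length. *)
pose P u v := exists s, chain U u v s /\
  normc (h v - h u) <= e * 2 * (v - u) + \sum_(i < size s) dh (nth (0, 0) s i).
have [s [cs hs]] : P a b.
  apply: cousin => //.
    move=> x y z /andP[_ xy] /andP[yz _] [s [cs hs]] [s' [cs' hs']].
    exists (s ++ s'); split; first exact: chain_cat cs cs'.
    apply: le_trans (normc_triangle _ _ (h y)) _.
    have -> : \sum_(i < size (s ++ s')) dh (nth (0, 0) (s ++ s') i) =
        \sum_(i < size s) dh (nth (0, 0) s i) + \sum_(i < size s') dh (nth (0, 0) s' i).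
      have T (w : seq (R * R)) : \sum_(i < size w) dh (nth (0, 0) w i) = \sum_(x <- w) dh x.
        by rewrite (big_nth (0, 0)) big_mkord.
      by rewrite !T big_cat.
    by lra.
  (* At a point of the null set the whole interval becomes a link of the chain; elsewhere the
     vanishing derivative pays for it and the chain is empty. *)
  move=> x xab; have [Nx|Nx] := pselect (N' x).
    have /nbhs_ballP[r /= r0 rU] : nbhs x U by apply: open_nbhs_nbhs; split => //; exact: N'U.
    exists r => // u v au /andP[ux xv] vb xu vx; exists [:: (u, v)]; split.
      split => //=; first exact: le_trans xv.
      move=> t /=; rewrite in_itv /= => /andP[ut tv]; apply: rU.
      by rewrite /ball /= ltr_norml; apply/andP; split; lra.
    have uv0 : 0 <= v - u by rewrite subr_ge0 (le_trans ux).
    by rewrite big_ord1 /= lerDr mulr_ge0// mulr_ge0// ltW.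
  have [dr di] := dh0 _ xab (contra_not (NN' x) Nx).
  have [d1 d10 H1] := is_derive0_small dr e0.
  have [d2 d20 H2] := is_derive0_small di e0.
  exists (Num.min d1 d2); first by rewrite lt_min d10.
  move=> u v au /andP[ux xv] vb xu vx; exists [::]; split; first exact: le_trans xv.
  rewrite big_ord0 addr0.
  have loc y : `|y - x| < Num.min d1 d2 -> normc (h y - h x) <= e * 2 * `|y - x|.
    rewrite lt_min => /andP[/H1 h1 /H2 h2].
    by apply: le_trans (normc_le_ReIm _) _; rewrite ReB ImB; lra.
  have lu : `|u - x| = x - u by rewrite distrC ger0_norm ?subr_ge0.
  have lv : `|v - x| = v - x by rewrite ger0_norm ?subr_ge0.
  have := loc u; have := loc v; rewrite lu lv.
  have := normc_triangle (h v) (h u) (h x); rewrite (normcB_sym (h x)).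
  have vm : v - x < Num.min d1 d2 by lra.
  have um : x - u < Num.min d1 d2 by lra.
  by move=> h3 /(_ vm) h1 /(_ um) h2; lra.
apply: le_trans hs _.
have -> : e * (2 * (b - a) + 1) = e * 2 * (b - a) + e by ring.
rewrite lerD2l ltW//.
apply: (hd _ (fun i : 'I_(size s) => (nth (0, 0) s i).1) (fun i => (nth (0, 0) s i).2)).
- by move=> i; have [? ? ?] := chain_nth cs (ltn_ord i).
- move=> i j _ _ [x [/=]]; rewrite !in_itv/= => /andP[ix xi] /andP[jx xj].
  apply/val_inj => /=; case: (ltngtP i j) => // ij.
    have := lt_trans (lt_le_trans xi (chain_ordered cs ij (ltn_ord j))) jx.
    by rewrite ltxx.
  have := lt_trans (lt_le_trans xj (chain_ordered cs ij (ltn_ord i))) ix.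
  by rewrite ltxx.
- rewrite -lte_fin; apply: le_lt_trans (chain_length mU cs) _.
  apply: le_lt_trans muU; apply: le_measure; rewrite ?inE//; first exact: measurableI.
Qed.

End AbsolutelyContinuous.

(** * Indefinite integrals: absolute continuity and differentiation almost everywhere *)

Section Primitives.
Variable R : realType.
Let mu : {measure set (measurableTypeR R) -> \bar R} := lebesgue_measure.
Implicit Types (f g h : R -> R[i]) (a b x y : R).

Definition cloc f := forall T : R, 0 < T -> cintegrable `[0, T] f.

Lemma cint_set1 f x : cint `[x, x] f = 0.
Proof.
rewrite /cint set_itv1; apply: complexP => /=; exact: Rintegral_set1.
Qed.

Lemma cint_split f x (b : itv_bound R) : 0 <= x -> (BRight x <= b)%O ->
  cintegrable [set` Interval (BLeft 0) b] f ->
  cint [set` Interval (BLeft 0) b] f = cint `[0, x] f + cint [set` Interval (BLeft x) b] f.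
Proof.
move=> x0 xb [fr fi].
have E (k : R -> R) : mu.-integrable [set` Interval (BLeft 0) b] (EFin \o k) ->
    (\int[mu]_(t in [set` Interval (BLeft 0) b]) k t =
     \int[mu]_(t in `[0%R, x]) k t + \int[mu]_(t in [set` Interval (BLeft x) b]) k t)%R.
  move=> ik; rewrite -(Rintegral_itv_obnd_cbnd (r := x)); last first.
    apply: integrableS ik => //; apply: subset_itvr; rewrite bnd_simp//.
  rewrite -(Rintegral_itvB ik) ?bnd_simp//.
  by rewrite addrC subrK.
by rewrite /cint (E _ fr) (E _ fi).
Qed.

Lemma clocP f a b : 0 <= a -> cloc f -> cintegrable `[a, b] f.
Proof.
move=> a0 lf; have [b0|b0] := ltP 0 b.
  apply: cintegrableS (lf _ b0) => //.
  by apply: subset_itvr; rewrite bnd_simp.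
have [E|E] := eqVneq a b.
  rewrite -E set_itv1; have H := lf 1 ltr01.
  have {E b0} -> : a = 0 by apply/eqP; rewrite eq_le a0 E b0.
  apply: cintegrableS H => //.
    by move=> t ->; rewrite /= in_itv /= lexx ler01.
rewrite set_itv_ge; last by rewrite bnd_simp -ltNge lt_neqAle eq_sym E (le_trans b0).
by split; exact: integrable_set0.
Qed.

Lemma cint_itvB f a b : 0 <= a -> a <= b -> cloc f ->
  cint `[0, b] f - cint `[0, a] f = cint `[a, b] f.
Proof.
move=> a0 ab lf; rewrite (@cint_split f a (BRight b))//; last exact: clocP.
by rewrite addrC addKr.
Qed.

Lemma integrable_fctB D (h1 h2 : R -> R) : measurable (D : set (measurableTypeR R)) ->
  mu.-integrable D (EFin \o h1) -> mu.-integrable D (EFin \o h2) ->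
  mu.-integrable D (EFin \o (fun x => h1 x - h2 x)).
Proof. by move=> mD i1 i2; exact: (integrableB mD i1 i2). Qed.

Lemma measurable_minc D (k : R -> R) (N : R) : measurable_fun (D : set (measurableTypeR R)) k ->
  measurable_fun (D : set (measurableTypeR R)) (fun x => Num.min (k x) N).
Proof. by move=> mk; apply: (measurable_minr mk); exact: measurable_cst. Qed.

Lemma integrable_minc D (k : R -> R) (N : R) : measurable (D : set (measurableTypeR R)) ->
  (forall x, 0 <= k x) -> 0 <= N -> mu.-integrable D (EFin \o k) ->
  mu.-integrable D (EFin \o (fun x => Num.min (k x) N)).
Proof.
move=> mD k0 N0 ik; apply: (le_integrable mD _ _ ik).
  have /measurable_int/measurable_EFinP mk := ik.
  by apply/measurable_EFinP; exact: measurable_minc.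
move=> x _ /=; have m0 : 0 <= Num.min (k x) N by rewrite le_min k0.
by rewrite lee_fin (ger0_norm m0) (ger0_norm (k0 x)) ge_min lexx.
Qed.

Lemma truncation_small D (k : R -> R) (e : R) : measurable (D : set (measurableTypeR R)) ->
  (forall x, 0 <= k x) -> mu.-integrable D (EFin \o k) -> 0 < e ->
  exists N : nat, (\int[mu]_(t in D) (k t - Num.min (k t) N%:R) < e)%R.
Proof.
move=> mD k0 ik e0.
have /measurable_int/measurable_EFinP mk := ik.
pose F (N : nat) x := (k x - Num.min (k x) N%:R)%:E.
have F0 N x : (0 <= F N x)%E by rewrite lee_fin subr_ge0 ge_min lexx.
have [] := @dominated_convergence _ _ R mu D mD F (fun=> 0%E) (EFin \o k).
- by move=> N; apply/measurable_EFinP; apply: measurable_funB => //; exact: measurable_minc.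
- exact: measurable_cst.
- apply: aeW => x _; apply: cvg_near_cst; near=> N.
  rewrite /F min_l ?subrr//; near: N.
  exists (Num.bound (k x)) => // N /= hN.
  have := archi_boundP (k0 x); move=> /ltW/le_trans; apply.
  by rewrite ler_nat.
- exact: ik.
- apply: aeW => x N _; rewrite gee0_abs//= lee_fin gerBl le_min k0 ler0n //.
- move=> _ _; rewrite integral0 => /fine_cvgP[_ /cvgrPdist_lt /(_ _ e0)].
  case=> N _ /(_ N (leqnn N)) /=; rewrite sub0r normrN => /(le_lt_trans (ler_norm _)) H.
  by exists N.
Unshelve. all: end_near. Qed.

Lemma sum_disjoint_integral_le D (k : R -> R) (m : nat) (E : 'I_m -> set R) :
  measurable (D : set (measurableTypeR R)) ->
  (forall x, 0 <= k x) -> mu.-integrable D (EFin \o k) ->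
  (forall i, measurable (E i : set (measurableTypeR R))) -> (forall i, E i `<=` D) ->
  trivIset [set: 'I_m] E ->
  (\sum_(i < m) \int[mu]_(t in E i) k t <= \int[mu]_(t in D) k t)%R.
Proof.
move=> mD k0 ik mE ED tE.
have iE i : mu.-integrable (E i) (EFin \o k) by exact: integrableS ik.
rewrite -lee_fin -sumEFin.
under eq_bigr do rewrite /Rintegral fineK ?integrable_fin_num//.
rewrite /Rintegral fineK ?integrable_fin_num//.
have mk : measurable_fun (D : set (measurableTypeR R)) (EFin \o k) by exact: measurable_int ik.
have subU : \big[setU/set0]_(i <- index_enum 'I_m) E i `<=` D.
  by elim/big_ind : _ => // A B AD BD x [/AD|/BD].
rewrite -(@ge0_integral_bigsetU _ _ _ mu _ E (EFin \o k) (index_enum 'I_m))//.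
- apply: ge0_subset_integral => //.
  + by apply: bigsetU_measurable.
  + by move=> x _; rewrite lee_fin.
- exact: index_enum_uniq.
- by apply: sub_trivIset tE.
- apply: measurable_funS mk => //.
  by move=> x _; rewrite lee_fin.
Qed.

(** Split |f| into min(|f|, N) and a remainder of integral below [e] / 2. The first part contributes
    at most N times the total length, the second at most its full integral, because the intervals
    are disjoint. *)
Lemma AC_cint f (T : R) : cloc f -> 0 < T ->
  absolutely_continuous_on 0 T (fun x => cint `[0, x] f).
Proof.
move=> lf T0 e e0; pose k x := normc (f x).
have k0 x : 0 <= k x by exact: normc_ge0.
have ik : mu.-integrable `[0, T] (EFin \o k) by apply: integrable_normc => //; exact: lf.
have mT : measurable (`[0%R, T]%classic : set (measurableTypeR R)) by [].
have [N HN] := truncation_small mT k0 ik (divr_gt0 e0 (ltr0n _ 2)).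
exists (e / 2 / N.+1%:R); first by rewrite !divr_gt0.
move=> m u v uv tuv suv.
pose k' t := k t - Num.min (k t) N%:R.
have k'0 t : 0 <= k' t by rewrite subr_ge0 ge_min lexx.
have ikm : mu.-integrable `[0, T] (EFin \o (fun t => Num.min (k t) N%:R)).
  exact: integrable_minc.
have ik' : mu.-integrable `[0, T] (EFin \o k') by exact: integrable_fctB.
have sub i : `]u i, v i[%classic `<=` `[0, T]%classic.
  by have [h1 h2 h3] := uv i; apply: subset_itv; rewrite bnd_simp.
have main i : normc (cint `[0, v i] f - cint `[0, u i] f) <=
    \int[mu]_(t in `]u i, v i[) k' t + N%:R * (v i - u i).
  have [h1 h2 h3] := uv i.
  have iuv : cintegrable `]u i, v i[ f by apply: cintegrableS (lf _ T0).
  have -> : cint `[0, v i] f - cint `[0, u i] f = cint `]u i, v i[ f.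
    rewrite cint_itvB//; have [cr ci] := clocP (v i) h1 lf.
    have E (g : R -> R) : mu.-integrable `[u i, v i] (EFin \o g) ->
        (\int[mu]_(t in `[u i, v i]) g t = \int[mu]_(t in `]u i, v i[) g t)%R.
      move=> ig; rewrite Rintegral_itv_bndo_bndc; last first.
        by apply: integrableS ig => //; apply: subset_itv; rewrite bnd_simp.
      rewrite Rintegral_itv_obnd_cbnd//.
      by apply: integrableS ig => //; apply: subset_itv; rewrite bnd_simp.
    by rewrite /cint (E _ cr) (E _ ci).
  apply: le_trans (le_normc_cint _ iuv) _ => //.
  have -> : (\int[mu]_(t in `]u i, v i[) normc (f t) =
     \int[mu]_(t in `]u i, v i[) k' t + \int[mu]_(t in `]u i, v i[) Num.min (k t) N%:R)%R.
    rewrite -RintegralD//; [|exact: integrableS ik'|exact: integrableS ikm].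
    by apply: eq_Rintegral => t _; rewrite /k' subrK.
  rewrite lerD2l.
  have muE : mu `]u i, v i[%classic = (v i - u i)%:E.
    rewrite [LHS](lebesgue_measure_itv `]u i, v i[) /= lte_fin.
    by case: ltP => // vu; rewrite (_ : v i = u i) ?subrr//; apply/eqP; rewrite eq_le h2 vu.
  apply: (@le_trans _ _ (\int[mu]_(t in `]u i, v i[) N%:R)%R).
    apply: le_Rintegral => //; first exact: integrableS ikm.
      apply: measurable_bounded_integrable => //; first by rewrite muE ltey.
      exact: bounded_cst.
    by move=> t _; rewrite ge_min lexx orbT.
  by rewrite Rintegral_cst// muE.
apply: (@le_lt_trans _ _ (\sum_(i < m) (\int[mu]_(t in `]u i, v i[) k' t + N%:R * (v i - u i)))).
  by apply: ler_sum => i _; exact: main.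
rewrite big_split /= -mulr_sumr (splitr e); apply: ltr_leD.
  apply: le_lt_trans HN; exact: (@sum_disjoint_integral_le `[0, T]).
apply: (@le_trans _ _ (N%:R * (e / 2 / N.+1%:R))); first by rewrite ler_wpM2l// ltW.
by rewrite mulrCA ler_piMr ?divr_ge0 ?(ltW e0)// ler_pdivrMr// mul1r ler_nat.
Qed.

(** Lebesgue differentiation is applied to the function cut to zero on ]-oo,
    0[, whose integral over ]-oo, y] is the integral over [0, y]. *)
Lemma cint_ae_derive f : cloc f ->
  {ae mu, forall x, 0 <= x -> has_cderiv (fun x => cint `[0, x] f) x (f x)}.
Proof.
move=> lf.
have key (k : R -> R) : (forall T, 0 < T -> mu.-integrable `[0, T] (EFin \o k)) ->
    {ae mu, forall x : R, 0 <= x -> is_derive x (1 : R) (fun x => (\int[mu]_(t in `[0%R, x]) k t)%R) (k x)}.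
  move=> lk; pose D : set R := `[0, +oo[%classic.
  have restE : EFin \o (k \_ D) = (EFin \o k) \_ D.
    by apply/funext => x /=; rewrite !patchE; case: ifPn.
  have mD : measurable (D : set (measurableTypeR R)) by exact: measurable_itv.
  have NyD y : `]-oo, y]%classic `&` D = `[0, y]%classic.
    apply/seteqP; split => x /=; rewrite /D /= !in_itv/= andbT.
      by move=> [-> ->].
    by move=> /andP[].
  have iy y : mu.-integrable `]-oo, y] (EFin \o (k \_ D)).
    rewrite restE; apply/integrable_restrict => //; rewrite NyD.
    have h : mu.-integrable `[0, Num.max 1 y] (EFin \o k) by apply: lk; rewrite lt_max ltr01.
    by apply: integrableS h => //; apply: subset_itvl; rewrite bnd_simp le_max lexx orbT.
  have loc : locally_integrable [set: R] (k \_ D).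
    have mkD : measurable_fun ([set: R] : set (measurableTypeR R)) (k \_ D).
      apply/(measurable_restrictT k mD).
      have -> : D = \bigcup_n `[0, n.+1%:R]%classic.
        apply/seteqP; split => x /=; rewrite /D /= in_itv/= ?andbT => x0.
          exists (Num.bound x) => //=; rewrite in_itv/= x0/=.
          by rewrite (le_trans (ltW (archi_boundP x0)))// ler_nat.
        by case: x0 => n _ /=; rewrite in_itv/= => /andP[].
      apply/measurable_fun_bigcup => // n.
      by have /measurable_int/measurable_EFinP := lk n.+1%:R (ltr0Sn _ _).
    split => //; first exact: openT.
    move=> K _ cK; have /compact_bounded[M [Mr HM]] := cK.
    have := HM (`|M| + 1); rewrite (le_lt_trans (ler_norm _)) ?ltrDl// => /(_ isT) {}HM.
    have M0 : 0 < `|M| + 1 by rewrite ltr_wpDl.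
    have mK : measurable (K : set (measurableTypeR R)) by exact: compact_measurable.
    have : mu.-integrable K (EFin \o (k \_ D)); last by move=> /integrableP[].
    rewrite restE.
    apply/integrable_restrict => //.
    apply: integrableS (lk _ M0) => //; first exact: measurableI.
    by move=> x [/= Kx]; rewrite /D/= !in_itv/= andbT => x0; rewrite x0 (le_trans (ler_norm _))// HM.
  have := FTC1Ny iy loc.
  apply: (@filterS _ _ (ae_filter_ringOfSetsType mu)) => x [+ +] x0.
  rewrite derive1E patchE mem_set; last by rewrite /D/= in_itv/= x0.
  have -> : (fun y : R => (\int[mu]_(t in `]-oo, y]) (k \_ D) t)%R) =
            (fun y : R => (\int[mu]_(t in `[0%R, y]) k t)%R).
    by apply/funext => y; rewrite -NyD Rintegral_mkcondr.
  by move=> dG <-; exact: derivableP.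
have h1 := key (fun t => Re (f t)) (fun T T0 => (lf T T0).1).
have h2 := key (fun t => Im (f t)) (fun T T0 => (lf T T0).2).
apply: (@filterS2 _ _ (ae_filter_ringOfSetsType mu)) h1 h2 => x h1 h2 x0; split; [exact: h1|exact: h2].
Qed.

End Primitives.

(** * Calculus of locally absolutely continuous functions *)

Section ACder.
Variable R : realType.
Let mu : {measure set (measurableTypeR R) -> \bar R} := lebesgue_measure.
Implicit Types (f g h : R -> R[i]) (a b x y T : R).

(** The derivative is carried along as a function that matters almost everywhere only; its local
    integrability is supplied separately, through [cloc], when it is integrated. *)
Definition ACder f (f' : R -> R[i]) : Prop :=
  (forall T, 0 < T -> absolutely_continuous_on 0 T f) /\
  {ae mu, forall x : R, 0 <= x -> has_cderiv f x (f' x)}.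

Let aeF := ae_filter_ringOfSetsType mu.

Lemma ACder_ae f f' g' : ACder f f' -> {ae mu, forall x : R, 0 <= x -> f' x = g' x} ->
  ACder f g'.
Proof.
move=> [acf df] fg; split => //; apply: (@filterS2 _ _ aeF) df fg => x df fg x0.
by rewrite -fg//; exact: df.
Qed.

Lemma ACder_eq f f' g' : ACder f f' -> (forall x, 0 <= x -> f' x = g' x) -> ACder f g'.
Proof. by move=> df fg; apply: ACder_ae df _; apply: aeW => x x0; exact: fg. Qed.

Lemma ACder_cst (z : R[i]) : ACder (fun=> z) (fun=> 0).
Proof.
split => [T T0|]; first exact: AC_cst.
by apply: aeW => x _; exact: has_cderiv_cst.
Qed.

Lemma ACderD f f' g g' : ACder f f' -> ACder g g' ->
  ACder (fun x => f x + g x) (fun x => f' x + g' x).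
Proof.
move=> [acf df] [acg dg]; split => [T T0|]; first by apply: AC_add; [exact: acf|exact: acg].
by apply: (@filterS2 _ _ aeF) df dg => x df dg x0; apply: has_cderivD; [exact: df|exact: dg].
Qed.

Lemma ACderM f f' g g' : ACder f f' -> ACder g g' ->
  ACder (fun x => f x * g x) (fun x => f' x * g x + f x * g' x).
Proof.
move=> [acf df] [acg dg]; split => [T T0|].
  by apply: AC_mul; [exact: ltW|exact: acf|exact: acg].
by apply: (@filterS2 _ _ aeF) df dg => x df dg x0; apply: has_cderivM; [exact: df|exact: dg].
Qed.

Lemma ACderZ (c : R[i]) f f' : ACder f f' -> ACder (fun x => c * f x) (fun x => c * f' x).
Proof.
move=> df; apply: ACder_eq (ACderM (ACder_cst c) df) _ => x _.
by rewrite mul0r add0r.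
Qed.

Lemma ACderB f f' g g' : ACder f f' -> ACder g g' ->
  ACder (fun x => f x - g x) (fun x => f' x - g' x).
Proof.
move=> df dg; under eq_fun do rewrite -(mulN1r (g _)).
apply: ACder_eq (ACderD df (ACderZ (-1) dg)) _ => x _.
by rewrite mulN1r.
Qed.

Lemma ACder_sum (I : Type) (s : seq I) (F F' : I -> R -> R[i]) :
  (forall i, ACder (F i) (F' i)) ->
  ACder (fun x => \sum_(i <- s) F i x) (fun x => \sum_(i <- s) F' i x).
Proof.
move=> dF; elim: s => [|i s ih].
  have -> : (fun x => \sum_(i <- [::]) F i x) = (fun=> 0) by apply/funext => x; rewrite big_nil.
  by apply: ACder_eq (ACder_cst 0) _ => x _; rewrite big_nil.
have -> : (fun x => \sum_(j <- i :: s) F j x) = (fun x => F i x + \sum_(j <- s) F j x).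
  by apply/funext => x; rewrite big_cons.
by apply: ACder_eq (ACderD (dF i) ih) _ => x _; rewrite big_cons.
Qed.

Lemma ACder_cexp f f' : ACder f f' -> ACder (fun x => cexp (f x)) (fun x => f' x * cexp (f x)).
Proof.
move=> [acf df]; split => [T T0|]; first by apply: AC_cexp; [exact: ltW|exact: acf].
by apply: (@filterS _ _ aeF) df => x df x0; apply: has_cderiv_cexp; exact: df.
Qed.

Lemma ACder_cint f : cloc f -> ACder (fun x => cint `[0, x] f) f.
Proof. by move=> lf; split => [T T0|]; [exact: AC_cint|exact: cint_ae_derive]. Qed.

(** The derivative is two-sided, so at 0 it would see values at negative arguments; the point 0 is
    discarded as a null set. *)
Lemma ACder_eqf f g f' : (forall x, 0 <= x -> f x = g x) -> ACder f f' -> ACder g f'.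
Proof.
move=> fg [acf df]; split => [T T0|].
  move=> e e0; have [d d0 H] := acf _ T0 _ e0; exists d => // m u v uv tuv suv.
  have := H m u v uv tuv suv; apply: le_lt_trans; apply: ler_sum => i _.
  by have [u0 uvi _] := uv i; rewrite !fg// (le_trans u0).
have n0 : {ae mu, forall x : R, x != 0}.
  exists [set 0]; split; [exact: measurable_set1|exact: lebesgue_measure_set1|].
  by move=> x /= /negP; rewrite negbK => /eqP.
apply: (@filterS2 _ _ aeF) df n0 => x df xn0 x0.
have [dr di] := df x0.
have x0' : 0 < x by rewrite lt_neqAle eq_sym xn0.
have fgN : \forall y \near x, f y = g y.
  apply/nbhs_ballP; exists x => //= y; rewrite /ball/= => xy; apply: fg.
  by rewrite -(opprB y) normrN in xy; have := ler_norm (x - y); rewrite distrC; lra.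
split.
  by apply: (near_eq_is_derive _ dr); apply: filterS fgN => y ->.
by apply: (near_eq_is_derive _ di); apply: filterS fgN => y ->.
Qed.

(** The function minus the primitive of its derivative is absolutely continuous with derivative 0
    almost everywhere, hence constant. *)
Lemma ACder_FTC f f' a b : ACder f f' -> cloc f' -> 0 <= a -> a <= b ->
  f b - f a = cint `[a, b] f'.
Proof.
move=> df lf' a0 ab; rewrite -cint_itvB//.
have [b0|b0] := ltP 0 b; last first.
  have E : a = b by apply/eqP; rewrite eq_le ab (le_trans b0).
  by rewrite E !subrr.
have [ach dh] := ACderB df (ACder_cint lf').
suff H c : 0 <= c <= b -> f c - cint `[0, c] f' = f 0 - cint `[0, 0] f'.
  have /(_ b) := H; rewrite (ltW b0) lexx => /(_ isT) Hb.
  have /(_ a) := H; rewrite a0 ab => /(_ isT) Ha.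
  have : f b - cint `[0, b] f' = f a - cint `[0, a] f' by rewrite Hb Ha.
  by move=> /eqP; rewrite subr_eq addrAC -addrA -subr_eq0 => /eqP; move: (cint _ _) (cint _ _) => u v E; apply/eqP; rewrite -subr_eq0; apply/eqP; rewrite -E; ring.
move=> /andP[c0]; have [c0'|c0' _] := ltP 0 c; last first.
  by have -> : c = 0 by apply/eqP; rewrite eq_le c0' c0.
move=> cb; apply: (@AC_derive0_cst _ 0 c (fun c => f c - cint `[0, c] f')) c0 (ach _ c0') dh _.
by move=> x /andP[x0 _] /= /contrapT /(_ x0); rewrite subrr.
Qed.

Lemma itv0y_bigcup : (`[0%R, +oo[%classic : set R) = \bigcup_n `[0%R, n.+1%:R]%classic.
Proof.
apply/seteqP; split => x /=; rewrite in_itv/= ?andbT => x0.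
  exists (Num.bound x) => //=; rewrite in_itv/= x0/=.
  by rewrite (le_trans (ltW (archi_boundP x0)))// ler_nat.
by case: x0 => n _ /=; rewrite in_itv/= => /andP[].
Qed.

Lemma cmeas_0y f : (forall T, 0 < T -> cmeas `[0, T] f) -> cmeas `[0, +oo[ f.
Proof.
move=> mf; split; rewrite itv0y_bigcup; apply/measurable_fun_bigcup => // n.
  exact: (mf _ (ltr0Sn _ _)).1.
exact: (mf _ (ltr0Sn _ _)).2.
Qed.

Lemma sub_itv0y a b : 0 <= a -> `[a, b]%classic `<=` (`[0%R, +oo[%classic : set R).
Proof. by move=> a0 x /=; rewrite !in_itv/= andbT => /andP[ax _]; exact: le_trans ax. Qed.

Lemma ACder_cmeas f f' : ACder f f' -> cmeas `[0, +oo[ f.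
Proof. by move=> [acf _]; apply: cmeas_0y => T T0; apply: AC_cmeas; [exact: ltW|exact: acf]. Qed.

Lemma cloc_cmeas f : cloc f -> cmeas `[0, +oo[ f.
Proof. by move=> lf; apply: cmeas_0y => T T0; exact: cintegrable_meas (lf _ T0). Qed.

Lemma ACder_bounded f f' T : 0 <= T -> ACder f f' ->
  exists2 B, 0 < B & forall x, 0 <= x <= T -> normc (f x) <= B.
Proof.
move=> T0 [acf _]; have T1 : 0 < T + 1 by rewrite ltr_wpDl.
have [B B0 H] := AC_bounded (ltW T1) (acf _ T1); exists B => // x /andP[x0 xT].
by apply: H; rewrite x0 (le_trans xT)// lerDl.
Qed.

Lemma clocD f g : cloc f -> cloc g -> cloc (fun x => f x + g x).
Proof. by move=> lf lg T T0; apply: cintegrableD => //; [exact: lf|exact: lg]. Qed.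

Lemma clocZ (c : R[i]) f : cloc f -> cloc (fun x => c * f x).
Proof. by move=> lf T T0; apply: cintegrableZ => //; exact: lf. Qed.

Lemma cloc_sum (I : Type) (s : seq I) (F : I -> R -> R[i]) :
  (forall i, cloc (F i)) -> cloc (fun x => \sum_(i <- s) F i x).
Proof. by move=> lF T T0; apply: cintegrable_sum => // i; exact: lF. Qed.

Lemma eq_cloc f g : (forall x, 0 <= x -> f x = g x) -> cloc f -> cloc g.
Proof.
move=> fg lf T T0; apply: eq_cintegrable (lf _ T0) => //.
by move=> x; rewrite /= in_itv/= => /andP[x0 _]; exact: fg.
Qed.

Lemma cloc_mul f g : cmeas `[0, +oo[ g ->
  (forall T, 0 < T -> exists B, forall x, 0 <= x <= T -> normc (g x) <= B) ->
  cloc f -> cloc (fun x => g x * f x).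
Proof.
move=> mg bg lf T T0; have [B gB] := bg _ T0.
apply: (@cintegrableM _ _ _ _ B); [by []| |by move=> x /=; rewrite in_itv => /gB|exact: lf].
by apply: cmeasS mg; [exact: measurable_itv|exact: sub_itv0y].
Qed.

Lemma ACder_cloc_mul f g g' : ACder g g' -> cloc f -> cloc (fun x => g x * f x).
Proof.
move=> dg; apply: cloc_mul; first exact: ACder_cmeas dg.
by move=> T /ltW T0; have [B _ HB] := ACder_bounded T0 dg; exists B.
Qed.

Lemma cintegrable_cloc f : cintegrable `[0, +oo[ f -> cloc f.
Proof.
move=> cf T T0; apply: cintegrableS cf => //.
exact: sub_itv0y.
Qed.

Lemma cint_itvy f x : 0 <= x -> cintegrable `[0, +oo[ f ->
  cint `[x, +oo[ f = cint `[0, +oo[ f - cint `[0, x] f.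
Proof. by move=> x0 cf; rewrite (@cint_split _ f x +oo%O)// addrC addKr. Qed.

End ACder.

(** * A uniform Riemann-Lebesgue lemma *)

Section Oscillation.
Variables (R : realType) (rho : R -> R).
Let mu : {measure set (measurableTypeR R) -> \bar R} := lebesgue_measure.
Let D0 : set (measurableTypeR R) := `[0%R, +oo[%classic.
Let rhoC t : R[i] := (rho t)%:C.
Let p := primitive rho.
Let aeF := ae_filter_ringOfSetsType mu.
Implicit Types (f g w q : R -> R[i]) (c u v : R) (J : set R).

Lemma measurable_0y : measurable D0.
Proof. exact: measurable_itv. Qed.
Let mD0 := measurable_0y.

Lemma cintegrable_real D (k : R -> R) : mu.-integrable D (EFin \o k) -> cintegrable D (fun t => (k t)%:C).
Proof. by move=> ik; split => //; exact: (integrable0 mu). Qed.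

Lemma cint_real D (k : R -> R) : cint D (fun t => (k t)%:C) = (\int[mu]_(t in D) k t)%R%:C.
Proof. by rewrite /cint /=; congr (_ +i* _); rewrite /Rintegral integral0. Qed.

Hypothesis cI : cond_I rho.

Lemma cloc_rho : cloc rhoC.
Proof.
move=> T T0; apply: cintegrable_real; have H := cI.1 _ (ltr_wpDr ler01 T0).
apply: integrableS H => //.
by apply: subset_itvl; rewrite bnd_simp ltrDl.
Qed.

Lemma primitiveE x : (p x)%:C = cint `[0, x] rhoC.
Proof. by rewrite cint_real. Qed.

Lemma ACder_primitive : ACder (fun x => (p x)%:C) rhoC.
Proof.
have -> : (fun x => (p x)%:C) = (fun x => cint `[0, x] rhoC) by apply/funext => x; exact: primitiveE.
exact: ACder_cint cloc_rho.
Qed.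

Lemma primitive_mono x y : 0 <= x -> x <= y -> p x <= p y.
Proof.
move=> x0 xy; rewrite -subr_ge0.
have E : ((p y - p x)%:C : R[i]) = (\int[mu]_(t in `[x, y]) rho t)%R%:C.
  by rewrite -cint_real -cint_itvB//; [rewrite rmorphB /= !primitiveE|exact: cloc_rho].
move/complexI : E => ->.
have [/measurable_int mr _] := clocP y x0 cloc_rho.
(* [rho] is positive almost everywhere only, so it is replaced by its modulus under the integral
   before positivity is used. *)
have -> : (\int[mu]_(t in `[x, y]) rho t = \int[mu]_(t in `[x, y]) `|rho t|)%R.
  congr fine; apply: ae_eq_integral => //.
    by apply/measurable_EFinP; apply: measurableT_comp => //; exact/measurable_EFinP.
  apply: (@filterS _ _ aeF) cI.2 => t rt /=; rewrite in_itv/= => /andP[xt _].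
  by rewrite gtr0_norm// rt// (le_trans x0).
exact: Rintegral_ge0.
Qed.

Lemma primitive0 : p 0 = 0.
Proof. by rewrite /p /primitive set_itv1; exact: Rintegral_set1. Qed.

Lemma primitive_ge0 x : 0 <= x -> 0 <= p x.
Proof. by move=> x0; rewrite -primitive0; exact: primitive_mono. Qed.

Lemma ACder_phase (k e : R[i]) :
  ACder (fun t => cexp (k - e * (p t)%:C)) (fun t => - (e * rhoC t) * cexp (k - e * (p t)%:C)).
Proof.
have H := ACder_cexp (ACderB (ACder_cst k) (ACderZ e ACder_primitive)).
by apply: ACder_eq H _ => x _; rewrite sub0r.
Qed.

Lemma cint_indic D (P : set R) f : measurable (D : set (measurableTypeR R)) ->
  cint D (fun t => (\1_P t)%:C * f t) = cint (D `&` P) f.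
Proof.
move=> mD; rewrite /cint !Rintegral_mkcondr; congr (_ +i* _); apply: eq_Rintegral => t _.
  rewrite ReM /= mul0r subr0 patchE indicE; case: (t \in P); rewrite ?mul1r ?mul0r//.
rewrite ImM /= mul0r addr0 patchE indicE; case: (t \in P); rewrite ?mul1r ?mul0r//.
Qed.

Lemma cint_set0 f : cint set0 f = 0.
Proof. by rewrite /cint !Rintegral_set0. Qed.

(* The bound is uniform in everything except the gap [eta] between the phase
   [d] of [w] and the phase [e] of the kernel. *)
Definition osc_bound (eta r eps : R) q : Prop :=
  forall (l d e k : R[i]) w f (W u v : R),
  r < normc l -> eta <= normc (d - e) ->
  ACder w (fun t => l * d * rhoC t * w t + f t) ->
  cintegrable D0 f -> (forall x, 0 <= x -> normc (w x) <= W) ->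
  (\int[mu]_(t in D0) normc (f t) <= W)%R ->
  0 <= u -> (forall x, u <= x <= v -> Re (k - l * e * (p x)%:C) <= 0) ->
  normc (cint `[u, v] (fun t => cexp (k - l * e * (p t)%:C) * (q t * w t))) <= eps * W.

Definition osc q : Prop := forall eta eps : R, 0 < eta -> 0 < eps ->
  exists r, osc_bound eta r eps q.

(** Integration by parts. With E the kernel, h = E w satisfies h' = l (d - e) rho h + E f, so l (d -
    e) times the integral of rho h equals a difference of two values of h minus the integral of E f,
    which is at most 3 W in modulus. This is the 3 in the radius. *)
Lemma osc_base c (T : R) : 0 <= c -> osc (fun t => (rho t * \1_`[c, T]%classic t)%:C).
Proof.
move=> c0 eta eps eta0 eps0; exists (3 / (eta * eps)).
move=> l d e k w f W u v rl de dw fi wW fW u0 kJ.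
have W0 : 0 <= W by apply: le_trans (wW 0 (lexx _)); exact: normc_ge0.
have l0 : 0 < normc l.
  by apply: le_lt_trans rl; rewrite divr_ge0// mulr_ge0// ltW.
have de0 : 0 < normc (d - e) by exact: lt_le_trans de.
pose E t := cexp (k - l * e * (p t)%:C).
have -> : cint `[u, v] (fun t => E t * ((rho t * \1_`[c, T]%classic t)%:C * w t)) =
    cint (`[u, v] `&` `[c, T]) (fun t => E t * w t * rhoC t).
  rewrite -cint_indic//; apply: eq_cint => t _.
  by rewrite rmorphM /= -/(rhoC t); ring.
set u' := Num.max u c; set v' := Num.min v T.
have -> : (`[u, v] `&` `[c, T] : set R)%classic = `[u', v']%classic.
  apply/seteqP; split => t /=; rewrite !in_itv/= ge_max le_min.
    by move=> [/andP[-> ->] /andP[-> ->]].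
  by move=> /andP[/andP[-> ->] /andP[-> ->]].
have [uv|vu] := leP u' v'; last first.
  by rewrite set_itv_ge ?bnd_simp -?ltNge// cint_set0 normc0 mulr_ge0// ltW.
have u'0 : 0 <= u' by rewrite le_max u0.
have sub x : u' <= x <= v' -> u <= x <= v.
  by rewrite ge_max le_min => /andP[/andP[-> _] /andP[-> _]].
have dE := ACder_phase k (l * e); rewrite -/E in dE.
have E1 x : u' <= x <= v' -> normc (E x) <= 1.
  by move=> /sub/kJ h; rewrite normc_cexp -expR0 ler_expR.
pose h t := E t * w t.
have dh : ACder h (fun t => l * (d - e) * (h t * rhoC t) + E t * f t).
  by apply: ACder_eq (ACderM dE dw) _ => t _; rewrite /h -/(E t); ring.
have lh : cloc (fun t => h t * rhoC t) by apply: (ACder_cloc_mul dh); exact: cloc_rho.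
have lEf : cloc (fun t => E t * f t) by apply: (ACder_cloc_mul dE); exact: cintegrable_cloc.
have := ACder_FTC dh (clocD (clocZ _ lh) lEf) u'0 uv.
rewrite cintD//; [|exact/clocP/clocZ|exact: clocP].
rewrite cintZ//; last exact: clocP.
set I := cint _ _; set I2 := cint _ _ => FTC.
have I2W : normc I2 <= W.
  apply: le_trans fW; apply: (@cint_le _ D0) => //.
  - exact: sub_itv0y.
  - exact: cintegrable_meas (clocP _ u'0 lEf).
  - exact: integrable_normc.
  - by move=> x _; exact: normc_ge0.
  - move=> x /=; rewrite in_itv /= => /E1 Ex; rewrite normcM ler_piMl ?normc_ge0//.
have hW x : u' <= x <= v' -> normc (h x) <= W.
  move=> xuv; rewrite normcM; apply: le_trans (wW x _); last by case/andP: xuv => /(le_trans u'0).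
  by rewrite ler_piMl ?normc_ge0 ?E1.
have key : normc (l * (d - e)) * normc I <= W * 3.
  rewrite -normcM (_ : _ * I = (h v' - h u') - I2); last by rewrite FTC; ring.
  apply: le_trans (le_normcB _ _) _.
  have := le_normcB (h v') (h u').
  have := hW v'; have := hW u'; rewrite uv !lexx => /(_ isT) h1 /(_ isT) h2 h3.
  by lra.
have ll : 3 <= eps * normc (l * (d - e)).
  rewrite normcM; move: rl; rewrite ltr_pdivrMr ?mulr_gt0// => rl.
  have : normc l * (eta * eps) <= normc l * (normc (d - e) * eps) by rewrite ler_wpM2l ?ler_wpM2r// ltW.
  by move: (normc l) (normc (d - e)) rl => a b; nra.
have lp : 0 < normc (l * (d - e)) by rewrite normcM mulr_gt0.
rewrite -(ler_pM2l lp) (le_trans key)// [leRHS](_ : _ = W * (eps * normc (l * (d - e)))).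
  by rewrite ler_wpM2l.
by ring.
Qed.

End Oscillation.

Section RealHelpers.
Variable R : realType.
Let mu : {measure set (measurableTypeR R) -> \bar R} := lebesgue_measure.

Lemma small_dominated_integral (D : set (measurableTypeR R)) (k : nat -> R -> R) (h : R -> R) (e : R) :
  measurable D -> (forall n, measurable_fun D (k n)) -> (forall n x, D x -> 0 <= k n x) ->
  {ae mu, forall x, D x -> k ^~ x @ \oo --> (0 : R)} ->
  {ae mu, forall x n, D x -> k n x <= h x} -> mu.-integrable D (EFin \o h) ->
  0 < e -> exists n, (\int[mu]_(t in D) k n t < e)%R.
Proof.
move=> mD mk k0 kcvg kh ih e0.
have aeF := ae_filter_ringOfSetsType mu.
have [] := @dominated_convergence _ _ R mu D mD (fun n x => (k n x)%:E) (fun=> 0%E) (EFin \o h).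
- by move=> N; exact/measurable_EFinP.
- exact: measurable_cst.
- by apply: (@filterS _ _ aeF) kcvg => x kx Dx; apply: cvg_EFin; [exact: nearW|exact: kx].
- exact: ih.
- by apply: (@filterS _ _ aeF) kh => x kx n Dx; rewrite gee0_abs ?lee_fin ?k0// kx.
- move=> _ _; rewrite integral0 => /fine_cvgP[_ /cvgrPdist_lt /(_ _ e0)].
  case=> N _ /(_ N (leqnn N)) /=; rewrite sub0r normrN => /(le_lt_trans (ler_norm _)) H.
  by exists N.
Qed.

Lemma cintegrable_indic (D P : set (measurableTypeR R)) (f : R -> R[i]) :
  measurable D -> measurable P ->
  cintegrable (D `&` P) f -> cintegrable D (fun t => (\1_P t)%:C * f t).
Proof.
move=> mD mP [fr fi].
have E (k : R -> R) : mu.-integrable (D `&` P) (EFin \o k) ->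
    mu.-integrable D (EFin \o (fun t => \1_P t * k t)).
  move=> ik; rewrite (_ : EFin \o _ = (EFin \o k) \_ P); first exact/integrable_restrict.
  by apply/funext => t; rewrite /= patchE indicE; case: (t \in P); rewrite ?mul1r ?mul0r.
split.
  by under eq_fun do rewrite ReM /= mul0r subr0; exact: E fr.
by under eq_fun do rewrite ImM /= mul0r addr0; exact: E fi.
Qed.

End RealHelpers.

(** * Densities reached by linear combinations, L1 limits and Dynkin's theorem *)

Section OscillationDensity.
Variables (R : realType) (rho : R -> R).
Let mu : {measure set (measurableTypeR R) -> \bar R} := lebesgue_measure.
Let D0 : set (measurableTypeR R) := `[0%R, +oo[%classic.
Let rhoC t : R[i] := (rho t)%:C.
Let p := primitive rho.
Let aeF := ae_filter_ringOfSetsType mu.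
Let mD0 : measurable D0 := @measurable_0y R.
Let osc := @osc R rho.
Implicit Types (f g w q : R -> R[i]) (c u v : R) (J : set R).
Hypothesis cI : cond_I rho.

Let osc_cloc q (k e : R[i]) w w' : cloc q -> ACder w w' ->
  cloc (fun t => cexp (k - e * (p t)%:C) * (q t * w t)).
Proof.
move=> lq dw; apply: (ACder_cloc_mul (ACder_phase cI k e)).
by apply: eq_cloc (ACder_cloc_mul dw lq) => x _; rewrite mulrC.
Qed.

Let W_ge0 w (W : R) : (forall x, 0 <= x -> normc (w x) <= W) -> 0 <= W.
Proof. by move=> wW; apply: le_trans (wW 0 (lexx _)); exact: normc_ge0. Qed.

Lemma osc_add q1 q2 : cloc q1 -> cloc q2 -> osc q1 -> osc q2 -> osc (fun t => q1 t + q2 t).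
Proof.
move=> l1 l2 o1 o2 eta eps eta0 eps0.
have e2 : 0 < eps / 2 by rewrite divr_gt0.
have [r1 h1] := o1 _ _ eta0 e2; have [r2 h2] := o2 _ _ eta0 e2.
exists (Num.max r1 r2) => l d e k w f W u v; rewrite gt_max => /andP[rl1 rl2] de dw fi wW fW u0 kJ.
have := h1 l d e k w f W u v rl1 de dw fi wW fW u0 kJ.
have := h2 l d e k w f W u v rl2 de dw fi wW fW u0 kJ.
have := clocP v u0 (osc_cloc k (l * e) l1 dw); have := clocP v u0 (osc_cloc k (l * e) l2 dw).
set g1 := (fun t => _ * (q1 t * _)); set g2 := (fun t => _ * (q2 t * _)) => i2 i1 b2 b1.
have -> : cint `[u, v] (fun t => cexp (k - l * e * (primitive rho t)%:C) * ((q1 t + q2 t) * w t)) =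
    cint `[u, v] g1 + cint `[u, v] g2.
  by rewrite -cintD//; apply: eq_cint => t _; rewrite /g1 /g2 /p; ring.
apply: le_trans (le_normcD _ _) _.
by rewrite [leRHS](_ : _ = eps / 2 * W + eps / 2 * W); [exact: lerD|lra].
Qed.

Lemma osc_scale q (c : R[i]) : cloc q -> osc q -> osc (fun t => c * q t).
Proof.
move=> lq oq eta eps eta0 eps0.
have c1 : 0 < normc c + 1 by rewrite ltr_wpDl// normc_ge0.
have [r h] := oq _ _ eta0 (divr_gt0 eps0 c1).
exists r => l d e k w f W u v rl de dw fi wW fW u0 kJ.
have := h l d e k w f W u v rl de dw fi wW fW u0 kJ.
have := clocP v u0 (osc_cloc k (l * e) lq dw).
set g := (fun t => _ * (q t * _)) => ig b.
have -> : cint `[u, v] (fun t => cexp (k - l * e * (primitive rho t)%:C) * (c * q t * w t)) =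
    c * cint `[u, v] g.
  by rewrite -cintZ//; apply: eq_cint => t _; rewrite /g /p; ring.
have W0 := W_ge0 wW.
rewrite normcM; apply: (@le_trans _ _ ((normc c + 1) * (eps / (normc c + 1) * W))).
  by apply: ler_pM; rewrite ?normc_ge0// lerDl.
by rewrite mulrA (mulrCA _ eps) divff ?mulr1// gt_eqF.
Qed.

Lemma osc0 : osc (fun=> 0).
Proof.
move=> eta eps eta0 eps0; exists 0 => l d e k w f W u v _ _ _ _ wW _ _ _.
rewrite (@eq_cint _ _ _ (fun=> 0)); last by move=> x _; rewrite mul0r mulr0.
rewrite /cint /Rintegral integral0/= [normc _](_ : _ = 0); last exact: normc0.
by rewrite mulr_ge0 ?(W_ge0 wW) ?ltW.
Qed.

Lemma osc_sum (I : Type) (s : seq I) (F : I -> R -> R[i]) :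
  (forall i, cloc (F i)) -> (forall i, osc (F i)) -> osc (fun t => \sum_(i <- s) F i t).
Proof.
move=> lF oF; elim: s => [|i s ih].
  by under eq_fun do rewrite big_nil; exact: osc0.
under eq_fun do rewrite big_cons; apply: osc_add => //; exact: cloc_sum.
Qed.

(** The class is closed in L1: the kernel has modulus at most 1 and [w] at most [W], so passing from
    [q] to [q'] costs at most [W] times their distance, uniformly in all other data. *)
Lemma osc_approx q : cintegrable D0 q ->
  (forall e, 0 < e -> exists q', [/\ osc q', cintegrable D0 q' &
    (\int[mu]_(t in D0) normc (q t - q' t) <= e)%R]) -> osc q.
Proof.
move=> iq H eta eps eta0 eps0.
have e2 : 0 < eps / 2 by rewrite divr_gt0.
have [q' [oq' iq' qq']] := H _ e2; have [r h] := oq' _ _ eta0 e2.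
exists r => l d e k w f W u v rl de dw fi wW fW u0 kJ.
have b := h l d e k w f W u v rl de dw fi wW fW u0 kJ.
have W0 := W_ge0 wW.
have i1 := clocP v u0 (osc_cloc k (l * e) (cintegrable_cloc iq') dw).
have iqq' := cintegrableB mD0 iq iq'.
have i2 := clocP v u0 (osc_cloc k (l * e) (cintegrable_cloc iqq') dw).
have -> : cint `[u, v] (fun t => cexp (k - l * e * (primitive rho t)%:C) * (q t * w t)) =
    cint `[u, v] (fun t => cexp (k - l * e * (primitive rho t)%:C) * (q' t * w t)) +
    cint `[u, v] (fun t => cexp (k - l * e * (primitive rho t)%:C) * ((q t - q' t) * w t)).
  by rewrite -cintD//; apply: eq_cint => t _; ring.
apply: le_trans (le_normcD _ _) _.
rewrite [leRHS](_ : _ = eps / 2 * W + eps / 2 * W); last by lra.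
apply: lerD => //.
apply: (@le_trans _ _ (\int[mu]_(t in D0) (W * normc (q t - q' t)))%R).
  apply: (@cint_le _ D0) => //.
  - exact: sub_itv0y.
  - exact: cintegrable_meas i2.
  - by apply: integrable_fctZ => //; exact: integrable_normc.
  - by move=> x _; rewrite mulr_ge0// normc_ge0.
  - move=> x /=; rewrite in_itv/= => xuv; rewrite normcM normc_cexp normcM.
    apply: (@le_trans _ _ (normc (q x - q' x) * normc (w x))).
      by rewrite ler_piMl ?mulr_ge0 ?normc_ge0// -expR0 ler_expR kJ.
    by rewrite mulrC ler_wpM2r ?normc_ge0// wW// (le_trans u0)//; case/andP: xuv.
rewrite RintegralZl//; last exact: integrable_normc.
by rewrite mulrC ler_wpM2r.
Qed.

(** The window [0, T] keeps [rho] integrable, whatever the measurable set [A]. *)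
Let S (T : R) (A : set R) t : R[i] := (rho t * \1_(A `&` `[0, T]) t)%:C.

Let integrableS0 (T : R) : 0 < T -> cintegrable D0 (fun t => (\1_(`[0%R, T]%classic : set R) t)%:C * rhoC t).
Proof.
move=> T0; apply: cintegrable_indic => //.
rewrite (_ : D0 `&` _ = `[0%R, T]%classic); first exact: (cloc_rho cI).
by apply/setIidPr; exact: sub_itv0y.
Qed.

Let SE (T : R) A t : S T A t = (\1_A t)%:C * ((\1_(`[0%R, T]%classic : set R) t)%:C * rhoC t).
Proof. by rewrite /S indicI /= /rhoC !rmorphM /=; ring. Qed.

Let cmeas_indic (A : set (measurableTypeR R)) : measurable A -> cmeas D0 (fun t => (\1_A t)%:C).
Proof. by move=> mA; apply: cmeas_real; exact: measurable_indic. Qed.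

Let normc_indic (A : set R) t : normc ((\1_A t)%:C : R[i]) <= 1.
Proof. by rewrite normc_real indicE; case: (t \in A); rewrite ?normr1 ?normr0. Qed.

Let iS (T : R) (A : set (measurableTypeR R)) : 0 < T -> measurable A -> cintegrable D0 (S T A).
Proof.
move=> T0 mA; have H := integrableS0 T0.
apply: (eq_cintegrable mD0 (f := fun t => (\1_A t)%:C * ((\1_(`[0%R, T]%classic : set R) t)%:C * rhoC t))).
  by move=> x _; rewrite -SE.
by apply: (cintegrableM mD0 (cmeas_indic mA) _ H (c := 1)) => x _.
Qed.

Let sum_indic (F : (set R)^nat) n t : trivIset [set: nat] F ->
  (forall m, F m t -> \sum_(k <- iota 0 n) (\1_(F k) t : R) = (m < n)%N%:R) /\
  ((forall m, ~ F m t) -> \sum_(k <- iota 0 n) (\1_(F k) t : R) = 0).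
Proof.
move=> tF; split=> [m Fm|Fm]; last first.
  by rewrite big1// => k _; rewrite indicE memNset.
rewrite (_ : iota 0 n = index_iota 0 n); last by rewrite /index_iota subn0.
elim: n => [|n ih]; first by rewrite big_nil.
rewrite big_nat_recr//= ih indicE ltnS; have [mn|mn|mn] := ltngtP m n.
- rewrite memNset ?addr0// => Fn.
  by have E := tF m n I I (ex_intro _ t (conj Fm Fn)); rewrite E ltnn in mn.
- rewrite memNset ?addr0// => Fn.
  by have E := tF m n I I (ex_intro _ t (conj Fm Fn)); rewrite E ltnn in mn.
- by rewrite -mn mem_set// add0r.
Qed.

(** The sets with this property form a Dynkin system containing the half-lines [x, +oo[, which are
    stable under intersection and generate the Borel sets. *)
Lemma osc_indic (T : R) (A : set (measurableTypeR R)) : 0 < T -> measurable A ->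
  osc (fun t => (rho t * \1_(A `&` `[0, T]) t)%:C).
Proof.
move=> T0 mA.
have iST : osc (S T setT).
  have := osc_base cI T (lexx 0).
  by rewrite /S setTI.
apply: (@dynkin_induction _ (measurableTypeR R) (RGenCInfty.G (R:=R)) (fun A => osc (S T A))).
- exact: RGenCInfty.measurableE.
- move=> _ _ [x ->] [y ->]; exists (Num.max x y).
  apply/seteqP; split => t /=; rewrite !in_itv/= !andbT ge_max.
    by move=> [-> ->].
  by move=> /andP[].
- exact: iST.
(* Within [0, T] a half-line is the interval from max(x, 0) to T, the case settled by integration by
   parts. *)
- move=> _ [x ->].
  have -> : S T `[x, +oo[%classic = (fun t => (rho t * \1_(`[Num.max x 0, T]%classic : set R) t)%:C).
    rewrite /S; apply/funext => t; congr (_ * \1_ _ _)%:C.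
    apply/seteqP; split => s /=; rewrite !in_itv/= ?andbT ge_max.
      by move=> [-> /andP[-> ->]].
    by move=> /andP[/andP[-> ->] ->].
  by apply: osc_base => //; rewrite le_max lexx orbT.
- move=> B mB oB.
  have -> : S T (~` B) = (fun t => S T setT t + (-1) * S T B t).
    apply/funext => t; rewrite !SE !indicE in_setT in_setC.
    by case: (t \in B) => /=; ring.
  apply: osc_add => //; first by apply: cintegrable_cloc; exact: iS.
    by apply: clocZ; apply: cintegrable_cloc; exact: iS.
  by apply: osc_scale => //; apply: cintegrable_cloc; exact: iS.
(* The partial sums converge pointwise to the indicator of the disjoint union, with errors dominated
   by [rho] on [0, T]; hence L1 convergence, and [osc_approx] applies. *)
- move=> F mF tF oF.
  have mU : measurable (\bigcup_k F k) by exact: bigcupT_measurable.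
  have iF k : cintegrable D0 (S T (F k)) by exact: iS.
  apply: osc_approx; first exact: iS.
  move=> e e0; pose q n t := \sum_(k <- iota 0 n) S T (F k) t.
  have iq n : cintegrable D0 (q n) by exact: cintegrable_sum.
  have B t : (\1_(\bigcup_k F k) t : R) = 0 /\ (forall m, ~ F m t) \/ (\1_(\bigcup_k F k) t : R) = 1 /\ exists m, F m t.
    have [H|H] := pselect (exists m, F m t).
      by right; split => //; case: H => m Fm; rewrite indicE mem_set//; exists m.
    left; split; first by rewrite indicE memNset// => -[m _ Fm]; apply: H; exists m.
    by move=> m Fm; apply: H; exists m.
  have qE n t : S T (\bigcup_k F k) t - q n t =
      (\1_(\bigcup_k F k) t - \sum_(k <- iota 0 n) \1_(F k) t)%:C * ((\1_(`[0%R, T]%classic : set R) t)%:C * rhoC t).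
    rewrite SE /q; under eq_bigr do rewrite SE.
    by rewrite -mulr_suml -mulrBl rmorphB rmorph_sum.
  have c1 : {ae mu, forall x, D0 x -> (fun n => normc (S T (\bigcup_k F k) x - q n x)) @ \oo --> (0 : R)}.
    apply: aeW => x _; apply: cvg_near_cst.
    case: (B x) => [[B1 B2]|[B1 [m Fm]]].
      by apply: nearW => n; rewrite qE B1 ((sum_indic n x tF).2 B2) subrr mul0r normc0.
    exists m.+1 => // n /= mn.
    by rewrite qE B1 ((sum_indic n x tF).1 _ Fm) mn subrr mul0r normc0.
  have c2 : {ae mu, forall x n, D0 x -> normc (S T (\bigcup_k F k) x - q n x) <=
      normc ((\1_(`[0%R, T]%classic : set R) x)%:C * rhoC x)}.
    apply: aeW => x n _; rewrite qE normcM ler_piMl ?normc_ge0// normc_real.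
    case: (B x) => [[B1 B2]|[B1 [m Fm]]].
      by rewrite B1 ((sum_indic n x tF).2 B2) subrr normr0.
    by rewrite B1 ((sum_indic n x tF).1 _ Fm); case: (m < n)%N; rewrite ?subrr ?subr0 ?normr0 ?normr1.
  have [n Hn] := small_dominated_integral mD0
    (fun n => measurable_normc (cintegrable_meas (cintegrableB mD0 (iS T0 mU) (iq n))))
    (fun n x _ => normc_ge0 _) c1 c2 (integrable_normc mD0 (integrableS0 T0)) e0.
  by exists (q n); split => //; [apply: osc_sum => // k; exact: cintegrable_cloc|exact: ltW].
- have E : (<<s @RGenCInfty.G R >>) = @measurable _ (measurableTypeR R) :=
    esym (RGenCInfty.measurableE R).
  by rewrite E.
Qed.

End OscillationDensity.

Import HBSimple HBNNSimple.

(** * From simple functions to all L1 densities, and from intervals to half-lines *)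

Section OscillationL1.
Variables (R : realType) (rho : R -> R).
Let mu : {measure set (measurableTypeR R) -> \bar R} := lebesgue_measure.
Let D0 : set (measurableTypeR R) := `[0%R, +oo[%classic.
Let rhoC t : R[i] := (rho t)%:C.
Let p := primitive rho.
Let aeF := ae_filter_ringOfSetsType mu.
Let mD0 : measurable D0 := @measurable_0y R.
Let osc := @osc R rho.
Implicit Types (f g w q : R -> R[i]) (c u v : R) (J : set R).
Hypothesis cI : cond_I rho.

Lemma measurable_rho : measurable_fun D0 rho.
Proof. exact: (cloc_cmeas (cloc_rho cI)).1. Qed.

(** Write q = rho F, approximate F = q / rho from below by simple functions and cut these to
    [0, n + 1]: rho times such a function is a finite combination of the densities of
    [osc_indic]. *)
Lemma osc_nonneg (q : R -> R) : mu.-integrable D0 (EFin \o q) -> (forall x, 0 <= q x) ->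
  osc (fun t => (q t)%:C).
Proof.
(* exp(- ln rho) is a measurable form of 1 / rho where rho > 0; on the exceptional null set it is
   merely some positive number. *)
move=> iq q0; pose F x := q x * expR (- ln (rho x)).
have F0 x : 0 <= F x by rewrite mulr_ge0// expR_ge0.
have mq : measurable_fun D0 q by have /measurable_int/measurable_EFinP := iq.
have mF : measurable_fun D0 F.
  apply: measurable_funM => //.
  apply: (measurableT_comp (f := expR)); first exact: measurable_expR.
  apply: measurableT_comp => //.
  by apply: (measurableT_comp (f := @ln R)); [exact: measurable_ln|exact: measurable_rho].
have rhoF x : 0 < rho x -> rho x * F x = q x.
  by move=> r0; rewrite /F mulrCA expRN lnK// divff ?mulr1// gt_eqF.
have /measurable_EFinP mF' := mF.
have [phi [nd cvgphi]] := approximation mD0 mF' (fun t _ => F0 t : (0 <= (F t)%:E)%E).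
have phi0 n x : 0 <= phi n x by [].
have cphi x : D0 x -> (fun n => phi n x) @ \oo --> F x.
  by move=> /cvgphi /fine_cvg.
have phiF n x : D0 x -> phi n x <= F x.
  move=> Dx; have := cphi x Dx => H.
  rewrite -(cvg_lim _ H)//; apply: nondecreasing_cvgn_le; last by apply/cvg_ex; exists (F x).
  by move=> a b ab; have /lefP := nd _ _ ab; exact.
pose ind n t : R := \1_(`[0%R, n.+1%:R]%classic : set R) t.
have ind01 n t : 0 <= ind n t <= 1.
  by rewrite /ind indicE; case: (t \in _); rewrite ?lexx ?ler01.
pose qn n t : R[i] := (rho t * (phi n t * ind n t))%:C.
have qnE n t : qn n t = \sum_(y <- finmap.enum_fset (fset_set (range (phi n))))
    y%:C * (rho t * \1_((phi n @^-1` [set y]) `&` `[0, n.+1%:R]) t)%:C.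
  rewrite /qn fimfunE fsbig_finite//= big_distrl/= mulr_sumr rmorph_sum.
  by apply: eq_bigr => y _; rewrite indicI /ind -rmorphM /=; congr (_)%:C; ring.
have clocn n y : cloc (fun t => (rho t * \1_((phi n @^-1` [set y]) `&` `[0, n.+1%:R]) t)%:C).
  move=> T T0; apply: (eq_cintegrable (f := fun t => (\1_((phi n @^-1` [set y]) `&` `[0, n.+1%:R]) t)%:C * rhoC t)) => //.
    by move=> x _; rewrite rmorphM /= mulrC.
  apply: (@cintegrableM _ _ _ _ 1) => //; last exact: (cloc_rho cI).
    by apply: cmeas_real; apply: measurable_indic; apply: measurableI.
  by move=> x _; rewrite normc_real indicE; case: (x \in _); rewrite ?normr0 ?normr1.
have oqn n : osc (qn n).
  rewrite (funext (qnE n)); apply: osc_sum => // y; first by apply: clocZ; exact: clocn.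
  by apply: osc_scale => //; apply: osc_indic.
have rhoae := cI.2.
have mqn n : measurable_fun D0 (fun t => rho t * (phi n t * ind n t)).
  apply: measurable_funM; first exact: measurable_rho.
  by apply: measurable_funM; [exact: measurable_funTS|apply: measurable_indic].
have qnq n x : D0 x -> 0 < rho x -> 0 <= rho x * (phi n x * ind n x) <= q x.
  move=> Dx r0; have /andP[i0 i1] := ind01 n x; apply/andP; split.
    by rewrite mulr_ge0 ?(ltW r0)// mulr_ge0.
  rewrite -(rhoF x r0) ler_wpM2l ?(ltW r0)//.
  by rewrite (le_trans _ (phiF n x Dx))// ler_piMr.
have iqn n : cintegrable D0 (qn n).
  have h (k : R -> R) : measurable_fun D0 k -> {ae mu, forall x, 0 <= x -> 0 <= k x <= q x} ->
      mu.-integrable D0 (EFin \o k).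
    move=> mk kq; have mk' : measurable_fun D0 (fun x => `|k x|) by exact: measurableT_comp.
    apply/integrableP; split; first exact/measurable_EFinP.
    have /integrableP[_] := iq; apply: le_lt_trans.
    apply: ae_ge0_le_integral => //.
    - by apply: measurableT_comp => //; exact/measurable_EFinP.
    - by apply: measurableT_comp => //; exact/measurable_EFinP.
    - apply: (@filterS _ _ aeF) kq => x kx; rewrite /D0 /= in_itv/= andbT => /kx /andP[k0 kq].
      by rewrite lee_fin !ger0_norm// q0.
  apply: cintegrable_real; apply: h => //.
  apply: (@filterS _ _ aeF) rhoae => x rx x0; apply: qnq; last exact: rx.
  by rewrite /D0 /= in_itv/= andbT.
have iqC := cintegrable_real iq.
apply: osc_approx => // e e0.
have c1 : {ae mu, forall x, D0 x -> (fun n => normc ((q x)%:C - qn n x)) @ \oo --> (0 : R)}.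
  apply: (@filterS _ _ aeF) rhoae => x rx Dx.
  have x0 : 0 <= x by move: Dx; rewrite /D0 /= in_itv/= andbT.
  have r0 := rx x0.
  have H : (fun n => `|q x - rho x * phi n x|) @ \oo --> (0 : R).
    have -> : 0 = `|q x - rho x * F x| by rewrite rhoF// subrr normr0.
    apply: cvg_norm; apply: cvgB; first exact: cvg_cst.
    by apply: cvgM; [exact: cvg_cst|exact: cphi].
  apply: (cvg_trans _ H); apply: near_eq_cvg; near=> n.
  rewrite -rmorphB normc_real /ind indicE mem_set ?mulr1//= in_itv/= x0/=.
  near: n; exists (Num.bound x) => // n /= hn.
  by rewrite (le_trans (ltW (archi_boundP x0)))// ler_nat (leq_trans hn).
have c2 : {ae mu, forall x n, D0 x -> normc ((q x)%:C - qn n x) <= q x}.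
  apply: (@filterS _ _ aeF) rhoae => x rx n Dx.
  have x0 : 0 <= x by move: Dx; rewrite /D0 /= in_itv/= andbT.
  have /andP[h1 h2] := qnq n x Dx (rx x0).
  by rewrite -rmorphB normc_real ger0_norm ?subr_ge0// gerBl.
have [n Hn] := small_dominated_integral mD0
  (fun n => measurable_normc (cintegrable_meas (cintegrableB mD0 iqC (iqn n))))
  (fun n x _ => normc_ge0 _) c1 c2 iq e0.
by exists (qn n); split; [exact: oqn|exact: iqn|exact: (ltW Hn)].
Unshelve. all: end_near. Qed.

(** Real and imaginary parts, each split as max(k, 0) - max(- k, 0). *)
Lemma osc_integrable q : cintegrable D0 q -> osc q.
Proof.
move=> iq; have [ir ii] := iq.
have mpos (k : R -> R) : mu.-integrable D0 (EFin \o k) ->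
    mu.-integrable D0 (EFin \o (fun x => Num.max (k x) 0)).
  move=> ik; have /measurable_int/measurable_EFinP mk := ik.
  apply: (le_integrable mD0 _ _ ik).
    by apply/measurable_EFinP; apply: (measurable_maxr mk); exact: measurable_cst.
  move=> x _ /=; rewrite lee_fin ger0_norm ?le_max ?lexx ?orbT//.
  by rewrite ge_max ler_norm normr_ge0.
have iN (k : R -> R) : mu.-integrable D0 (EFin \o k) ->
    mu.-integrable D0 (EFin \o (fun x => - k x)).
  move=> ik; rewrite (_ : (fun x => - k x) = (fun x => -1 * k x)); first exact: integrable_fctZ.
  by apply/funext => x; rewrite mulN1r.
have m0 (k : R -> R) x : 0 <= Num.max (k x) 0 by rewrite le_max lexx orbT.
have real (k : R -> R) : mu.-integrable D0 (EFin \o k) -> osc (fun t => (k t)%:C).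
  move=> ik.
  have -> : (fun t => (k t)%:C) = (fun t => (Num.max (k t) 0)%:C + (-1) * (Num.max (- k t) 0)%:C : R[i]).
    apply/funext => t; rewrite mulN1r -rmorphB /=; congr (_)%:C.
    by case: (leP (k t) 0) => ?; case: (leP (- k t) 0) => ?; lra.
  have lc k' : mu.-integrable D0 (EFin \o k') -> cloc (fun t => (Num.max (k' t) 0)%:C : R[i]).
    by move=> ik'; apply: cintegrable_cloc; apply: cintegrable_real; exact: mpos.
  apply: osc_add; [by []|exact: lc|apply: clocZ; exact: (lc (fun x => - k x) (iN _ ik))|exact: osc_nonneg (mpos _ ik) (m0 _)|].
  apply: osc_scale; [by []|exact: (lc (fun x => - k x) (iN _ ik))|].
  exact: osc_nonneg (mpos _ (iN _ ik)) (m0 _).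
have -> : q = (fun t => (Re (q t))%:C + 'i%C * (Im (q t))%:C).
  by apply/funext => t; rewrite -complexE.
have lc (k : R -> R) : mu.-integrable D0 (EFin \o k) -> cloc (fun t => (k t)%:C : R[i]).
  by move=> ik; apply: cintegrable_cloc; exact: cintegrable_real.
apply: osc_add; [by []|exact: lc|by apply: clocZ; exact: lc|exact: real|].
by apply: osc_scale; [by []|exact: lc|exact: real].
Qed.

Lemma tail_small (h : R -> R) (e : R) : mu.-integrable D0 (EFin \o h) ->
  (forall x, 0 <= h x) -> 0 < e ->
  exists2 T, 0 < T & forall v, T <= v -> (\int[mu]_(t in `[v, +oo[) h t < e)%R.
Proof.
move=> ih h0 e0; have /measurable_int/measurable_EFinP mh := ih.
pose k n t := \1_(`[n%:R, +oo[%classic : set R) t * h t.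
have mk n : measurable_fun D0 (k n).
  by apply: measurable_funM => //; apply: measurable_indic; exact: measurable_itv.
have c1 : {ae mu, forall x, D0 x -> k ^~ x @ \oo --> (0 : R)}.
  apply: aeW => x; rewrite /D0 /= in_itv/= andbT => x0; apply: cvg_near_cst.
  exists (Num.bound x) => // n /= hn; rewrite /k indicE memNset ?mul0r//= in_itv/= andbT.
  apply/negP; rewrite -ltNge (lt_le_trans (archi_boundP x0))// ler_nat//.
have ind01 n t : 0 <= (\1_(`[n%:R, +oo[%classic : set R) t : R) <= 1.
  by rewrite indicE; case: (t \in _); rewrite ?lexx ?ler01.
have c2 : {ae mu, forall x n, D0 x -> k n x <= h x}.
  by apply: aeW => x n _; have /andP[i0 i1] := ind01 n x; rewrite /k ler_piMl.
have k0 n x : D0 x -> 0 <= k n x by move=> _; have /andP[i0 i1] := ind01 n x; rewrite /k mulr_ge0.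
have [n Hn] := small_dominated_integral mD0 mk k0 c1 c2 ih e0.
exists n.+1%:R => // v nv; apply: le_lt_trans Hn.
have v0 : 0 <= v by apply: le_trans nv.
have sub : `[v, +oo[%classic `<=` D0.
  by move=> x; rewrite /D0 /= !in_itv/= !andbT; exact: le_trans.
have ik : mu.-integrable D0 (EFin \o k n).
  apply: (le_integrable mD0 _ _ ih); first exact/measurable_EFinP.
  move=> x Dx /=; rewrite lee_fin !ger0_norm ?k0//.
  by have /andP[i0 i1] := ind01 n x; rewrite /k ler_piMl.
have ikv : mu.-integrable `[v, +oo[ (EFin \o k n) by apply: integrableS ik => //; exact: measurable_itv.
rewrite (_ : (\int[mu]_(t in `[v, +oo[) h t)%R = (\int[mu]_(t in `[v, +oo[) k n t)%R); last first.
  apply: eq_Rintegral => t /set_mem/=; rewrite in_itv/= andbT => vt.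
  rewrite /k indicE mem_set ?mul1r//= in_itv/= andbT (le_trans _ vt)// (le_trans _ nv)//.
  by rewrite ler_nat.
rewrite /Rintegral fine_le//; [exact: integrable_fin_num|exact: integrable_fin_num|].
apply: ge0_subset_integral; [exact: measurable_itv|exact: mD0|exact/measurable_EFinP| |exact: sub].
by move=> x Dx; rewrite lee_fin k0.
Qed.

Definition interval_from u J := (exists v, J = `[u, v]%classic) \/ J = `[u, +oo[%classic.

(** The bound on [u, v] does not depend on v. A half-line follows because what lies beyond v is at
    most the tail of [W] |q|, which is arbitrarily small. *)
Lemma oscillation q : cintegrable D0 q -> forall eta eps : R, 0 < eta -> 0 < eps ->
  exists r, forall (l d e k : R[i]) w f (W u : R) J,
  r < normc l -> eta <= normc (d - e) ->
  ACder w (fun t => l * d * rhoC t * w t + f t) ->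
  cintegrable D0 f -> (forall x, 0 <= x -> normc (w x) <= W) ->
  (\int[mu]_(t in D0) normc (f t) <= W)%R ->
  0 <= u -> interval_from u J -> (forall x, J x -> Re (k - l * e * (p x)%:C) <= 0) ->
  normc (cint J (fun t => cexp (k - l * e * (p t)%:C) * (q t * w t))) <= eps * W.
Proof.
move=> iq eta eps eta0 eps0; have [r H] := osc_integrable iq eta0 eps0; exists r.
move=> l d e k w f W u J rl de dw fi wW fW u0 HJ kJ.
have W0 : 0 <= W by apply: le_trans (wW 0 (lexx _)); exact: normc_ge0.
case: HJ => [[v JE]|JE].
  rewrite JE; apply: (H l d e k w f W u v) => // x xuv; apply: kJ.
  by rewrite JE /= in_itv.
pose g t := cexp (k - l * e * (p t)%:C) * (q t * w t).
have lqw : cloc (fun t => q t * w t).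
  by apply: eq_cloc (ACder_cloc_mul dw (cintegrable_cloc iq)) => x _; rewrite mulrC.
have lg : cloc g by exact: (ACder_cloc_mul (ACder_phase cI k (l * e))).
have mJ : measurable (J : set (measurableTypeR R)) by rewrite JE; exact: measurable_itv.
have JD : J `<=` D0.
  by move=> x; rewrite JE /D0 /= !in_itv/= !andbT; exact: le_trans.
have gq x : J x -> normc (g x) <= W * normc (q x).
  move=> Jx; rewrite normcM normc_cexp normcM.
  apply: (@le_trans _ _ (normc (q x) * normc (w x))).
    by rewrite ler_piMl ?mulr_ge0 ?normc_ge0// -expR0 ler_expR kJ.
  rewrite mulrC ler_wpM2r ?normc_ge0// wW//.
  by move: (JD _ Jx); rewrite /D0 /= in_itv/= andbT.
have inq := integrable_normc mD0 iq.
have iWq : mu.-integrable D0 (EFin \o (fun x => W * normc (q x))) by exact: integrable_fctZ.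
have ig : cintegrable J g.
  apply: (le_cintegrable mJ _ gq); last exact: integrableS iWq.
  by apply: (cmeasS _ JD) => //; exact: cloc_cmeas.
apply/ler_addgt0Pr => e' e'0.
have [T T0 HT] := tail_small iWq (fun x => mulr_ge0 W0 (normc_ge0 _)) e'0.
pose v := Num.max u T.
have uv : u <= v by rewrite le_max lexx.
have split : cint J g = cint `[u, v] g + cint `[v, +oo[ g.
  pose gJ t := (\1_J t)%:C * g t.
  have igJ : cintegrable D0 gJ.
    by apply: cintegrable_indic => //; rewrite (_ : D0 `&` J = J)//; apply/setIidPr.
  have gJE (K : set (measurableTypeR R)) : K `<=` J -> cint K g = cint K gJ.
    by move=> KJ; apply: eq_cint => t Kt; rewrite /gJ indicE mem_set ?mul1r//; exact: KJ.
  have v0 : 0 <= v by exact: le_trans uv.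
  rewrite (gJE J)// (gJE `[u, v]%classic); last first.
    by rewrite JE; apply: subset_itvl.
  rewrite (gJE `[v, +oo[%classic); last first.
    by rewrite JE; apply: subset_itvr; rewrite bnd_simp.
  rewrite [in LHS]JE (cint_itvy u0 igJ) (cint_itvy v0 igJ).
  rewrite -(cint_itvB u0 uv (cintegrable_cloc igJ)).
  by ring.
rewrite -/g split; apply: le_trans (le_normcD _ _) _; apply: lerD.
  apply: (H l d e k w f W u v) => // x /andP[ux _]; apply: kJ.
  by rewrite JE /= in_itv/= ux.
apply: le_trans (ltW (HT v _)); last by rewrite le_max lexx orbT.
have subv : `[v, +oo[%classic `<=` J by rewrite JE; apply: subset_itvr; rewrite bnd_simp.
have mv : measurable (`[v, +oo[%classic : set (measurableTypeR R)) by exact: measurable_itv.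
apply: (cint_le mv mv) => //.
- by apply: (cmeasS mJ subv); exact: cintegrable_meas ig.
- by apply: integrableS iWq => //; exact: subset_trans JD.
- by move=> x _; rewrite mulr_ge0// normc_ge0.
- by move=> x /subv; exact: gq.
Qed.

End OscillationL1.

(** * Integral equations *)

Section GeometricLimit.
Variable R : realType.
Implicit Types (a : nat -> R) (c : R).

Lemma le_geometric (x y B : R) : (forall k : nat, x <= y + B / 2 ^+ k) -> x <= y.
Proof.
move=> H; apply/ler_addgt0Pr => e e0.
pose k := Num.bound (`|B| / e).
apply: le_trans (H k) _; rewrite lerD2l.
have h : `|B| / e < 2 ^+ k.
  apply: (@lt_le_trans _ _ k%:R); first by apply: archi_boundP; rewrite divr_ge0// ltW.
  by rewrite -natrX ler_nat ltnW// ltn_expl.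
rewrite ltr_pdivrMr// in h.
by rewrite ler_pdivrMr ?exprn_gt0// mulrC (le_trans (ler_norm B))// ltW.
Qed.

(** The limit is the supremum of the lower bounds a_m - c / 2^m, each of which lies below every
    upper bound a_k + c / 2^k. *)
Lemma geometric_cauchy a c :
  (forall m k, (m <= k)%N -> `|a k - a m| <= c / 2 ^+ m) ->
  exists l, forall m, `|l - a m| <= c / 2 ^+ m.
Proof.
move=> H; pose S := [set a m - c / 2 ^+ m | m in [set: nat]].
have up m k : a k - c / 2 ^+ k <= a m + c / 2 ^+ m.
  have [mk|km] := leqP m k.
    have := H _ _ mk; rewrite ler_norml => /andP[_ h].
    have := H _ _ (leqnn k); rewrite subrr normr0 => h'; lra.
  have := H _ _ (ltnW km); rewrite ler_norml => /andP[h _].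
  have := H _ _ (leqnn m); rewrite subrr normr0 => h'; lra.
have hS : has_sup S.
  by split; [exists (a 0%N - c / 2 ^+ 0); exists 0%N|exists (a 0%N + c / 2 ^+ 0) => _ [k _ <-]].
exists (sup S) => m; rewrite ler_norml; apply/andP; split.
  have : a m - c / 2 ^+ m <= sup S by apply: ub_le_sup; [case: hS|exists m].
  by lra.
have : sup S <= a m + c / 2 ^+ m by apply: ge_sup; [case: hS|move=> _ [k _ <-]].
by lra.
Qed.

Lemma cvg_geometric0 (c : R) : (fun m => c / 2 ^+ m) @ \oo --> (0 : R).
Proof.
have := @cvg_geometric R c 2^-1; rewrite /geometric /= => H.
under eq_fun do rewrite -exprVn.
by apply: H; rewrite ger0_norm ?invr_ge0// invf_lt1// ltr1n.
Qed.

Lemma le_norm_sum4 (x y z t : R) (S := `|x| + `|y| + `|z| + `|t|) :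
  [/\ x <= S, y <= S, z <= S & t <= S].
Proof.
have := ler_norm x; have := ler_norm y; have := ler_norm z; have := ler_norm t.
have := normr_ge0 x; have := normr_ge0 y; have := normr_ge0 z; have := normr_ge0 t.
by rewrite /S => *; split; lra.
Qed.

End GeometricLimit.

(** * A fixed-point theorem for operators whose square contracts *)

Section Resolvent.
Variables (R : realType) (n : nat).
Let D0 : set (measurableTypeR R) := `[0%R, +oo[%classic.
Let mD0 : measurable D0 := @measurable_0y R.
Let V := R -> 'I_n -> R[i].
Implicit Types (f g r u v : V) (c e B : R).

Definition mV f : Prop := forall j, cmeas D0 (fun x => f x j).

(** The weight lets one fixed-point theorem serve twice: weight 1 for the forward equation, an
    exponential weight for Volterra equations. *)
Definition bndw (w : R -> R) c f : Prop :=
  forall x, 0 <= x -> forall j, normc (f x j) <= c * w x.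

Definition bnd c f : Prop := bndw (fun=> 1) c f.

Definition addV f g : V := fun x j => f x j + g x j.
Definition subV f g : V := fun x j => f x j - g x j.
Definition solves_eq (T : V -> V) f g : Prop :=
  forall x, 0 <= x -> forall j, f x j = g x j + T f x j.

(** The second clause is stability: the a priori bound [B] of [f] does not enter the conclusion. It
    contains uniqueness and turns small residuals into small errors, which is how the dependence on
    the parameter is proved. *)
Definition solvable (T : V -> V) (K : R) : Prop :=
  (forall g c, mV g -> bnd c g -> exists f, [/\ mV f, solves_eq T f g & bnd (K * c) f]) /\
  (forall f r e B, mV f -> mV r -> bnd B f -> bnd e r -> solves_eq T f r -> bnd (K * e) f).

Lemma mV_add f g : mV f -> mV g -> mV (addV f g).
Proof. by move=> mf mg j; exact: cmeasD. Qed.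
Lemma mV_sub f g : mV f -> mV g -> mV (subV f g).
Proof. by move=> mf mg j; exact: cmeasB. Qed.

Lemma mV_lim (u : nat -> V) f (B : R -> R) :
  (forall m, mV (u m)) ->
  (forall m x, 0 <= x -> forall j, normc (f x j - u m x j) <= B x / 2 ^+ m) -> mV f.
Proof.
move=> mu uf j; split.
- apply: (@measurable_fun_cvg _ _ _ _ (fun m x => Re (u m x j))) => //; first by move=> m; exact: (mu m j).1.
  move=> x; rewrite /D0 /= in_itv/= andbT => x0.
  apply/cvgrPdist_le => e e0.
  have := cvg_geometric0 (B x) => /cvgrPdist_le /(_ _ e0); apply: filterS => m.
  rewrite sub0r normrN => /(le_trans (ler_norm _)); apply: le_trans; apply: le_trans (uf m x x0 j).
  by rewrite -ReB; have [] := normr_le_normc (f x j - u m x j).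
- apply: (@measurable_fun_cvg _ _ _ _ (fun m x => Im (u m x j))) => //; first by move=> m; exact: (mu m j).2.
  move=> x; rewrite /D0 /= in_itv/= andbT => x0.
  apply/cvgrPdist_le => e e0.
  have := cvg_geometric0 (B x) => /cvgrPdist_le /(_ _ e0); apply: filterS => m.
  rewrite sub0r normrN => /(le_trans (ler_norm _)); apply: le_trans; apply: le_trans (uf m x x0 j).
  by rewrite -ImB; have [] := normr_le_normc (f x j - u m x j).
Qed.

Section Contraction.
Variables (T : V -> V) (w : R -> R) (W K : R).
Hypothesis w1 : forall x, 0 <= x -> 1 <= w x.
Hypothesis wW : forall x, 0 <= x -> w x <= W.
Hypothesis K0 : 0 <= K.
Hypothesis T_mV : forall f B, mV f -> bndw w B f -> mV (T f).
Hypothesis T_sub : forall f g B, mV f -> mV g -> bndw w B f -> bndw w B g ->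
  forall x, 0 <= x -> forall j, T (subV f g) x j = T f x j - T g x j.
Hypothesis T_bnd : forall f c, mV f -> bndw w c f -> bndw w (K * c) (T f).
Hypothesis T_half : forall f c, mV f -> bndw w c f -> bndw w (c / 2) (T (T f)).

Let w_ge0 x : 0 <= x -> 0 <= w x.
Proof. by move=> /w1; apply: le_trans. Qed.

Let bndwD f g c c' : bndw w c f -> bndw w c' g -> bndw w (c + c') (addV f g).
Proof.
move=> bf bg x x0 j; rewrite mulrDl (le_trans (le_normcD _ _))//.
by apply: lerD; [exact: bf|exact: bg].
Qed.

Let bndwB f g c c' : bndw w c f -> bndw w c' g -> bndw w (c + c') (subV f g).
Proof.
move=> bf bg x x0 j; rewrite mulrDl (le_trans (le_normcB _ _))//.
by apply: lerD; [exact: bf|exact: bg].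
Qed.

Let bndwW f c c' : c <= c' -> bndw w c f -> bndw w c' f.
Proof. by move=> cc bf x x0 j; apply: le_trans (bf x x0 j) _; rewrite ler_wpM2r// w_ge0. Qed.

Let bndw_bnd f c : 0 <= c -> bndw w c f -> bnd (c * W) f.
Proof.
move=> c0 bf x x0 j; rewrite mulr1 (le_trans (bf x x0 j))//.
by rewrite ler_wpM2l// wW.
Qed.

Let bnd_bndw f c : bnd c f -> bndw w c f.
Proof.
move=> bf x x0 j; have := bf x x0 j; rewrite mulr1 => h.
by rewrite (le_trans h)// ler_peMr ?w1// (le_trans (normc_ge0 _) h).
Qed.

Let T_add f g B : mV f -> mV g -> bndw w B f -> bndw w B g ->
  forall x, 0 <= x -> forall j, T (addV f g) x j = T f x j + T g x j.
Proof.
move=> mf mg bf bg x x0 j.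
have bfg := bndwD bf bg; have mfg := mV_add mf mg.
have B2 : B <= `|B| + `|B| by rewrite (le_trans (ler_norm _))// lerDl.
have h := T_sub mfg mg (bndwW (ler_norm (B + B)) bfg)
  (bndwW (_ : B <= `|B + B|) bg) x0 j.
have E : T (subV (addV f g) g) x j = T f x j.
  by congr (T _ x j); apply/funext => y; apply/funext => i; rewrite /subV /addV addrK.
rewrite -E h ?subrK//.
have [b0|b0] := leP 0 B; first by rewrite ger0_norm ?addr_ge0// lerDl.
by apply: ltW; apply: lt_le_trans b0 _.
Qed.

(** The map B |-> a + B / 2 has the fixed point 2 a, and iterating it drives any initial bound
    there. *)
Let halving f a B : bndw w B f -> (forall B, bndw w B f -> bndw w (a + B / 2) f) ->
  bndw w (a * 2) f.
Proof.
move=> bf H.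
have h k : bndw w (a * 2 + (B - a * 2) / 2 ^+ k) f.
  elim: k => [|k ih]; first by rewrite expr0 divr1 subrKC.
  apply: bndwW (H _ ih); rewrite exprS invfM.
  by rewrite le_eqVlt; apply/orP; left; apply/eqP; field.
move=> x x0 j; apply: (@le_geometric _ _ _ ((B - a * 2) * w x)) => k.
by have := h k x x0 j; rewrite mulrDl [_ / _ * _]mulrAC.
Qed.

(** The bound of the operator is applied to the difference with constant 0: values at negative x
    cannot influence it. *)
Let T_ext f g B : mV f -> mV g -> bndw w B f -> bndw w B g ->
  (forall x, 0 <= x -> forall j, f x j = g x j) ->
  forall x, 0 <= x -> forall j, T f x j = T g x j.
Proof.
move=> mf mg bf bg fg x x0 j.
have b0 : bndw w 0 (subV f g).
  by move=> y y0 i; rewrite /subV fg// subrr normc0 mul0r.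
have := T_bnd (mV_sub mf mg) b0 x0 j; rewrite mulr0 mul0r (T_sub mf mg bf bg x0 j) => h.
by apply/eqP; rewrite -subr_eq0 -normc_eq0 eq_le h normc_ge0.
Qed.

(** Substituting the equation into itself gives f = r + T r + T (T f). The last term halves the
    bound of f, so [halving] applies with a = (1 + K) e. *)
Let stab f r e B : mV f -> mV r -> bndw w B f -> bndw w e r -> solves_eq T f r ->
  bndw w ((1 + K) * e * 2) f.
Proof.
move=> mf mr bf be fr; apply: (halving bf) => B' bf'.
have mTf := T_mV mf bf'; have bTf := T_bnd mf bf'.
pose C := `|B'| + `|e| + `|K * B'| + `|K * e|.
have bigC x0 : x0 = B' \/ x0 = e \/ x0 = K * B' \/ x0 = K * e -> x0 <= C.
  have := normr_ge0 B'; have := normr_ge0 e; have := normr_ge0 (K * B'); have := normr_ge0 (K * e).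
  have := ler_norm B'; have := ler_norm e; have := ler_norm (K * B'); have := ler_norm (K * e).
  by rewrite /C => ? ? ? ? ? ? ? ? [->|[->|[->|->]]]; lra.
have brC : bndw w C r by apply: bndwW be; apply: bigC; tauto.
have bTfC : bndw w C (T f) by apply: bndwW bTf; apply: bigC; tauto.
have bfC : bndw w C f by apply: bndwW bf'; apply: bigC; tauto.
have mrT := mV_add mr mTf.
have C0 : 0 <= C by rewrite /C !addr_ge0.
have brT : bndw w (C + C) (addV r (T f)) by exact: bndwD.
have E x : 0 <= x -> forall j, f x j = r x j + (T r x j + T (T f) x j).
  move=> x0 j; rewrite fr//; congr (_ + _).
  rewrite -(T_add mr mTf brC bTfC x0 j).
  apply: (T_ext mf mrT (bndwW _ bfC) brT) => //.
  by rewrite lerDl.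
move=> x x0 j; rewrite (E x x0 j) !mulrDl !mul1r.
rewrite (le_trans (le_normcD _ _))// -addrA; apply: lerD; first exact: be.
rewrite (le_trans (le_normcD _ _))//; apply: lerD.
  exact: (T_bnd mr be).
exact: (T_half mf bf').
Qed.

(** The iteration runs for the operator that contracts: f = h + T (T f) with h = g + T g. Then v = g
    + T f satisfies the same equation, so f = v by uniqueness, that is, f = g + T f. Passing from
    the weighted to the plain bound costs the factor [W]. *)
Lemma contraction_solvable : solvable T ((1 + K) * 2 * W).
Proof.
have W0 : 0 <= W by rewrite (le_trans _ (wW (lexx 0)))// w_ge0.
(* A negative bound is possible only if there is no index at all, and then nothing is to be
   proved. *)
have normb (f : V) B : bnd B f -> 0 <= B \/ (forall (j : 'I_n), False).
  move=> bf; have [|b0] := leP 0 B; first by left.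
  right => j; have := bf 0 (lexx _) j; rewrite mulr1 => h.
  by have := le_trans (normc_ge0 _) h; rewrite leNgt b0.
split=> [g c mg bg|f r e B mf mr bf be fr]; last first.
  have h := stab mf mr (bnd_bndw bf) (bnd_bndw be) fr.
  move=> x x0 j; case: (normb _ _ be) => [e0|/(_ j)//].
  have := bndw_bnd _ h x0 j; rewrite mulr1 => /(_ ltac:(by rewrite !mulr_ge0// addr_ge0)) h'.
  by apply: le_trans h' _; rewrite mulr1 le_eqVlt; apply/orP; left; apply/eqP; ring.
pose c' := `|c|; have bg' : bndw w c' g by apply: bndwW (bnd_bndw bg); exact: ler_norm.
pose h := addV g (T g); have mTg := T_mV mg bg'.
have mh : mV h by exact: mV_add.
pose C := c' + K * c'; have c'0 : 0 <= c' by rewrite /c'.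
have C0 : 0 <= C by rewrite addr_ge0// mulr_ge0.
have bh : bndw w C h by apply: bndwD => //; exact: T_bnd.
pose u := fix u (k : nat) : V := if k is k'.+1 then addV h (T (T (u k'))) else h.
have TTm f B : mV f -> bndw w B f -> mV (T (T f)).
  by move=> mf bf; apply: T_mV (T_bnd mf bf); exact: T_mV bf.
have ub k : mV (u k) /\ bndw w (C * 2) (u k).
  elim: k => [|k [mk bk]] /=; first by split => //; apply: bndwW bh; lra.
  split; first by apply: mV_add => //; exact: TTm bk.
  by apply: bndwW (bndwD bh (T_half mk bk)); lra.
have TTsub f g' B : mV f -> mV g' -> bndw w B f -> bndw w B g' -> forall x, 0 <= x -> forall j,
    T (T (subV f g')) x j = T (T f) x j - T (T g') x j.
  move=> mf mg' bf bg'' x x0 j.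
  have m1 := T_mV mf bf; have m2 := T_mV mg' bg''.
  have b1 := T_bnd mf bf; have b2 := T_bnd mg' bg''.
  have m3 := mV_sub mf mg'; have b3 := bndwB bf bg''.
  have b4 := T_bnd m3 b3; have m5 := mV_sub m1 m2; have b5 := bndwB b1 b2.
  rewrite -(T_sub m1 m2 b1 b2 x0 j).
  pose Z := `|K * (B + B)| + `|K * B + K * B|.
  apply: (@T_ext _ _ Z (T_mV m3 b3) m5) => //.
  - by apply: bndwW b4; rewrite (le_trans (ler_norm _))// lerDl.
  - by apply: bndwW b5; rewrite (le_trans (ler_norm _))// lerDr.
  - by move=> y y0 i; exact: T_sub bf bg'' _ y0 i.
have step k : bndw w (C / 2 ^+ k.+1) (subV (u k.+1) (u k)).
  elim: k => [|k ih].
    move=> x x0 j; rewrite /subV /= /addV (addrC (h x j)) addrK expr1.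
    exact: (T_half mh bh).
  move=> x x0 j.
  have [m1 b1] := ub k.+1; have [m2 b2] := ub k.
  have -> : subV (u k.+2) (u k.+1) x j = T (T (subV (u k.+1) (u k))) x j.
    rewrite (TTsub _ _ _ m1 m2 b1 b2 x x0 j) /subV /= /addV; ring.
  have := T_half (mV_sub m1 m2) ih x0 j.
  have -> // : C / 2 ^+ k.+2 = C / 2 ^+ k.+1 / 2.
  by rewrite [2 ^+ k.+2]exprSr invfM mulrA.
(* The sum of the steps C w / 2^(k + 1) is kept in closed form, which lets the induction on [k] go
   through. *)
have cau m k x j : 0 <= x -> (m <= k)%N -> normc (u k x j - u m x j) <= C * w x / 2 ^+ m - C * w x / 2 ^+ k.
  move=> x0; elim: k => [|k ih]; first by rewrite leqn0 => /eqP ->; rewrite !subrr normc0.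
  rewrite leq_eqVlt => /predU1P[->|]; first by rewrite !subrr normc0.
  rewrite ltnS => /ih {}ih.
  have := normc_triangle (u k.+1 x j) (u m x j) (u k x j).
  have := step k x x0 j; rewrite /subV => h1 h2.
  have E : C * w x / 2 ^+ k = C * w x / 2 ^+ k.+1 * 2 by rewrite exprS; field.
  have E2 : C / 2 ^+ k.+1 * w x = C * w x / 2 ^+ k.+1 by rewrite mulrAC.
  by move: h1 h2 ih; rewrite E2 E; lra.
have cau' m k x j : 0 <= x -> (m <= k)%N -> normc (u k x j - u m x j) <= C * w x / 2 ^+ m.
  move=> x0 mk; apply: le_trans (cau m k x j x0 mk) _; rewrite gerBl.
  by rewrite divr_ge0 ?exprn_ge0// mulr_ge0// w_ge0.
(* Limits are taken for each point and index separately; the doubled constant comes from real and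
   imaginary parts. *)
have ex x j : exists l : R[i], 0 <= x -> forall m, normc (l - u m x j) <= C * w x / 2 ^+ m *+ 2.
  have [x0|x0] := leP 0 x; last by exists 0.
  have [m k mk|a ha] := @geometric_cauchy R (fun m => Re (u m x j)) (C * w x).
    rewrite -ReB; apply: le_trans (cau' m k x j x0 mk).
    by have [] := normr_le_normc (u k x j - u m x j).
  have [m k mk|b hb] := @geometric_cauchy R (fun m => Im (u m x j)) (C * w x).
    rewrite -ImB; apply: le_trans (cau' m k x j x0 mk).
    by have [] := normr_le_normc (u k x j - u m x j).
  exists (a +i* b) => _ m; apply: le_trans (normc_le_ReIm _) _.
  by rewrite ReB ImB /= mulr2n; exact: lerD.
pose f x j := projT1 (cid (ex x j)).
have fu x : 0 <= x -> forall j m, normc (f x j - u m x j) <= (C * 2) / 2 ^+ m * w x.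
  move=> x0 j m; have := projT2 (cid (ex x j)) x0 m; rewrite -/(f x j) => /le_trans; apply.
  by rewrite le_eqVlt; apply/orP; left; apply/eqP; field.
have mf : mV f.
  apply: (@mV_lim u f (fun x => C * 2 * w x)); first by move=> m; have [] := ub m.
  by move=> m x x0 j; have := fu x x0 j m; rewrite [_ / _ * _]mulrAC.
have bf : bndw w (C * 4) f.
  move=> x x0 j; have := fu x x0 j 0%N; rewrite expr0 divr1 => h1.
  have := (ub 0%N).2 x x0 j => h2.
  have := le_normcD (f x j - u 0%N x j) (u 0%N x j); rewrite subrK => h3; lra.
have fTT x : 0 <= x -> forall j, f x j = h x j + T (T f) x j.
  move=> x0 j; apply/eqP; rewrite -subr_eq0 -normc_eq0 eq_le normc_ge0 andbT.
  apply: (@le_geometric _ _ _ (C * 4 * w x)) => k; rewrite add0r.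
  have [mk bk] := ub k.
  have h1 := fu x x0 j k.+1.
  have bfu : bndw w ((C * 2) / 2 ^+ k) (subV f (u k)) by move=> y y0 i; exact: fu.
  have h2 := T_half (mV_sub mf mk) bfu x0 j.
  have bk' : bndw w (C * 4) (u k) by apply: bndwW bk; lra.
  rewrite (TTsub _ _ _ mf mk bf bk' x x0 j) in h2.
  have -> : f x j - (h x j + T (T f) x j) = (f x j - u k.+1 x j) - (T (T f) x j - T (T (u k)) x j).
    by rewrite /= /addV; ring.
  apply: le_trans (le_normcB _ _) _.
  apply: le_trans (lerD h1 h2) _; rewrite exprS.
  have P : 0 <= C * w x / 2 ^+ k by rewrite divr_ge0 ?exprn_ge0// mulr_ge0// w_ge0.
  rewrite [leLHS](_ : _ = C * w x / 2 ^+ k * 2); last by field.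
  by rewrite [leRHS](_ : _ = C * w x / 2 ^+ k * 4); [lra|field].
have mTf := T_mV mf bf; have bTf := T_bnd mf bf.
pose v := addV g (T f).
have mv : mV v by exact: mV_add.
pose Z := `|c'| + `|K * (C * 4)| + C * 4 + `|K * c'| + `|K * (K * (C * 4))|.
have Z1 : [/\ c' <= Z, K * (C * 4) <= Z, C * 4 <= Z, c' + K * (C * 4) <= Z & True].
  have := normr_ge0 c'; have := normr_ge0 (K * (C * 4)); have := normr_ge0 (K * c').
  have := normr_ge0 (K * (K * (C * 4))).
  have := ler_norm c'; have := ler_norm (K * (C * 4)).
  by rewrite /Z => ? ? ? ? ? ?; split => //; lra.
case: Z1 => Z1 Z2 Z3 Z4 _.
have bv : bndw w Z v by apply: bndwW Z4 _; exact: bndwD.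
have bfZ : bndw w Z f by exact: bndwW bf.
have vf x : 0 <= x -> forall j, v x j = h x j + T (T v) x j.
  move=> x0 j; rewrite /v /h /addV -addrA; congr (_ + _).
  have T1 y : 0 <= y -> forall i, T v y i = T g y i + T (T f) y i.
    by move=> y0 i; apply: (@T_add _ _ Z) => //; [exact: bndwW bg'|exact: bndwW bTf].
  have T2 y : 0 <= y -> forall i, f y i = addV g (T v) y i.
    by move=> y0 i; rewrite fTT// /h /addV T1// addrA.
  have mTv := T_mV mv bv; have bTv := T_bnd mv bv.
  have bgTv := bndwD bg' bTv.
  pose Z' := `|Z| + `|c' + K * Z| + `|K * Z| + `|c'|.
  have Z'1 := le_norm_sum4 Z (c' + K * Z) (K * Z) c'.
  case: Z'1 => y1 y2 y3 y4.
  rewrite (@T_ext f (addV g (T v)) Z' mf (mV_add mg mTv) (bndwW y1 bfZ) (bndwW y2 bgTv) T2 x x0 j).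
  by apply: (@T_add _ _ Z') => //; [exact: bndwW bg'|exact: bndwW bTv].
exists f.
have sol : solves_eq T f g.
  move=> x x0 j; change (f x j = v x j).
  have m1 := mV_sub mf mv; have b1 := bndwB bfZ bv.
  have : bndw w (0 * 2) (subV f v).
    apply: (halving b1) => B bB; rewrite add0r.
    move=> y y0 i; have := T_half m1 bB y0 i.
    rewrite (TTsub _ _ _ mf mv bfZ bv y y0 i) [in X in _ -> X]/subV fTT// vf//.
    by rewrite (_ : h y i + _ - _ = T (T f) y i - T (T v) y i)//; ring.
  move=> /(_ x x0 j); rewrite !mul0r => h0.
  by apply/eqP; rewrite -subr_eq0 -normc_eq0 eq_le h0 normc_ge0.
split => //; move=> x x0 j; case: (normb _ _ bg) => [c0|/(_ j)//].
have h0 := stab mf mg bf (bnd_bndw bg) sol.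
have := bndw_bnd _ h0 x0 j; rewrite mulr1 => /(_ ltac:(by rewrite !mulr_ge0// addr_ge0)) h'.
by apply: le_trans h' _; rewrite mulr1 le_eqVlt; apply/orP; left; apply/eqP; ring.
Qed.

End Contraction.
End Resolvent.

(** * Integral operators with a bounded kernel *)

Section KernelOperator.
Variables (R : realType) (n : nat).
Let mu : {measure set (measurableTypeR R) -> \bar R} := lebesgue_measure.
Let D0 : set (measurableTypeR R) := `[0%R, +oo[%classic.
Let mD0 : measurable D0 := @measurable_0y R.
Let V := R -> 'I_n -> R[i].
Let Mx := R -> 'M[R[i]]_n.
Implicit Types (f g : V) (Q : Mx) (s : 'I_n -> bool) (k : 'I_n -> R -> R -> R[i]).

(* The component [j] of the operator integrates from 0 up to x if [s j] holds,
   and from +oo down to x otherwise, hence the sign in [Kop]. *)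
Definition Jset (b : bool) (x : R) : set (measurableTypeR R) :=
  if b then `[0%R, x]%classic else `[x, +oo[%classic.

Definition row_mul Q f t j : R[i] := \sum_m Q t j m * f t m.

Definition Kop s k Q f : V := fun x j =>
  (if s j then 1 else -1) * cint (Jset (s j) x) (fun t => k j x t * row_mul Q f t j).

(** Summing over all entries, not over a row, yields one integrable function that dominates every
    component, so [mass] bounds the operator norm as soon as the kernel has modulus at most 1. *)
Definition sumnorm Q t : R := \sum_j \sum_m normc (Q t j m).
Definition L1mx Q : Prop := forall j m, cintegrable D0 (fun t => Q t j m).
Definition mass Q : R := (\int[mu]_(t in D0) sumnorm Q t)%R.

Definition good_kernel s k (B0 : R) : Prop := forall j x, 0 <= x ->
  cmeas (Jset (s j) x) (k j x) /\ forall t, Jset (s j) x t -> normc (k j x t) <= B0.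

Lemma measurable_Jset b x : measurable (Jset b x).
Proof. by case: b; exact: measurable_itv. Qed.

Lemma Jset_sub b x : 0 <= x -> Jset b x `<=` D0.
Proof.
move=> x0; case: b; first exact: sub_itv0y.
by move=> t; rewrite /D0 /Jset /= !in_itv/= !andbT; exact: le_trans.
Qed.

Lemma JsetP b x t : 0 <= x -> Jset b x t -> 0 <= t /\ (if b then t <= x else x <= t).
Proof.
move=> x0; case: b; rewrite /Jset /= in_itv/= ?andbT; first by move=> /andP[].
by move=> xt; split => //; exact: le_trans xt.
Qed.

Lemma interval_from_Jset b x : 0 <= x -> exists2 u, 0 <= u & interval_from u (Jset b x).
Proof.
move=> x0; case: b; first by exists 0 => //; left; exists x.
by exists x => //; right.
Qed.

Lemma sumnorm_ge0 Q t : 0 <= sumnorm Q t.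
Proof. by apply: sumr_ge0 => j _; apply: sumr_ge0 => m _; exact: normc_ge0. Qed.

Lemma integrable_fct_sum (I : Type) (r : seq I) (F : I -> R -> R) D :
  measurable (D : set (measurableTypeR R)) ->
  (forall i, mu.-integrable D (EFin \o F i)) ->
  mu.-integrable D (EFin \o (fun t => \sum_(i <- r) F i t)).
Proof.
move=> mD iF; elim: r => [|i r ih].
  have -> : (fun t => \sum_(i <- [::]) F i t) = (fun=> 0) by apply/funext => t; rewrite big_nil.
  exact: (integrable0 mu).
have -> : (fun t => \sum_(l <- i :: r) F l t) = (fun t => F i t + \sum_(l <- r) F l t).
  by apply/funext => t; rewrite big_cons.
by apply: integrable_fctD => //; exact: iF.
Qed.

Lemma integrable_sumnorm Q : L1mx Q -> mu.-integrable D0 (EFin \o sumnorm Q).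
Proof.
move=> iQ; apply: integrable_fct_sum => // j; apply: integrable_fct_sum => // m.
exact: integrable_normc.
Qed.

Lemma mass_ge0 Q : 0 <= mass Q.
Proof. by apply: Rintegral_ge0 => x _; exact: sumnorm_ge0. Qed.

Lemma L1mxD Q1 Q2 : L1mx Q1 -> L1mx Q2 -> L1mx (fun t => Q1 t + Q2 t).
Proof. by move=> i1 i2 j m; under eq_fun do rewrite mxE; exact: cintegrableD. Qed.

Lemma L1mxB Q1 Q2 : L1mx Q1 -> L1mx Q2 -> L1mx (fun t => Q1 t - Q2 t).
Proof. by move=> i1 i2 j m; under eq_fun do rewrite !mxE; exact: cintegrableB. Qed.

Lemma L1mxZ (a : R[i]) Q : L1mx Q -> L1mx (fun t => a *: Q t).
Proof. by move=> iQ j m; under eq_fun do rewrite mxE; exact: cintegrableZ. Qed.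

Lemma normc_row_mul Q f t j c : (forall m, normc (f t m) <= c) ->
  normc (row_mul Q f t j) <= c * sumnorm Q t.
Proof.
move=> fc; apply: le_trans (normc_sum _ _ _) _.
apply: (@le_trans _ _ (\sum_m c * normc (Q t j m))).
  by apply: ler_sum => m _; rewrite normcM mulrC ler_wpM2r// normc_ge0.
rewrite -mulr_sumr; have [c0|c0] := leP 0 c.
  rewrite ler_wpM2l// /sumnorm [leRHS](bigD1 j)//= lerDl sumr_ge0// => i _.
  by apply: sumr_ge0 => m _; exact: normc_ge0.
have [m|n0] := pickP 'I_n.
  by have := le_trans (normc_ge0 _) (fc m); rewrite leNgt c0.
by have := n0 j.
Qed.

Lemma cmeas_row_mul Q f j : L1mx Q -> mV f -> cmeas D0 (fun t => row_mul Q f t j).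
Proof.
move=> iQ mf; apply: cmeas_sum => m; apply: cmeasM; last exact: mf.
exact: cintegrable_meas.
Qed.

Lemma cintegrable_row_mul Q f j c : L1mx Q -> mV f -> bnd c f ->
  cintegrable D0 (fun t => row_mul Q f t j).
Proof.
move=> iQ mf bf; apply: (@le_cintegrable _ _ _ (fun t => c * sumnorm Q t)) => //.
- exact: cmeas_row_mul.
- move=> x; rewrite /D0 /= in_itv/= andbT => x0; apply: normc_row_mul => m.
  by have := bf x x0 m; rewrite mulr1.
- by apply: integrable_fctZ => //; exact: integrable_sumnorm.
Qed.

Lemma Kop_integrable s k B0 Q f c j x : good_kernel s k B0 -> L1mx Q -> mV f -> bnd c f ->
  0 <= x -> cintegrable (Jset (s j) x) (fun t => k j x t * row_mul Q f t j).
Proof.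
move=> gk iQ mf bf x0; have [mk kk] := gk j x x0.
apply: (@cintegrableM _ _ _ _ B0) => //; first exact: measurable_Jset.
apply: (cintegrableS mD0 (measurable_Jset _ _)); first exact: Jset_sub.
exact: cintegrable_row_mul bf.
Qed.

Lemma Kop_le s k Q f j x (h : R -> R) : 0 <= x ->
  cmeas (Jset (s j) x) (k j x) -> L1mx Q -> mV f ->
  mu.-integrable D0 (EFin \o h) -> (forall t, D0 t -> 0 <= h t) ->
  (forall t, Jset (s j) x t -> normc (k j x t * row_mul Q f t j) <= h t) ->
  normc (Kop s k Q f x j) <= (\int[mu]_(t in D0) h t)%R.
Proof.
move=> x0 mk iQ mf ih h0 kh; rewrite /Kop normcM.
have -> : normc (if s j then 1 else -1) = 1 :> R.
  by case: (s j); rewrite ?normcN normc1.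
rewrite mul1r; apply: (@cint_le _ D0) => //; first exact: measurable_Jset.
  exact: Jset_sub.
apply: cmeasM => //; apply: (cmeasS mD0); first exact: Jset_sub.
exact: cmeas_row_mul.
Qed.

Lemma Kop_bnd s k B0 Q f c : 0 <= B0 -> 0 <= c -> good_kernel s k B0 -> L1mx Q -> mV f -> bnd c f ->
  bnd (B0 * c * mass Q) (Kop s k Q f).
Proof.
move=> B00 c0 gk iQ mf bf x x0 j; rewrite mulr1 -RintegralZl//; last exact: integrable_sumnorm.
have [mk kk] := gk j x x0.
apply: Kop_le => //.
- by apply: integrable_fctZ => //; exact: integrable_sumnorm.
- by move=> t _; rewrite !mulr_ge0// sumnorm_ge0.
- move=> t Jt; rewrite normcM -mulrA; apply: ler_pM; rewrite ?normc_ge0//; first exact: kk.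
  apply: normc_row_mul => m; have [t0 _] := JsetP x0 Jt.
  by have := bf t t0 m; rewrite mulr1.
Qed.

Lemma Kop_sub s k B0 Q f g c c' x j : good_kernel s k B0 -> L1mx Q -> mV f -> mV g ->
  bnd c f -> bnd c' g -> 0 <= x ->
  Kop s k Q (subV f g) x j = Kop s k Q f x j - Kop s k Q g x j.
Proof.
move=> gk iQ mf mg bf bg x0; rewrite /Kop -mulrBr -cintB; last 3 first.
- exact: measurable_Jset.
- exact: (Kop_integrable j gk iQ mf bf x0).
- exact: (Kop_integrable j gk iQ mg bg x0).
congr (_ * _); apply: eq_cint => t _; rewrite -mulrBr; congr (_ * _).
by rewrite /row_mul -sumrB; apply: eq_bigr => m _; rewrite /subV mulrBr.
Qed.

Lemma Kop_Qsub s k B0 Q1 Q2 f c x j : good_kernel s k B0 -> L1mx Q1 -> L1mx Q2 -> mV f ->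
  bnd c f -> 0 <= x ->
  Kop s k (fun t => Q1 t - Q2 t) f x j = Kop s k Q1 f x j - Kop s k Q2 f x j.
Proof.
move=> gk i1 i2 mf bf x0; rewrite /Kop -mulrBr -cintB; last 3 first.
- exact: measurable_Jset.
- exact: (Kop_integrable j gk i1 mf bf x0).
- exact: (Kop_integrable j gk i2 mf bf x0).
congr (_ * _); apply: eq_cint => t _; rewrite -mulrBr; congr (_ * _).
by rewrite /row_mul -sumrB; apply: eq_bigr => m _; rewrite !mxE mulrBl.
Qed.

Lemma Kop_Qscale s k B0 (a : R[i]) Q f c x j : good_kernel s k B0 -> L1mx Q -> mV f ->
  bnd c f -> 0 <= x ->
  Kop s k (fun t => a *: Q t) f x j = a * Kop s k Q f x j.
Proof.
move=> gk iQ mf bf x0; rewrite /Kop mulrCA -[a * cint _ _]cintZ; last 2 first.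
- exact: measurable_Jset.
- exact: (Kop_integrable j gk iQ mf bf x0).
congr (_ * _); apply: eq_cint => t _; rewrite mulrCA; congr (_ * _).
by rewrite /row_mul mulr_sumr; apply: eq_bigr => m _; rewrite !mxE mulrA.
Qed.

Lemma Kop_ksub s k1 k2 B0 B0' Q f c x j : good_kernel s k1 B0 -> good_kernel s k2 B0' ->
  L1mx Q -> mV f -> bnd c f -> 0 <= x ->
  Kop s (fun j x t => k1 j x t - k2 j x t) Q f x j = Kop s k1 Q f x j - Kop s k2 Q f x j.
Proof.
move=> g1 g2 iQ mf bf x0; rewrite /Kop -mulrBr -cintB; last 3 first.
- exact: measurable_Jset.
- exact: (Kop_integrable j g1 iQ mf bf x0).
- exact: (Kop_integrable j g2 iQ mf bf x0).
by congr (_ * _); apply: eq_cint => t _; rewrite -mulrBl.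
Qed.

Lemma Kop_kscale s k B0 (a : R[i]) Q f c x j : good_kernel s k B0 -> L1mx Q -> mV f ->
  bnd c f -> 0 <= x ->
  Kop s (fun j x t => a * k j x t) Q f x j = a * Kop s k Q f x j.
Proof.
move=> gk iQ mf bf x0; rewrite /Kop mulrCA -[a * cint _ _]cintZ; last 2 first.
- exact: measurable_Jset.
- exact: (Kop_integrable j gk iQ mf bf x0).
by congr (_ * _); apply: eq_cint => t _; rewrite mulrA.
Qed.

End KernelOperator.

(** * The operators with exponential kernels *)

Section ExponentialOperator.
Variables (R : realType) (n : nat) (rho : R -> R).
Let mu : {measure set (measurableTypeR R) -> \bar R} := lebesgue_measure.
Let D0 : set (measurableTypeR R) := `[0%R, +oo[%classic.
Let mD0 : measurable D0 := @measurable_0y R.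
Let V := R -> 'I_n -> R[i].
Let Mx := R -> 'M[R[i]]_n.
Let p := primitive rho.
Let rhoC t : R[i] := (rho t)%:C.
Implicit Types (f g : V) (Q : Mx) (s : 'I_n -> bool) (e : 'I_n -> R[i]).
Hypothesis cI : cond_I rho.

Definition expker e (j : 'I_n) (x t : R) : R[i] := cexp (e j * (p x - p t)%:C).

Definition Top s e Q f : V := Kop s (expker e) Q f.

(** The kernel is used for t <= x if [s j] holds and for t >= x otherwise; since the primitive of
    [rho] increases, these signs make its modulus at most 1. *)
Definition admissible s e : Prop :=
  forall j, if s j then Re (e j) <= 0 else 0 <= Re (e j).

Lemma expkerE e j x t : expker e j x t = cexp (e j * (p x)%:C - e j * (p t)%:C).
Proof. by rewrite /expker rmorphB mulrBr. Qed.

Lemma Re_expker s e j x t : admissible s e -> 0 <= x -> Jset (s j) x t ->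
  Re (e j * (p x - p t)%:C) <= 0.
Proof.
move=> ad x0 Jt; rewrite ReM /= mulr0 subr0; have := ad j; have [t0] := JsetP x0 Jt.
case: (s j) => tx ej; have := primitive_mono cI _ tx; rewrite -/p => pp.
  by have {}pp := pp t0; nra.
by have {}pp := pp x0; nra.
Qed.

Lemma cmeas_primitive : cmeas D0 (fun t => (p t)%:C).
Proof. exact: ACder_cmeas (ACder_primitive cI). Qed.

Lemma cmeas_expker e j x : cmeas D0 (expker e j x).
Proof.
apply: cmeas_cexp; apply: cmeasM; first exact: cmeas_cst.
under eq_fun do rewrite rmorphB; apply: cmeasB; first exact: cmeas_cst.
exact: cmeas_primitive.
Qed.

Lemma good_expker s e : admissible s e -> good_kernel s (expker e) 1.
Proof.
move=> ad j x x0; split.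
  by apply: (cmeasS mD0 _ (cmeas_expker e j x)); exact: Jset_sub.
by move=> t Jt; rewrite normc_cexp -expR0 ler_expR (Re_expker ad x0 Jt).
Qed.

Lemma Top_bnd s e Q f c : admissible s e -> 0 <= c -> L1mx Q -> mV f -> bnd c f ->
  bnd (mass Q * c) (Top s e Q f).
Proof.
move=> ad c0 iQ mf bf; have := Kop_bnd ler01 c0 (good_expker ad) iQ mf bf.
by rewrite mul1r mulrC.
Qed.

(** The kernel factors as exp(e p(x)) exp(- e p(t)), so the operator is an exponential times a
    primitive, and the product rule gives the scalar equation. This is what admits values of the
    operator into the oscillation lemma. *)
Lemma Top_ACder s e Q f c j : admissible s e -> L1mx Q -> mV f -> bnd c f ->
  exists g : R -> R[i], (forall x, 0 <= x -> Top s e Q f x j = g x) /\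
    ACder g (fun x => e j * rhoC x * g x + row_mul Q f x j).
Proof.
move=> ad iQ mf bf.
pose E x := cexp (e j * (p x)%:C).
pose E' x := cexp (- (e j * (p x)%:C)).
pose F t := E' t * row_mul Q f t j.
have iqf : cintegrable D0 (fun t => row_mul Q f t j) by exact: cintegrable_row_mul bf.
have dE : ACder E (fun x => e j * rhoC x * E x).
  exact: ACder_cexp (ACderZ (e j) (ACder_primitive cI)).
have dE' : ACder E' (fun x => - (e j * rhoC x) * E' x).
  have := ACder_phase cI 0 (e j).
  by rewrite /E' /p; under eq_fun do rewrite sub0r; under [X in ACder _ X]eq_fun do rewrite sub0r.
have EE' x : E x * E' x = 1 by rewrite /E /E' cexpN.
have lF : cloc F by apply: (ACder_cloc_mul dE'); exact: cintegrable_cloc.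
have dF := ACder_cint lF.
have kE x t : expker e j x t * row_mul Q f t j = E x * F t.
  by rewrite expkerE cexpD -mulrA.
case sj : (s j).
  exists (fun x => E x * cint `[0, x] F); split.
    move=> x x0; rewrite /Top /Kop sj mul1r /Jset.
    rewrite (@eq_cint _ _ _ (fun t => E x * F t)); last by move=> t _; exact: kE.
    by rewrite cintZ//; exact: clocP.
  apply: ACder_eq (ACderM dE dF) _ => x _.
  have Er : row_mul Q f x j = E x * E' x * row_mul Q f x j by rewrite EE' mul1r.
rewrite [X in _ = _ + X]Er /F.
  by ring.
(* Integrating from +oo after the factorization requires exp(- e p) times the row to be integrable
   on the whole half-line; it is, because Re (e j) >= 0 and p >= 0. *)
have aj : 0 <= Re (e j) by have := ad j; rewrite sj.
have iF : cintegrable D0 F.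
  apply: (@cintegrableM _ _ _ _ 1) => //; first exact: ACder_cmeas dE'.
  move=> x; rewrite /D0 /= in_itv/= andbT => x0; rewrite normc_cexp -expR0 ler_expR.
  rewrite ReN ReM /= mulr0 subr0.
  by have := primitive_ge0 cI x0; rewrite -/p; nra.
exists (fun x => - (E x * (cint D0 F - cint `[0, x] F))); split.
  move=> x x0; rewrite /Top /Kop sj mulN1r /Jset.
  rewrite (@eq_cint _ _ _ (fun t => E x * F t)); last by move=> t _; exact: kE.
  rewrite -cint_itvy// cintZ//.
  by apply: (cintegrableS mD0 _ _ iF); [exact: measurable_itv|exact: (@Jset_sub _ false)].
have H := ACderZ (-1) (ACderM dE (ACderB (ACder_cst (cint D0 F)) dF)).
apply: ACder_eqf (ACder_eq H _) => x x0; first by rewrite mulN1r.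
have Er : row_mul Q f x j = E x * E' x * row_mul Q f x j by rewrite EE' mul1r.
rewrite [X in _ = _ + X]Er /F.
by ring.
Qed.

Lemma Top_mV s e Q f c : admissible s e -> L1mx Q -> mV f -> bnd c f -> mV (Top s e Q f).
Proof.
move=> ad iQ mf bf j; have [g [Tg dg]] := Top_ACder j ad iQ mf bf.
apply: eq_cmeas (ACder_cmeas dg) => x; rewrite /= in_itv/= andbT => x0.
by rewrite Tg.
Qed.

End ExponentialOperator.

(** * Dependence on the parameter *)

Section Tools.
Variables (R : realType) (n : nat).
Let mu : {measure set (measurableTypeR R) -> \bar R} := lebesgue_measure.
Let D0 : set (measurableTypeR R) := `[0%R, +oo[%classic.
Let mD0 : measurable D0 := @measurable_0y R.
Let V := R -> 'I_n -> R[i].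
Let Mx := R -> 'M[R[i]]_n.
Implicit Types (f g : V) (Q : Mx).

Lemma tail_indic (h : R -> R) (e : R) : mu.-integrable D0 (EFin \o h) ->
  (forall x, 0 <= h x) -> 0 < e ->
  exists2 T, 0 < T & forall X, T <= X ->
    (\int[mu]_(t in D0) (\1_(`[X, +oo[%classic : set R) t * h t) < e)%R.
Proof.
move=> ih h0 e0; have [T T0 HT] := tail_small ih h0 e0; exists T => // X TX.
have -> : (\int[mu]_(t in D0) (\1_(`[X, +oo[%classic : set R) t * h t) = \int[mu]_(t in `[X, +oo[) h t)%R.
  have E : D0 `&` (`[X, +oo[%classic : set R) = `[X, +oo[%classic.
    apply/setIidPr => x; rewrite /D0 /= !in_itv/= !andbT; apply: le_trans.
    by rewrite (le_trans (ltW T0)).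
  transitivity (\int[mu]_(t in D0 `&` (`[X, +oo[%classic : set R)) h t)%R; last by rewrite E.
  rewrite Rintegral_mkcondr; apply: eq_Rintegral => t _.
  by rewrite patchE indicE; case: (t \in _); rewrite ?mul1r ?mul0r.
exact: HT.
Qed.

Lemma integrable_indicM (A : set (measurableTypeR R)) (h : R -> R) : measurable A ->
  mu.-integrable D0 (EFin \o h) -> mu.-integrable D0 (EFin \o (fun t => \1_A t * h t)).
Proof.
move=> mA ih; have /measurable_int/measurable_EFinP mh := ih.
apply: (le_integrable mD0 _ _ ih).
  by apply/measurable_EFinP; apply: measurable_funM => //; exact: measurable_indic.
move=> x _ /=; rewrite lee_fin normrM indicE.
by case: (x \in A); rewrite ?normr1 ?normr0 ?mul1r ?mul0r.
Qed.

Lemma sumnorm_triangle Q1 Q2 t : sumnorm Q1 t <= sumnorm Q2 t + sumnorm (fun t => Q1 t - Q2 t) t.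
Proof.
rewrite /sumnorm -big_split /=; apply: ler_sum => j _.
rewrite -big_split /=; apply: ler_sum => m _; rewrite !mxE.
by have := le_normcD (Q2 t j m) (Q1 t j m - Q2 t j m); rewrite subrKC.
Qed.

Lemma mass_triangle Q1 Q2 : L1mx Q1 -> L1mx Q2 ->
  mass Q1 <= mass Q2 + mass (fun t => Q1 t - Q2 t).
Proof.
move=> i1 i2; have i12 := L1mxB i1 i2.
rewrite /mass -RintegralD//; try exact: integrable_sumnorm.
apply: le_Rintegral => //; try exact: integrable_sumnorm.
  by apply: integrable_fctD => //; exact: integrable_sumnorm.
by move=> t _; exact: sumnorm_triangle.
Qed.

Definition restr (A : set R) f : V := fun x j => (\1_A x)%:C * f x j.

Lemma mV_restr (A : set (measurableTypeR R)) f : measurable A -> mV f -> mV (restr A f).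
Proof.
by move=> mA mf j; apply: cmeasM => //; apply: cmeas_real; exact: measurable_indic.
Qed.

Lemma bnd_restr (A : set R) c f : bnd c f -> bnd c (restr A f).
Proof.
move=> bf x x0 j; rewrite normcM normc_real indicE.
apply: le_trans (bf x x0 j); case: (x \in A); rewrite ?normr1 ?normr0 ?mul1r ?mul0r//.
exact: normc_ge0.
Qed.

Lemma bnd_add f g c d : bnd c f -> bnd d g -> bnd (c + d) (addV f g).
Proof.
move=> bf bg x x0 j; rewrite mulrDl (le_trans (le_normcD _ _))//.
by apply: lerD; [exact: bf|exact: bg].
Qed.

Lemma bnd_sub f g c d : bnd c f -> bnd d g -> bnd (c + d) (subV f g).
Proof.
move=> bf bg x x0 j; rewrite mulrDl (le_trans (le_normcB _ _))//.
by apply: lerD; [exact: bf|exact: bg].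
Qed.

Lemma bnd_scale (a : R[i]) f c : bnd c f -> bnd (normc a * c) (fun x j => a * f x j).
Proof. by move=> bf x x0 j; rewrite normcM -mulrA ler_wpM2l ?normc_ge0// bf. Qed.

Lemma mV_scale (a : R[i]) f : mV f -> mV (fun x j => a * f x j).
Proof. by move=> mf j; apply: cmeasM => //; exact: cmeas_cst. Qed.

Lemma bnd_weaken f c d : c <= d -> bnd c f -> bnd d f.
Proof. by move=> cd bf x x0 j; rewrite (le_trans (bf x x0 j))// mulr1 mulr1. Qed.

End Tools.

(** * Continuity of the solution in the parameter *)

Section ParameterDependence.
Variables (R : realType) (n : nat) (rho : R -> R).
Let mu : {measure set (measurableTypeR R) -> \bar R} := lebesgue_measure.
Let D0 : set (measurableTypeR R) := `[0%R, +oo[%classic.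
Let mD0 : measurable D0 := @measurable_0y R.
Let V := R -> 'I_n -> R[i].
Let Mx := R -> 'M[R[i]]_n.
Let p := primitive rho.
Hypothesis cI : cond_I rho.
Variables (s : 'I_n -> bool) (c : 'I_n -> R[i]) (Lam : set R[i]).
Variables (Q : R[i] -> Mx) (g f : R[i] -> V) (l0 : R[i]) (d0 K B : R).
Let e l (j : 'I_n) : R[i] := l * c j.
Let T l : V -> V := Top rho s (e l) (Q l).
Hypothesis d0_gt0 : 0 < d0.
Hypothesis K_ge0 : 0 <= K.
Hypothesis B_ge0 : 0 <= B.
Hypothesis Lam_l0 : Lam l0.
Hypothesis adm : forall l, Lam l -> admissible s (e l).
Hypothesis iQ : forall l, Lam l -> L1mx (Q l).
Hypothesis mf : forall l, Lam l -> mV (f l).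
Hypothesis mg : forall l, Lam l -> mV (g l).
Hypothesis fsol : forall l, Lam l -> solves_eq (T l) (f l) (g l).
Hypothesis fB : forall l, Lam l -> normc (l - l0) < d0 -> bnd B (f l).
Hypothesis Tsol : forall l, Lam l -> normc (l - l0) < d0 -> solvable (T l) K.

Let C : R := \sum_j normc (c j).
Let cC j : normc (c j) <= C.
Proof. by rewrite /C (bigD1 j)//= lerDl sumr_ge0// => i _; exact: normc_ge0. Qed.
Let C0 : 0 <= C. Proof. by apply: sumr_ge0 => i _; exact: normc_ge0. Qed.

Let l0l0 : normc (l0 - l0) < d0. Proof. by rewrite subrr normc0. Qed.

Let dist_p x t X : 0 <= x -> 0 <= t -> x <= X -> t <= X -> normc ((p x - p t)%:C : R[i]) <= p X.
Proof.
move=> x0 t0 xX tX; rewrite normc_real ler_norml.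
have := primitive_mono cI x0 xX; have := primitive_mono cI t0 tX.
have := primitive_ge0 cI x0; have := primitive_ge0 cI t0; rewrite -/p => *.
by apply/andP; split; lra.
Qed.

(* On the boundary of the sector the kernels converge only locally uniformly, so
   the difference of two solutions is cut off at a large [X]: what is cut off is
   controlled by the tail of [Q]. *)
Lemma solution_continuous :
  (forall eps, 0 < eps -> exists2 d, 0 < d & forall l, Lam l -> normc (l - l0) < d ->
     mass (fun t => Q l t - Q l0 t) <= eps) ->
  (forall eps, 0 < eps -> exists2 d, 0 < d & forall l, Lam l -> normc (l - l0) < d ->
     bnd eps (subV (g l) (g l0))) ->
  forall x j eps, 0 <= x -> 0 < eps -> exists2 d, 0 < d &
    forall l, Lam l -> normc (l - l0) < d -> normc (f l x j - f l0 x j) <= eps.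
Proof.
move=> HQ Hg x0 j0 eps x00 eps0.
pose m := mass (Q l0) + 1.
have m0 : 0 <= m by rewrite addr_ge0// mass_ge0.
(* The residual [rt] below is at most [eta] times [Z]: 1 + 4 B comes from the equation for the
   difference on [0, X[, and 4 B and 4 m B come from the two tail terms. *)
pose Z := 1 + 8 * B + 4 * m * B.
have mB0 : 0 <= m * B by exact: mulr_ge0.
have Z0 : 0 < Z by rewrite /Z ltr_wpDr ?mulr_ge0// ltr_wpDr ?mulr_ge0.
pose eta := Num.min 1 (eps / ((K + 1) * Z)).
have KZ0 : 0 < (K + 1) * Z by rewrite mulr_gt0// ltr_wpDl.
have eta0 : 0 < eta by rewrite lt_min ltr01 divr_gt0.
have eta1 : eta <= 1 by rewrite ge_min lexx.
have etaZ : K * (eta * Z) <= eps.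
  have : eta <= eps / ((K + 1) * Z) by rewrite ge_min lexx orbT.
  rewrite ler_pdivlMr// => h.
  have : 0 <= eta * Z by rewrite mulr_ge0// ltW.
  by nra.
have iQ0 := iQ Lam_l0.
have [X1 X10 HX1] := tail_indic (integrable_sumnorm iQ0) (sumnorm_ge0 (Q l0)) eta0.
(* Strictly beyond the evaluation point, so the cut-off leaves the value at [x0] unchanged. *)
pose X := Num.max x0 X1 + 1.
have mx1 : x0 <= Num.max x0 X1 by rewrite le_max lexx.
have mx2 : X1 <= Num.max x0 X1 by rewrite le_max lexx orbT.
have x0X : x0 < X by rewrite /X ltr_pwDr.
have X0 : 0 <= X by rewrite (le_trans x00)// ltW.
have tailX : (\int[mu]_(t in D0) (\1_(`[X, +oo[%classic : set R) t * sumnorm (Q l0) t) < eta)%R.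
  by apply: HX1; rewrite /X (le_trans mx2)// lerDl.
pose A : set (measurableTypeR R) := `[X, +oo[%classic.
have mA : measurable A by exact: measurable_itv.
pose Y := 2 * C * p X * mass (Q l0).
have Y0 : 0 <= Y by rewrite /Y !mulr_ge0 ?mass_ge0// primitive_ge0.
have [d1 d10 Hd1] := HQ _ eta0; have [d2 d20 Hd2] := Hg _ eta0.
exists (Num.min d0 (Num.min (Num.min d1 d2) (eta / (Y + 1)))).
  by rewrite !lt_min d0_gt0 d10 d20 divr_gt0// ltr_wpDl.
move=> l Ll; rewrite !lt_min => /and3P[ll0 /andP[ll1 ll2] ll3].
have mQ := Hd1 l Ll ll1; have bg := Hd2 l Ll ll2.
have hY : normc (l - l0) * Y <= eta.
  move: ll3; rewrite ltr_pdivlMr ?ltr_wpDl// => h.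
  by have := normc_ge0 (l - l0); nra.
have iQl := iQ Ll; have iQd := L1mxB iQl iQ0.
have massl : mass (Q l) <= m.
  apply: le_trans (mass_triangle iQl iQ0) _; rewrite lerD2l.
  exact: le_trans eta1.
have adl := adm Ll; have adl0 := adm Lam_l0.
have gl := good_expker cI adl; have gl0 := good_expker cI adl0.
have bfl := fB Ll ll0; have bf0 := fB Lam_l0 l0l0.
have mfl := mf Ll; have mf0 := mf Lam_l0.
pose d := subV (f l) (f l0).
have md : mV d by exact: mV_sub.
have bd : bnd (B + B) d by exact: bnd_sub.
pose u := restr (~` A) d.
have mAc : measurable (~` A) by exact: measurableC.
have mu' : mV u by exact: mV_restr.
have bu : bnd (B + B) u by exact: bnd_restr.
have BB0 : 0 <= B + B by rewrite addr_ge0.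
have mTu : mV (T l u) by exact: Top_mV bu.
have bTu : bnd (m * (B + B)) (T l u).
  by apply: bnd_weaken (Top_bnd cI adl BB0 iQl mu' bu); rewrite ler_wpM2r.
(* On [0, X[ this is the difference [d]; from X on, where the residual of [d] is not controlled, [d]
   is replaced by the operator applied to the cut function [u]. The residual of the new function
   beyond X is then a tail term alone. *)
pose dt := addV u (restr A (T l u)).
have mrTu : mV (restr A (T l u)) by exact: mV_restr.
have brTu : bnd (m * (B + B)) (restr A (T l u)) by exact: bnd_restr.
have mdt : mV dt by exact: mV_add.
have bdt : bnd (B + B + m * (B + B)) dt by exact: bnd_add.
have mTdt : mV (T l dt) by exact: Top_mV bdt.
pose rt := subV dt (T l dt).
have mrt : mV rt by exact: mV_sub.
have tailT v b x j : mV v -> bnd b v -> 0 <= b -> 0 <= x ->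
    normc (T l (restr A v) x j) <= b * (eta + eta).
  move=> mv bv b0 x00'.
  have mrv := mV_restr mA mv.
  have [mk kk] := gl j x x00'.
  have iA := integrable_indicM mA (integrable_sumnorm iQ0).
  apply: (@le_trans _ _ (\int[mu]_(t in D0) (b * (\1_A t * sumnorm (Q l0) t + sumnorm (fun t => Q l t - Q l0 t) t)))%R).
    apply: Kop_le => //.
    - apply: integrable_fctZ => //; apply: integrable_fctD => //.
      exact: integrable_sumnorm.
    - move=> t _; rewrite mulr_ge0// addr_ge0 ?sumnorm_ge0// mulr_ge0 ?sumnorm_ge0//.
    - move=> t Jt; have [t0 _] := JsetP x00' Jt.
      rewrite normcM; apply: (@le_trans _ _ (normc (row_mul (Q l) (restr A v) t j))).
        by rewrite ler_piMl ?normc_ge0// kk.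
      apply: (@le_trans _ _ (b * (\1_A t) * sumnorm (Q l) t)).
        apply: normc_row_mul => i; rewrite /restr normcM mulrC normc_real ger0_norm//.
        by rewrite ler_wpM2r//; have := bv t t0 i; rewrite mulr1.
      rewrite -mulrA ler_wpM2l//.
      have := sumnorm_triangle (Q l) (Q l0) t; have := sumnorm_ge0 (fun t => Q l t - Q l0 t) t.
      by rewrite indicE; case: (t \in A) => /=; rewrite ?mul1r ?mul0r ?add0r.
  rewrite RintegralZl//; last first.
    by apply: integrable_fctD => //; exact: integrable_sumnorm.
  rewrite ler_wpM2l// RintegralD//; last exact: integrable_sumnorm.
  by apply: lerD => //; exact: ltW.
(* Three sources of the difference: the right-hand side, the coefficients, the kernel. *)
have rE x j : 0 <= x -> d x j - T l d x j =
    (g l x j - g l0 x j) + (Kop s (expker rho (e l)) (fun t => Q l t - Q l0 t) (f l0) x j +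
    Kop s (fun j x t => expker rho (e l) j x t - expker rho (e l0) j x t) (Q l0) (f l0) x j).
  move=> xx0; rewrite (Kop_Qsub j gl iQl iQ0 mf0 bf0 xx0) (Kop_ksub j gl gl0 iQ0 mf0 bf0 xx0).
  rewrite [T l d x j](Kop_sub j gl iQl mfl mf0 bfl bf0 xx0).
  rewrite /d /subV (fsol Ll xx0) (fsol Lam_l0 xx0) /T /Top.
  by do !move: (Kop _ _ _ _ _ _) => ?; ring.
have rB x j : 0 <= x -> x < X -> normc (d x j - T l d x j) <= eta + (eta * B + B * (eta + 2 * eta)).
  move=> xx0 xX; rewrite rE//.
  apply: le_trans (le_normcD _ _) _; apply: lerD; first by have := bg x xx0 j; rewrite mulr1.
  apply: le_trans (le_normcD _ _) _; apply: lerD.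
    have := Kop_bnd ler01 B_ge0 gl iQd mf0 bf0 xx0 j; rewrite mulr1 mul1r => /le_trans; apply.
    by rewrite mulrC ler_wpM2r.
  have iA := integrable_indicM mA (integrable_sumnorm iQ0).
  pose h1 t := (normc (l - l0) * (2 * C * p X)) * sumnorm (Q l0) t.
  pose h2 t := 2 * (\1_A t * sumnorm (Q l0) t).
  have ih1 : mu.-integrable D0 (EFin \o h1) by apply: integrable_fctZ => //; exact: integrable_sumnorm.
  have ih2 : mu.-integrable D0 (EFin \o h2) by exact: integrable_fctZ.
  have P0 : 0 <= normc (l - l0) * (2 * C * p X).
    by rewrite mulr_ge0 ?normc_ge0// !mulr_ge0// primitive_ge0.
  apply: (@le_trans _ _ (\int[mu]_(t in D0) (B * (h1 t + h2 t)))%R).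
    have [mk1 kk1] := gl j x xx0; have [mk2 kk2] := gl0 j x xx0.
    apply: Kop_le => //.
    - exact: cmeasB.
    - by apply: integrable_fctZ => //; exact: integrable_fctD.
    - move=> t _; rewrite mulr_ge0// addr_ge0// mulr_ge0 ?sumnorm_ge0// mulr_ge0// sumnorm_ge0//.
    - move=> t Jt; have [t0 _] := JsetP xx0 Jt.
      have S0 := sumnorm_ge0 (Q l0) t.
      have rb : normc (row_mul (Q l0) (f l0) t j) <= B * sumnorm (Q l0) t.
        by apply: normc_row_mul => i; have := bf0 t t0 i; rewrite mulr1.
      (* For t < X the phases differ by at most |l - l0| C p(X). For t >= X there is only the
         trivial bound 2, for which the tail of [Q l0] compensates. *)
      have kb : normc (expker rho (e l) j x t - expker rho (e l0) j x t) <=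
          normc (l - l0) * (2 * C * p X) + 2 * \1_A t.
        have [tX|Xt] := ltP t X; last first.
          rewrite indicE mem_set ?mulr1; last by rewrite /A /= in_itv/= Xt.
          apply: le_trans (le_normcB _ _) _.
          by have := kk1 t Jt; have := kk2 t Jt; lra.
        rewrite indicE memNset ?mulr0 ?addr0; last first.
          by rewrite /A /= in_itv/= andbT; apply/negP; rewrite -ltNge.
        apply: le_trans (cexp_lipschitz (Re_expker cI adl xx0 Jt) (Re_expker cI adl0 xx0 Jt)) _.
        rewrite expR0 mulr1 -mulrBl normcM /e -mulrBl normcM -mulr_natl.
        have := dist_p xx0 t0 (ltW xX) (ltW tX); have := cC j; have := normc_ge0 (c j).
        have := normc_ge0 (l - l0); have := normc_ge0 ((p x - p t)%:C : R[i]).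
        rewrite -/p => a1 a2 a3 a4 a5.
        have : normc (c j) * normc ((p x - p t)%:C : R[i]) <= C * p X by exact: ler_pM.
        move: (normc (c j)) (normc ((p x - p t)%:C)) (normc (l - l0)) a2 => q1 q2 q3 a2 h.
        have : q3 * (q1 * q2) <= q3 * (C * p X) by rewrite ler_wpM2l.
        by lra.
      rewrite normcM; apply: (@le_trans _ _ ((normc (l - l0) * (2 * C * p X) + 2 * \1_A t) * (B * sumnorm (Q l0) t))).
        by apply: ler_pM; rewrite ?normc_ge0.
      by rewrite le_eqVlt /h1 /h2; apply/orP; left; apply/eqP; ring.
  rewrite RintegralZl//; last exact: integrable_fctD.
  rewrite ler_wpM2l// RintegralD//.
  have E1 : (\int[mu]_(t in D0) h1 t = normc (l - l0) * (2 * C * p X) * mass (Q l0))%R.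
    by rewrite /h1 RintegralZl//; exact: integrable_sumnorm.
  have E2 : (\int[mu]_(t in D0) h2 t = 2 * \int[mu]_(t in D0) (\1_A t * sumnorm (Q l0) t))%R.
    by rewrite /h2 RintegralZl.
  rewrite E1 E2; apply: lerD; first by rewrite -mulrA.
  by rewrite ler_wpM2l// ltW.
have rtB : bnd (eta * Z) rt.
  move=> x xx0 j; rewrite mulr1 /rt /subV.
  have E1 : T l dt x j = T l u x j + T l (restr A (T l u)) x j.
    have := Kop_sub j gl iQl mdt mu' bdt bu xx0.
    have -> : subV dt u = restr A (T l u).
      by apply/funext => y; apply/funext => i; rewrite /subV /dt /addV addrAC subrr add0r.
    by rewrite /T /Top => ->; rewrite subrKC.
  have t1 := tailT _ _ x j mTu bTu (mulr_ge0 m0 BB0) xx0.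
  have [xX|Xx] := ltP x X.
    have dtE : dt x j = d x j.
      rewrite /dt /addV /u /restr !indicE mem_set ?mul1r; last first.
        by rewrite /A /= in_itv/= andbT; apply/negP; rewrite -ltNge.
      by rewrite memNset ?mul0r ?addr0// /A /= in_itv/= andbT; apply/negP; rewrite -ltNge.
    have E2 : T l d x j = T l u x j + T l (restr A d) x j.
      have := Kop_sub j gl iQl md mu' bd bu xx0.
      have -> : subV d u = restr A d.
        apply/funext => y; apply/funext => i; rewrite /subV /u /restr !indicE in_setC.
        by case: (y \in A) => /=; ring.
      by rewrite /T /Top => ->; rewrite subrKC.
    have t2 := tailT _ _ x j md bd BB0 xx0.
    have r1 := rB x j xx0 xX.
    have -> : dt x j - T l dt x j = (d x j - T l d x j) + T l (restr A d) x j - T l (restr A (T l u)) x j.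
      rewrite dtE E1 E2; do !move: (T l _ x j) => ?; ring.
    apply: le_trans (le_normcB _ _) _; have := le_normcD (d x j - T l d x j) (T l (restr A d) x j).
    rewrite /Z => h; move: r1 t1 t2 h.
    move: (normc _) (normc _) (normc _) (normc _) => q1 q2 q3 q4 r1 t1 t2 h.
    by lra.
  have dtE : dt x j = T l u x j.
    rewrite /dt /addV /u /restr !indicE memNset ?mul0r; last first.
      by move=> /=; apply; rewrite /A /= in_itv/= Xx.
    by rewrite mem_set ?mul1r ?add0r// /A /= in_itv/= Xx.
  rewrite dtE E1 opprD addNKr normcN (le_trans t1)// /Z.
  have : 0 <= eta * B by rewrite mulr_ge0// ltW.
  have : 0 <= eta * (m * B) by rewrite mulr_ge0 ?(ltW eta0)// mulr_ge0.
  by lra.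
have dts : solves_eq (T l) dt rt by move=> x xx0 j; rewrite /rt /subV subrK.
have := (Tsol Ll ll0).2 dt rt _ _ mdt mrt bdt rtB dts x0 x00 j0; rewrite mulr1.
have -> : dt x0 j0 = f l x0 j0 - f l0 x0 j0.
  rewrite /dt /addV /u /restr !indicE mem_set ?mul1r; last first.
    by rewrite /A /= in_itv/= andbT; apply/negP; rewrite -ltNge.
  by rewrite memNset ?mul0r ?addr0// /A /= in_itv/= andbT; apply/negP; rewrite -ltNge.
by move=> /le_trans; apply.
Qed.

End ParameterDependence.

(** * Differentiability of the solution in the parameter *)

Section ExponentialBounds.
Variable R : realType.

Lemma mul_expRN_le1 (y : R) : 0 <= y -> y * expR (- y) <= 1.
Proof.
move=> y0; rewrite expRN ler_pdivrMr ?expR_gt0// mul1r.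
by apply: le_trans (expR_ge1Dx y); rewrite lerDr.
Qed.

Lemma mul_expRN_le (d t : R) : 0 < d -> 0 <= t -> t * expR (- (d * t)) <= d^-1.
Proof.
move=> d0 t0; have := @mul_expRN_le1 (d * t) (mulr_ge0 (ltW d0) t0).
by rewrite -mulrA mulrC -ler_pdivlMr// mul1r.
Qed.

(** The square of the first-order estimate at rate [d] / 2. *)
Lemma sqr_mul_expRN_le (d t : R) : 0 < d -> 0 <= t ->
  t ^+ 2 * expR (- (d * t)) <= 4 / d ^+ 2.
Proof.
move=> d0 t0; have d20 : 0 < d / 2 by rewrite divr_gt0.
have h := mul_expRN_le d20 t0.
have -> : t ^+ 2 * expR (- (d * t)) = (t * expR (- (d / 2 * t))) ^+ 2.
  by rewrite exprMn [X in _ = _ * X]expr2 -expRD; congr (_ * expR _); field.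
rewrite [leRHS](_ : _ = (d / 2)^-1 ^+ 2); last by field; rewrite gt_eqF.
by rewrite ler_sqr ?nnegrE// ?mulr_ge0 ?expR_ge0// invr_ge0 ltW.
Qed.

(** The decay exp(- d t) pays for the second-order remainder: one half of it absorbs the growth
    exp(d t / 2), the other half the factor t^2. The 64 is 4 from [cexp_sub1_linear] times 16 from
    t^2 exp(- d t / 2) <= 16 / d^2. *)
Lemma cexp_quotient_bound (z h : R[i]) (d t C : R) : 0 < d -> 0 <= t ->
  Re z <= - d -> h != 0 -> normc h * C <= d / 2 ->
  forall c : R[i], normc c <= C ->
  normc (h^-1 * (cexp (z * t%:C + h * c * t%:C) - cexp (z * t%:C)) - c * t%:C * cexp (z * t%:C))
    <= normc h * (64 * C ^+ 2 / d ^+ 2).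
Proof.
move=> d0 t0 zd h0 hC c cC; set w := h * c * t%:C.
have C0 : 0 <= C by apply: le_trans cC; exact: normc_ge0.
have -> : h^-1 * (cexp (z * t%:C + w) - cexp (z * t%:C)) - c * t%:C * cexp (z * t%:C) =
    h^-1 * (cexp w - 1 - w) * cexp (z * t%:C).
  rewrite cexpD [X in _ - X * cexp _](_ : c * t%:C = h^-1 * w); first by ring.
  by rewrite /w !mulrA mulVf// mul1r.
rewrite normcM normcM normcV normc_cexp.
have nw : normc w <= d / 2 * t.
  rewrite /w normcM normcM normc_real (ger0_norm t0) ler_wpM2r// (le_trans _ hC)//.
  by rewrite ler_wpM2l ?normc_ge0.
have nw' : normc w <= normc h * C * t.
  by rewrite /w normcM normcM normc_real (ger0_norm t0) ler_wpM2r// ler_wpM2l ?normc_ge0.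
have hp : 0 < normc h by rewrite normc_gt0.
have Rz : Re (z * t%:C) <= - (d * t) by rewrite ReM /= mulr0 subr0 -mulNr ler_wpM2r.
apply: (@le_trans _ _ ((normc h)^-1 * ((normc h * C * t) ^+ 2 * expR (d / 2 * t) *+ 4) * expR (- (d * t)))).
  apply: ler_pM; rewrite ?expR_ge0 ?mulr_ge0 ?invr_ge0 ?normc_ge0 ?ler_expR//.
  rewrite ler_wpM2l ?invr_ge0 ?normc_ge0// (le_trans (cexp_sub1_linear w))//.
  rewrite ler_wMn2r// ler_pM ?exprn_ge0 ?normc_ge0 ?expR_ge0 ?ler_expR//.
  by rewrite ler_sqr ?nnegrE ?normc_ge0// !mulr_ge0 ?normc_ge0.
have -> : (normc h)^-1 * ((normc h * C * t) ^+ 2 * expR (d / 2 * t) *+ 4) * expR (- (d * t)) =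
    normc h * (4 * C ^+ 2) * (t ^+ 2 * expR (- (d / 2 * t))).
  have -> : expR (- (d * t)) = expR (- (d / 2 * t)) * expR (- (d / 2 * t)).
    by rewrite -expRD; congr expR; field.
  have EE : expR (d / 2 * t) * expR (- (d / 2 * t)) = 1 by rewrite -expRD subrr expR0.
  rewrite -mulr_natl.
  transitivity (normc h * (4 * C ^+ 2) * (t ^+ 2 * expR (- (d / 2 * t))) * (expR (d / 2 * t) * expR (- (d / 2 * t)))); last by rewrite EE mulr1.
  by move: (expR _) (expR _) => u v; field; rewrite gt_eqF.
have d20 : 0 < d / 2 by rewrite divr_gt0.
have := sqr_mul_expRN_le d20 t0 => sq.
have -> : normc h * (64 * C ^+ 2 / d ^+ 2) = normc h * (4 * C ^+ 2) * (4 / (d / 2) ^+ 2).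
  by field; rewrite gt_eqF.
by rewrite ler_wpM2l// !mulr_ge0 ?normc_ge0 ?exprn_ge0.
Qed.

End ExponentialBounds.

Section Differentiability.
Variables (R : realType) (n : nat) (rho : R -> R).
Let mu : {measure set (measurableTypeR R) -> \bar R} := lebesgue_measure.
Let D0 : set (measurableTypeR R) := `[0%R, +oo[%classic.
Let mD0 : measurable D0 := @measurable_0y R.
Let V := R -> 'I_n -> R[i].
Let Mx := R -> 'M[R[i]]_n.
Let p := primitive rho.
Hypothesis cI : cond_I rho.
Variables (s : 'I_n -> bool) (c : 'I_n -> R[i]).
Variables (Q : R[i] -> Mx) (g f : R[i] -> V) (l0 : R[i]) (d0 K B del : R).
Variables (Q' : Mx) (g' : V).
Let e l (j : 'I_n) : R[i] := l * c j.
Let T l : V -> V := Top rho s (e l) (Q l).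
Let near_l0 l := normc (l - l0) < d0.
Hypothesis d0_gt0 : 0 < d0.
Hypothesis K_ge0 : 0 <= K.
Hypothesis B_ge0 : 0 <= B.
Hypothesis adm : forall l, near_l0 l -> admissible s (e l).
Hypothesis iQ : forall l, near_l0 l -> L1mx (Q l).
Hypothesis mf : forall l, near_l0 l -> mV (f l).
Hypothesis mg : forall l, near_l0 l -> mV (g l).
Hypothesis fsol : forall l, near_l0 l -> solves_eq (T l) (f l) (g l).
Hypothesis fB : forall l, near_l0 l -> bnd B (f l).
Hypothesis Tsol : forall l, near_l0 l -> solvable (T l) K.
Hypothesis del_gt0 : 0 < del.
Hypothesis strict : forall j, c j = 0 \/
  (if s j then Re (l0 * c j) <= - del else del <= Re (l0 * c j)).
Hypothesis iQ' : L1mx Q'.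
Hypothesis mg' : mV g'.

Let C : R := \sum_j normc (c j).
Let cC j : normc (c j) <= C.
Proof. by rewrite /C (bigD1 j)//= lerDl sumr_ge0// => i _; exact: normc_ge0. Qed.
Let C0 : 0 <= C. Proof. by apply: sumr_ge0 => i _; exact: normc_ge0. Qed.

Let n0 : near_l0 l0. Proof. by rewrite /near_l0 subrr normc0. Qed.

Let k0 := expker rho (e l0).
(** The derivative of the kernel with respect to l at [l0]; [kd] is the error of the difference
    quotient. *)
Let kp (j : 'I_n) x t : R[i] := c j * (p x - p t)%:C * k0 j x t.
Let kd l (j : 'I_n) x t : R[i] := (l - l0)^-1 * (expker rho (e l) j x t - k0 j x t) - kp j x t.
Let Qd l : Mx := fun t => (l - l0)^-1 *: (Q l t - Q l0 t) - Q' t.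

Let cmeas_kp j x : cmeas D0 (kp j x).
Proof.
apply: cmeasM; last exact: cmeas_expker.
apply: cmeasM; first exact: cmeas_cst.
under eq_fun do rewrite rmorphB; apply: cmeasB; first exact: cmeas_cst.
exact: cmeas_primitive.
Qed.

(** Both directions of integration are brought to one form: a nonnegative distance [a] times a
    coefficient [b] along which the exponential decays at rate at least [del]. *)
Let signed j x t : 0 <= x -> Jset (s j) x t -> c j != 0 -> exists (a : R) (b : R[i]),
  [/\ 0 <= a, c j * (p x - p t)%:C = b * a%:C, normc b <= C & Re (l0 * b) <= - del].
Proof.
move=> x0 Jt cj0; have [|H] := strict j; first by move/eqP; rewrite (negbTE cj0).
have [t0] := JsetP x0 Jt; move: H.
case: (s j) => H tx.
  exists (p x - p t), (c j); split => //.
  by rewrite subr_ge0 primitive_mono.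
exists (p t - p x), (- c j); split => //.
- by rewrite subr_ge0 primitive_mono.
- by rewrite mulNr -mulrN -rmorphN opprB.
- by rewrite normcN.
- by rewrite mulrN ReN lerN2.
Qed.

(** Strict decay enters here: the factor p(x) - p(t) may be unbounded, and t exp(- del t) <= 1 / del
    tames it. *)
Let good_kp : good_kernel s kp (C / del).
Proof.
move=> j x x0; split; first by apply: (cmeasS mD0 _ (cmeas_kp j x)); exact: Jset_sub.
move=> t Jt; have Cd : 0 <= C / del by rewrite divr_ge0// ltW.
have [cj|cj] := eqVneq (c j) 0; first by rewrite /kp cj !mul0r normc0.
have [a [b [a0 E bC bd]]] := signed x0 Jt cj.
rewrite /kp /k0 /expker /e -[l0 * c j * _]mulrA E mulrA normcM normcM normc_real (ger0_norm a0) normc_cexp.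
rewrite -mulrA; apply: ler_pM; rewrite ?normc_ge0 ?mulr_ge0 ?expR_ge0//.
apply: le_trans (mul_expRN_le del_gt0 a0); rewrite ler_wpM2l// ler_expR.
by rewrite ReM /= mulr0 subr0 -mulNr ler_wpM2r.
Qed.

Let C2 := 64 * C ^+ 2 / del ^+ 2.
Let C20 : 0 <= C2.
Proof. by rewrite /C2 !mulr_ge0 ?invr_ge0 ?exprn_ge0// ltW. Qed.

Let good_kd l : near_l0 l -> l != l0 -> normc (l - l0) * C <= del / 2 ->
  good_kernel s (kd l) (normc (l - l0) * C2).
Proof.
move=> nl ll0 hC j x x0; split.
  suff H : cmeas D0 (kd l j x) by apply: (cmeasS mD0 _ H); exact: Jset_sub.
  apply: cmeasB; last exact: cmeas_kp.
  apply: cmeasM; first exact: cmeas_cst.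
  by apply: cmeasB; exact: cmeas_expker.
move=> t Jt; have h0 : l - l0 != 0 by rewrite subr_eq0.
have [cj|cj] := eqVneq (c j) 0.
  rewrite /kd /kp /k0 /expker /e cj !mulr0 !mul0r subrr mulr0 subr0 normc0.
  by rewrite mulr_ge0// normc_ge0.
have [a [b [a0 E bC bd]]] := signed x0 Jt cj.
have := cexp_quotient_bound del_gt0 a0 bd h0 hC bC.
rewrite /kd /kp /k0 /expker /e -[l0 * c j * _]mulrA -[l * c j * _]mulrA E.
rewrite (_ : l * (b * a%:C) = l0 * b * a%:C + (l - l0) * b * a%:C); last by ring.
by rewrite [l0 * (b * a%:C)]mulrA.
Qed.

(** Product rule: derivative of the kernel plus derivative of the coefficients. *)
Let T' h : V := fun x j => Kop s kp (Q l0) h x j + Kop s k0 Q' h x j.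

(** Bounds the distance from the difference quotient of the operators to [T']. The terms are the
    error of the kernel, the price of freezing the coefficients at [l0], and the error of their
    difference quotient. *)
Let omega l : R := normc (l - l0) * C2 * mass (Q l) + C / del * mass (fun t => Q l t - Q l0 t) +
  mass (Qd l).

Let gk0 : good_kernel s k0 1.
Proof. exact: (good_expker cI (adm n0)). Qed.

Let iQd l : near_l0 l -> L1mx (Qd l).
Proof. by move=> nl; apply: L1mxB => //; apply: L1mxZ; apply: L1mxB; exact: iQ. Qed.

Let quotient_bound l h b : near_l0 l -> l != l0 -> normc (l - l0) * C <= del / 2 ->
  mV h -> bnd b h -> 0 <= b ->
  bnd (omega l * b) (fun x j => (l - l0)^-1 * (T l h x j - T l0 h x j) - T' h x j).
Proof.
move=> nl ll0 hC mh bh b0 x x0 j; rewrite mulr1.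
have gkl := good_expker cI (adm nl); have gkd := good_kd nl ll0 hC.
have h0 : l - l0 != 0 by rewrite subr_eq0.
have iQl := iQ nl; have iQ0 := iQ n0; have iQs := L1mxB iQl iQ0; have iQdl := iQd nl.
have gks : good_kernel s (fun j x t => expker rho (e l) j x t - k0 j x t) 2.
  move=> i y y0; have [m1 b1] := gkl i y y0; have [m2 b2] := gk0 i y0; split; first exact: cmeasB.
  by move=> t Jt; apply: le_trans (le_normcB _ _) _; have := b1 t Jt; have := b2 t Jt; lra.
have gksz : good_kernel s (fun j x t => (l - l0)^-1 * (expker rho (e l) j x t - k0 j x t)) (normc (l - l0)^-1 * 2).
  move=> i y y0; have [m1 b1] := gks i y y0; split.
    by apply: cmeasM => //; exact: cmeas_cst.
  by move=> t Jt; rewrite normcM ler_wpM2l ?normc_ge0// b1.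
have -> : (l - l0)^-1 * (T l h x j - T l0 h x j) - T' h x j =
    Kop s (kd l) (Q l) h x j + Kop s kp (fun t => Q l t - Q l0 t) h x j + Kop s k0 (Qd l) h x j.
  rewrite /kd (Kop_ksub j gksz good_kp iQl mh bh x0) (Kop_kscale _ j gks iQl mh bh x0).
  rewrite (Kop_ksub j gkl gk0 iQl mh bh x0) (Kop_Qsub j good_kp iQl iQ0 mh bh x0).
  rewrite /Qd (Kop_Qsub j gk0 (L1mxZ _ iQs) iQ' mh bh x0) (Kop_Qscale _ j gk0 iQs mh bh x0).
  rewrite (Kop_Qsub j gk0 iQl iQ0 mh bh x0) /T' /T /Top -/k0.
  by do !move: (Kop _ _ _ _ _ _) => ?; ring.
have P : 0 <= normc (l - l0) * C2 by rewrite mulr_ge0 ?normc_ge0.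
have Cd : 0 <= C / del by rewrite divr_ge0// ltW.
have B1 := Kop_bnd P b0 gkd iQl mh bh x0 j.
have B2 := Kop_bnd Cd b0 good_kp iQs mh bh x0 j.
have B3 := Kop_bnd ler01 b0 gk0 iQdl mh bh x0 j.
rewrite !mulr1 ?mul1r in B1 B2 B3.
apply: le_trans (le_normcD _ _) _; rewrite /omega !mulrDl; apply: lerD; last by rewrite mulrC.
apply: le_trans (le_normcD _ _) _; apply: lerD; first by rewrite mulrAC.
by rewrite mulrAC.
Qed.

Let T'_bnd h b : mV h -> bnd b h -> 0 <= b -> bnd ((C / del * mass (Q l0) + mass Q') * b) (T' h).
Proof.
move=> mh bh b0 x x0 j; rewrite mulr1 /T'.
have Cd : 0 <= C / del by rewrite divr_ge0// ltW.
have B2 := Kop_bnd Cd b0 good_kp (iQ n0) mh bh x0 j.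
have B3 := Kop_bnd ler01 b0 gk0 iQ' mh bh x0 j.
rewrite !mulr1 ?mul1r in B2 B3.
apply: le_trans (le_normcD _ _) _; rewrite mulrDl; apply: lerD; first by rewrite mulrAC.
by rewrite mulrC.
Qed.

Hypothesis HQ : forall eps, 0 < eps -> exists2 d, 0 < d & forall l, l != l0 -> normc (l - l0) < d ->
  mass (Qd l) <= eps.
Hypothesis Hg : forall eps, 0 < eps -> exists2 d, 0 < d & forall l, l != l0 -> normc (l - l0) < d ->
  bnd eps (fun x j => (l - l0)^-1 * (g l x j - g l0 x j) - g' x j).

Let massZ (a : R[i]) M : L1mx M -> mass (fun t => a *: M t : 'M[R[i]]_n) = normc a * mass M.
Proof.
move=> iM; rewrite /mass -RintegralZl//; last exact: integrable_sumnorm.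
apply: eq_Rintegral => t _; rewrite /sumnorm mulr_sumr; apply: eq_bigr => j _.
by rewrite mulr_sumr; apply: eq_bigr => m _; rewrite mxE normcM.
Qed.

Let mass_diff l : near_l0 l -> l != l0 ->
  mass (fun t => Q l t - Q l0 t) <= normc (l - l0) * (mass Q' + mass (Qd l)).
Proof.
move=> nl ll0; have h0 : l - l0 != 0 by rewrite subr_eq0.
have iQs := L1mxB (iQ nl) (iQ n0).
rewrite (_ : (fun t => Q l t - Q l0 t) = (fun t => (l - l0) *: ((l - l0)^-1 *: (Q l t - Q l0 t)))).
  rewrite massZ; last exact: L1mxZ.
  by rewrite ler_wpM2l ?normc_ge0//; apply: mass_triangle => //; exact: L1mxZ.
by apply/funext => t; rewrite scalerA divff// scale1r.
Qed.

Let omega_small eps : 0 < eps -> exists2 d, 0 < d & forall l, l != l0 -> normc (l - l0) < d ->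
  near_l0 l /\ omega l <= eps.
Proof.
move=> eps0; pose eta := Num.min 1 (eps / 2).
have eta0 : 0 < eta by rewrite lt_min ltr01 divr_gt0.
have [d d_gt0 Hd] := HQ eta0.
pose m := mass (Q l0) + (mass Q' + 1).
have m0 : 0 <= m by rewrite !addr_ge0// mass_ge0.
have Cd : 0 <= C / del by rewrite divr_ge0// ltW.
pose Z := C2 * m + C / del * (mass Q' + 1) + 1.
have mQ1 : 0 <= mass Q' + 1 by rewrite addr_ge0 ?mass_ge0.
have ZZ : 0 < Z by rewrite ltr_wpDl// addr_ge0 ?(mulr_ge0 C20 m0) ?(mulr_ge0 Cd mQ1).
exists (Num.min (Num.min d0 1) (Num.min d (eps / 2 / Z))).
  by rewrite !lt_min d0_gt0 d_gt0 ltr01 !divr_gt0.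
move=> l ll0; rewrite !lt_min => /andP[/andP[nl l1] /andP[ld lz]]; split => //.
have Qde := Hd l ll0 ld.
have Qd1 : mass (Qd l) <= 1 by rewrite (le_trans Qde)// ge_min lexx.
have Qd2 : mass (Qd l) <= eps / 2 by rewrite (le_trans Qde)// ge_min lexx orbT.
have md := mass_diff nl ll0.
have N0 := normc_ge0 (l - l0).
have Q'0 := mass_ge0 Q'; have md' : mass (fun t => Q l t - Q l0 t) <= normc (l - l0) * (mass Q' + 1).
  by apply: le_trans md _; rewrite ler_wpM2l// lerD2l.
have ml : mass (Q l) <= m.
  apply: le_trans (mass_triangle (iQ nl) (iQ n0)) _; rewrite /m lerD2l (le_trans md')//.
  by rewrite ler_piMl ?addr_ge0// ltW.
move: lz; rewrite ltr_pdivlMr// => lz.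
have h1 : normc (l - l0) * C2 * mass (Q l) <= normc (l - l0) * (C2 * m).
  by rewrite -mulrA ler_wpM2l// ler_wpM2l.
have h2 : C / del * mass (fun t => Q l t - Q l0 t) <= normc (l - l0) * (C / del * (mass Q' + 1)).
  by rewrite mulrCA ler_wpM2l.
have h3 : normc (l - l0) * Z = normc (l - l0) * (C2 * m) + normc (l - l0) * (C / del * (mass Q' + 1)) + normc (l - l0).
  by rewrite /Z; ring.
rewrite /omega; apply: le_trans (lerD (lerD h1 h2) Qd2) _.
apply: (@le_trans _ _ (normc (l - l0) * Z + eps / 2)); first by rewrite lerD2r h3 lerDl.
rewrite [leRHS](splitr eps) lerD2r; exact: ltW.
Qed.

(** The kernel of [T'] carries the factor p(x) - p(t), so [Top_mV] does not cover it; measurability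
    in x is inherited from difference quotients along a sequence of parameters that makes them
    converge geometrically. *)
Let T'_mV h b : mV h -> bnd b h -> 0 <= b -> mV (T' h).
Proof.
move=> mh bh b0.
have ex m : exists l, [/\ near_l0 l, l != l0, normc (l - l0) * C <= del / 2 & omega l <= 1 / 2 ^+ m].
  have [|d d_gt0 Hd] := @omega_small (1 / 2 ^+ m); first by rewrite divr_gt0// exprn_gt0.
  pose a := Num.min (d / 2) (del / 2 / (C + 1)).
  have a0 : 0 < a by rewrite lt_min !divr_gt0// ltr_wpDl.
  have E : l0 + a%:C - l0 = a%:C by rewrite addrAC subrr add0r.
  have Na : normc (l0 + a%:C - l0) = a by rewrite E normc_real gtr0_norm.
  have ll0 : l0 + a%:C != l0.
    by rewrite -subr_eq0 -normc_eq0 Na gt_eqF.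
  have ad : a < d.
    by apply: (@le_lt_trans _ _ (d / 2)); [rewrite ge_min lexx|rewrite ltr_pdivrMr// ltr_pMr// ltr1n].
  exists (l0 + a%:C); have [|nl om] := Hd (l0 + a%:C) ll0; first by rewrite Na.
  split => //; rewrite Na.
  have : a <= del / 2 / (C + 1) by rewrite ge_min lexx orbT.
  rewrite ler_pdivlMr ?ltr_wpDl// => h1; apply: le_trans h1.
  by rewrite ler_wpM2l ?(ltW a0)// lerDl.
pose lm m := projT1 (cid (ex m)).
have lmP m : [/\ near_l0 (lm m), lm m != l0, normc (lm m - l0) * C <= del / 2 & omega (lm m) <= 1 / 2 ^+ m].
  exact: projT2 (cid (ex m)).
apply: (@mV_lim _ _ (fun m x j => (lm m - l0)^-1 * (T (lm m) h x j - T l0 h x j)) _ (fun=> b)).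
  move=> m; have [nl _ _ _] := lmP m; apply: mV_scale; apply: mV_sub.
    by apply: (Top_mV cI (adm nl) (iQ nl) mh bh).
  by apply: (Top_mV cI (adm n0) (iQ n0) mh bh).
move=> m x x0 j; have [nl ll0 lC om] := lmP m; rewrite normcB_sym.
have := quotient_bound nl ll0 lC mh bh b0 x0 j; rewrite mulr1 => /le_trans; apply.
by rewrite mulrC ler_wpM2l// (le_trans om)// mul1r.
Qed.

(** The candidate w solves the differentiated equation w = g' + T' f(l0) + T(l0) w. The difference
    quotient of f, minus w, solves the equation at l up to a small residual, and stability at l
    concludes. *)
Lemma solution_derivable : exists f' : V, forall x j eps, 0 <= x -> 0 < eps ->
  exists2 d, 0 < d & forall l, l != l0 -> normc (l - l0) < d ->
    normc ((l - l0)^-1 * (f l x j - f l0 x j) - f' x j) <= eps.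
Proof.
have mf0 := mf n0; have bf0 := fB n0.
have mT' := T'_mV mf0 bf0 B_ge0; have bT' := T'_bnd mf0 bf0 B_ge0.
(* [g'] is bounded because a difference quotient of [g] is close to it, and [g] is bounded because
   it equals f - T f. *)
have [bg' mg'b] : exists b, bnd b g'.
  have [d d_gt0 Hd] := Hg ltr01.
  pose a := Num.min d d0 / 2.
  have md0 : 0 < Num.min d d0 by rewrite lt_min d_gt0.
  have a0 : 0 < a by rewrite divr_gt0.
  have am : a < Num.min d d0 by rewrite ltr_pdivrMr// ltr_pMr// ltr1n.
  have E : l0 + a%:C - l0 = a%:C by rewrite addrAC subrr add0r.
  have Na : normc (l0 + a%:C - l0) = a by rewrite E normc_real gtr0_norm.
  have ll0 : l0 + a%:C != l0 by rewrite -subr_eq0 -normc_eq0 Na gt_eqF.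
  move: am; rewrite lt_min => /andP[ad ad0].
  have nl : near_l0 (l0 + a%:C) by rewrite /near_l0 Na.
  have b1 := Hd _ ll0 ltac:(by rewrite Na).
  have gE l : near_l0 l -> bnd (B + mass (Q l) * B) (g l).
    move=> nl' x x0 j.
    have -> : g l x j = f l x j - T l (f l) x j by rewrite (fsol nl' x0 j) addrK.
    rewrite mulrDl; apply: le_trans (le_normcB _ _) _; apply: lerD; first exact: (fB nl').
    exact: (Top_bnd cI (adm nl') B_ge0 (iQ nl') (mf nl') (fB nl')).
  have b2 := bnd_scale ((l0 + a%:C - l0)^-1) (bnd_sub (gE _ nl) (gE _ n0)).
  exists (normc (l0 + a%:C - l0)^-1 * (B + mass (Q (l0 + a%:C)) * B + (B + mass (Q l0) * B)) + 1).
  move=> x x0 j; have := bnd_sub b2 b1 x0 j.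
  by rewrite /subV; set u := (X in X - (X - _)); rewrite (_ : u - (u - g' x j) = g' x j)//; ring.
have mr0 : mV (addV g' (T' (f l0))) by exact: mV_add.
have br0 := bnd_add mg'b bT'.
have [w [mw wsol bw]] := (Tsol n0).1 _ _ mr0 br0.
set b0 := bg' + _ in br0 bw.
pose bW := `|K * b0|.
have bW0 : 0 <= bW by exact: normr_ge0.
have {}bw : bnd bW w by apply: bnd_weaken bw; exact: ler_norm.
have bT'w := T'_bnd mw bw bW0; set cw := (_ * bW) in bT'w.
have cw0 : 0 <= cw.
  by rewrite /cw mulr_ge0// addr_ge0 ?mass_ge0// mulr_ge0 ?mass_ge0// divr_ge0// ltW.
exists w => x j eps x0 eps0.
(* The second factor collects the terms of the residual in [br], the first majorizes the stability
   constant. *)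
pose Z := (K + 1) * (1 + B + bW + cw).
have S1 : 0 < 1 + B + bW + cw.
  by rewrite -!addrA ltr_pwDl// addr_ge0// addr_ge0.
have K1 : 0 < K + 1 by rewrite ltr_wpDl.
have Z0 : 0 < Z by exact: mulr_gt0.
have eta0 : 0 < eps / Z by rewrite divr_gt0.
have [d1 d10 H1] := omega_small eta0; have [d2 d20 H2] := Hg eta0.
exists (Num.min (Num.min d1 d2) (Num.min (Num.min 1 (eps / Z)) (del / 2 / (C + 1)))).
  by rewrite !lt_min d10 d20 ltr01 eta0 !divr_gt0// ltr_wpDl.
move=> l ll0; rewrite !lt_min => /andP[/andP[ld1 ld2] /andP[/andP[l1 le] lC]].
have [nl om] := H1 l ll0 ld1; have bgl := H2 l ll0 ld2.
have lC' : normc (l - l0) * C <= del / 2.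
  move: lC; rewrite ltr_pdivlMr ?ltr_wpDl// => /ltW; apply: le_trans.
  by rewrite ler_wpM2l ?normc_ge0// lerDl.
have h0 : l - l0 != 0 by rewrite subr_eq0.
pose q : V := fun x j => (l - l0)^-1 * (f l x j - f l0 x j).
have mq : mV q by apply: mV_scale; apply: mV_sub => //; exact: mf.
have bq := bnd_scale (l - l0)^-1 (bnd_sub (fB nl) bf0).
pose d := subV q w.
have md : mV d by exact: mV_sub.
have bd := bnd_sub bq bw.
pose r := subV d (T l d).
have mTd : mV (T l d) by exact: (Top_mV cI (adm nl) (iQ nl) md bd).
have mr : mV r by exact: mV_sub.
have dr : solves_eq (T l) d r by move=> y y0 i; rewrite /r /subV subrK.
have gkl := good_expker cI (adm nl).
have iQl := iQ nl; have iQ0 := iQ n0.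
have q1 := quotient_bound nl ll0 lC' mf0 bf0 B_ge0.
have q2 := quotient_bound nl ll0 lC' mw bw bW0.
have om0 : 0 <= omega l.
  have Cd : 0 <= C / del by rewrite divr_ge0// ltW.
  have a1 : 0 <= normc (l - l0) * C2 * mass (Q l).
    by rewrite mulr_ge0 ?mass_ge0// mulr_ge0 ?normc_ge0.
  have a2 : 0 <= C / del * mass (fun t => Q l t - Q l0 t) by rewrite mulr_ge0 ?mass_ge0.
  by rewrite /omega addr_ge0 ?mass_ge0// addr_ge0.
have br : bnd (eps / Z * (1 + B + bW + cw)) r.
  move=> y y0 i; rewrite mulr1 /r /subV.
  have bs := bnd_sub (fB nl) bf0.
  have ms : mV (subV (f l) (f l0)) by apply: mV_sub => //; exact: mf.
  have Tq : T l q y i = (l - l0)^-1 * (T l (f l) y i - T l (f l0) y i).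
    rewrite -[in RHS](Kop_sub i gkl iQl (mf nl) mf0 (fB nl) bf0 y0).
    rewrite /T /Top /Kop mulrCA -[(l - l0)^-1 * cint _ _]cintZ; last 2 first.
    - exact: measurable_Jset.
    - exact: (Kop_integrable i gkl iQl ms bs y0).
    congr (_ * _); apply: eq_cint => t _; rewrite mulrCA; congr (_ * _).
    by rewrite /row_mul mulr_sumr; apply: eq_bigr => m _; rewrite /q /subV; ring.
  have Td : T l d y i = T l q y i - T l w y i by exact: (Kop_sub i gkl iQl mq mw bq bw y0).
  rewrite Td Tq.
  (* The error of the right-hand side, the error of the operator on f(l0), and T(l) w - T(l0) w
     written through a difference quotient, so that it carries the factor l - l0. *)
  have -> : d y i - ((l - l0)^-1 * (T l (f l) y i - T l (f l0) y i) - T l w y i) =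
     ((l - l0)^-1 * (g l y i - g l0 y i) - g' y i) +
     ((l - l0)^-1 * (T l (f l0) y i - T l0 (f l0) y i) - T' (f l0) y i) +
     (l - l0) * (((l - l0)^-1 * (T l w y i - T l0 w y i) - T' w y i) + T' w y i).
    rewrite subrK mulVKf// /d /q /subV (wsol y y0 i) (fsol nl y0 i) {1}(fsol n0 y0 i) /addV.
    by do !move: (T _ _ _ _) => ?; do !move: (T' _ _ _) => ?; ring.
  apply: le_trans (le_normcD _ _) _.
  apply: (@le_trans _ _ ((eps / Z + omega l * B) + normc (l - l0) * (omega l * bW + cw))).
    apply: lerD.
      apply: le_trans (le_normcD _ _) _; apply: lerD.
        by have := bgl y y0 i; rewrite mulr1.
      by have := q1 y y0 i; rewrite mulr1.
    rewrite normcM ler_wpM2l ?normc_ge0// (le_trans (le_normcD _ _))//; apply: lerD.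
      by have := q2 y y0 i; rewrite mulr1.
    by have := bT'w y y0 i; rewrite mulr1.
  have N0 := normc_ge0 (l - l0).
  have a1 : omega l * B <= eps / Z * B by rewrite ler_wpM2r.
  have a2 : normc (l - l0) * (omega l * bW) <= eps / Z * bW.
    apply: (@le_trans _ _ (1 * (omega l * bW))); first by rewrite ler_wpM2r ?mulr_ge0// ltW.
    by rewrite mul1r ler_wpM2r.
  have a3 : normc (l - l0) * cw <= eps / Z * cw by rewrite ler_wpM2r// ltW.
  rewrite [normc (l - l0) * (_ + _)]mulrDr !mulrDr mulr1.
  by rewrite -!addrA; do !apply: lerD => //.
have := (Tsol nl).2 d r _ _ md mr bd br dr x x0 j; rewrite mulr1 => /le_trans; apply.
rewrite [leLHS](_ : _ = K * (eps * ((1 + B + bW + cw) / Z))); last by rewrite !mulrA; ring.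
rewrite /Z invfM mulrCA.
have S0 : 1 + B + bW + cw != 0 by rewrite gt_eqF.
rewrite (_ : (1 + B + bW + cw) * ((K + 1)^-1 * (1 + B + bW + cw)^-1) = (K + 1)^-1); last first.
  by rewrite mulrCA divff// mulr1.
rewrite -[leRHS]mulr1 ler_pM2l// ler_pdivrMr ?ltr_wpDl// mul1r lerDl//.
Qed.

End Differentiability.

(** * Oscillation and Volterra operators *)

Section OscillatingOperator.
Variables (R : realType) (n : nat) (rho : R -> R).
Let mu : {measure set (measurableTypeR R) -> \bar R} := lebesgue_measure.
Let D0 : set (measurableTypeR R) := `[0%R, +oo[%classic.
Let mD0 : measurable D0 := @measurable_0y R.
Let V := R -> 'I_n -> R[i].
Let Mx := R -> 'M[R[i]]_n.
Let p := primitive rho.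
Let rhoC t : R[i] := (rho t)%:C.
Hypothesis cI : cond_I rho.
Variables (s : 'I_n -> bool) (c : 'I_n -> R[i]).
Implicit Types (f g w : V) (Q : Mx).
Let T l Q : V -> V := Top rho s (fun j => l * c j) Q.

(** The phase c m of component m is recorded because it has to be compared with the phase c j of the
    kernel. The function [wm] needs to agree with [w] only on [0, +oo[. *)
Definition solves_scalar l w (F : 'I_n -> R -> R[i]) : Prop :=
  forall m, exists wm : R -> R[i], (forall x, 0 <= x -> w x m = wm x) /\
    ACder wm (fun x => l * c m * rhoC x * wm x + F m x).

Definition osc_small l Q (eps : R) : Prop := forall w F (W : R),
  mV w -> solves_scalar l w F -> (forall m, cintegrable D0 (F m)) ->
  (forall m, (\int[mu]_(t in D0) normc (F m t) <= W)%R) -> bnd W w ->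
  bnd (eps * W) (T l Q w).

(** Entry by entry: where c j = c m the coefficient vanishes, elsewhere the gap |c m - c j| is a
    fixed positive number. A row has n entries, whence [eps] / (n + 1). *)
Lemma osc_Top Q : L1mx Q -> (forall j m, c j = c m -> forall t, Q t j m = 0) ->
  forall eps, 0 < eps -> exists r, forall l, r < normc l ->
    admissible s (fun j => l * c j) -> osc_small l Q eps.
Proof.
move=> iQ Q0 eps eps0; have en0 : 0 < eps / n.+1%:R by rewrite divr_gt0.
have ex (jm : 'I_n * 'I_n) : exists r, forall (l k : R[i]) (w f : R -> R[i]) (W u : R) J,
    r < normc l ->
    ACder w (fun t => l * c jm.2 * rhoC t * w t + f t) ->
    cintegrable D0 f -> (forall x, 0 <= x -> normc (w x) <= W) ->
    (\int[mu]_(t in D0) normc (f t) <= W)%R ->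
    0 <= u -> interval_from u J -> (forall x, J x -> Re (k - l * c jm.1 * (p x)%:C) <= 0) ->
    normc (cint J (fun t => cexp (k - l * c jm.1 * (p t)%:C) * (Q t jm.1 jm.2 * w t))) <= eps / n.+1%:R * W.
  case: jm => j m /=; have [cjm|cjm] := eqVneq (c j) (c m).
    exists 0 => l k w f W u J _ _ _ wW _ _ _ _.
    rewrite (@eq_cint _ _ _ (fun=> 0)); last by move=> x _; rewrite (Q0 _ _ cjm) mul0r mulr0.
    rewrite /cint /Rintegral integral0/= [normc _](_ : _ = 0); last exact: normc0.
    by rewrite mulr_ge0 ?(ltW en0)// (le_trans (normc_ge0 _) (wW 0 (lexx _))).
  have eta0 : 0 < normc (c m - c j) by rewrite normc_gt0 subr_eq0 eq_sym.
  have [r Hr] := oscillation cI (iQ j m) eta0 en0.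
  by exists r => l k w f W u J rl dw fi wW fW u0 uJ kJ; exact: (Hr l (c m) (c j) k w f W u J).
pose r jm := projT1 (cid (ex jm)).
have rP jm := projT2 (cid (ex jm)); rewrite -/(r _) in rP.
exists (\sum_jm `|r jm|) => l rl ad w F W mw wF iF FW bw x x0 j; rewrite mulr1.
have W0 : 0 <= W by apply: le_trans (FW j); apply: Rintegral_ge0 => t _; exact: normc_ge0.
have [u u0 uJ] := interval_from_Jset (s j) x0.
have mJ := measurable_Jset (s j) x.
have gk := good_expker cI ad.
have [mk kk] := gk j x x0.
have iqw m : cintegrable (Jset (s j) x) (fun t => expker rho (fun j => l * c j) j x t * (Q t j m * w t m)).
  apply: (cintegrableM mJ mk kk).
  apply: (@eq_cintegrable _ _ (fun t => w t m * Q t j m)) => //; first by move=> t _; rewrite mulrC.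
  apply: (@cintegrableM _ _ _ _ W) => //.
  - by apply: (cmeasS mD0 _ (mw m)); exact: Jset_sub.
  - by move=> t Jt; have [t0 _] := JsetP x0 Jt; have := bw t t0 m; rewrite mulr1.
  - by apply: (cintegrableS mD0 mJ _ (iQ j m)); exact: Jset_sub.
rewrite /T /Top /Kop normcM.
have -> : normc (if s j then 1 else -1) = 1 :> R.
  by case: (s j); rewrite ?normcN normc1.
rewrite mul1r.
rewrite (@eq_cint _ _ _ (fun t => \sum_m expker rho (fun j => l * c j) j x t * (Q t j m * w t m))); last first.
  by move=> t _; rewrite /row_mul mulr_sumr.
rewrite cint_sum//; apply: le_trans (normc_sum _ _ _) _.
apply: (@le_trans _ _ (\sum_(m < n) (eps / n.+1%:R * W))).
  apply: ler_sum => m _; have [wm [wE dw]] := wF m.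
  rewrite (@eq_cint _ _ _ (fun t => cexp (l * c j * (p x)%:C - l * c j * (p t)%:C) * (Q t j m * wm t))); last first.
    by move=> t Jt; have [t0 _] := JsetP x0 Jt; rewrite expkerE wE.
  apply: (rP (j, m) l (l * c j * (p x)%:C) wm (F m) W u _) => //=.
  - apply: le_lt_trans rl; rewrite (bigD1 (j, m))//= (le_trans (ler_norm _))// lerDl sumr_ge0//.
  - by move=> y y0; rewrite -wE//; have := bw y y0 m; rewrite mulr1.
  - move=> y Jy; rewrite -mulrBr -rmorphB; exact: (Re_expker cI ad x0 Jy).
rewrite sumr_const card_ord -mulrnAl ler_wpM2r//.
by rewrite -mulr_natr -mulrA ler_piMr ?(ltW eps0)// mulrC ler_pdivrMr// mul1r ler_nat.
Qed.

Lemma Top_Qadd l Q1 Q2 f b x j : admissible s (fun j => l * c j) -> L1mx Q1 -> L1mx Q2 ->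
  mV f -> bnd b f -> 0 <= x ->
  T l (fun t => Q1 t + Q2 t) f x j = T l Q1 f x j + T l Q2 f x j.
Proof.
move=> ad i1 i2 mf bf x0; have gk := good_expker cI ad.
have := Kop_Qsub j gk (L1mxD i1 i2) i1 mf bf x0.
have -> : (fun t => Q1 t + Q2 t - Q1 t) = Q2 by apply/funext => t; rewrite addrAC subrr add0r.
by rewrite /T /Top => ->; rewrite subrKC.
Qed.

Lemma Top_solves_scalar l Q f b : admissible s (fun j => l * c j) -> L1mx Q -> mV f -> bnd b f ->
  solves_scalar l (T l Q f) (fun m t => row_mul Q f t m).
Proof.
move=> ad iQ mf bf m; have [g [Tg dg]] := Top_ACder cI m ad iQ mf bf.
by exists g.
Qed.

Lemma integral_row_mul Q f b m : L1mx Q -> mV f -> bnd b f ->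
  (\int[mu]_(t in D0) normc (row_mul Q f t m) <= mass Q * b)%R.
Proof.
move=> iQ mf bf; rewrite mulrC -RintegralZl//; last exact: integrable_sumnorm.
apply: le_Rintegral => //.
- by apply: integrable_normc => //; exact: cintegrable_row_mul bf.
- by apply: integrable_fctZ => //; exact: integrable_sumnorm.
- move=> t; rewrite /D0 /= in_itv/= andbT => t0; apply: normc_row_mul => i.
  by have := bf t t0 i; rewrite mulr1.
Qed.

(** Values of the operator solve scalar equations with source [row_mul], so the part [Q1] oscillates
    against them; the part [Q2] enters through its mass. *)
Lemma Top_square l Q1 Q2 eps f b : admissible s (fun j => l * c j) -> L1mx Q1 -> L1mx Q2 ->
  osc_small l Q1 eps -> mV f -> bnd b f -> 0 <= b ->
  let Q := fun t => Q1 t + Q2 t in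
  bnd ((eps + mass Q2) * (mass Q * b)) (T l Q (T l Q f)).
Proof.
move=> ad i1 i2 os mf bf b0 Q x x0 j; rewrite mulr1.
have iQ : L1mx Q by exact: L1mxD.
have mT : mV (T l Q f) by exact: (Top_mV cI ad iQ mf bf).
have bT : bnd (mass Q * b) (T l Q f) by exact: Top_bnd.
have mb0 : 0 <= mass Q * b by rewrite mulr_ge0// mass_ge0.
rewrite (Top_Qadd j ad i1 i2 mT bT x0) mulrDl.
apply: le_trans (le_normcD _ _) _; apply: lerD.
  have := os (T l Q f) _ (mass Q * b) mT (Top_solves_scalar ad iQ mf bf) _ _ bT x x0 j.
  rewrite mulr1; apply => m.
    exact: cintegrable_row_mul bf.
  exact: integral_row_mul.
by have := Top_bnd cI ad mb0 i2 mT bT x0 j; rewrite mulr1.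
Qed.

Lemma Top_solvable l Q : admissible s (fun j => l * c j) -> L1mx Q ->
  (forall f b, mV f -> bnd b f -> 0 <= b -> bnd (b / 2) (T l Q (T l Q f))) ->
  solvable (T l Q) ((1 + mass Q) * 2).
Proof.
move=> ad iQ half; rewrite -[X in solvable _ X]mulr1.
have nb (f : V) b : bnd b f -> 0 <= b \/ (forall (j : 'I_n), False).
  move=> bf; have [|b0] := leP 0 b; first by left.
  right => j; have := bf 0 (lexx _) j; rewrite mulr1 => h.
  by have := le_trans (normc_ge0 _) h; rewrite leNgt b0.
apply: (@contraction_solvable _ _ _ (fun=> 1) 1 (mass Q)) => //.
- exact: mass_ge0.
- by move=> f b mf bf; exact: (Top_mV cI ad iQ mf bf).
- move=> f g b mf mg bf bg x x0 j.
  exact: (Kop_sub j (good_expker cI ad) iQ mf mg bf bg x0).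
- move=> f b mf bf x x0 j; case: (nb _ _ bf) => [b0|/(_ j)//].
  exact: (Top_bnd cI ad b0 iQ mf bf x0).
- move=> f b mf bf x x0 j; case: (nb _ _ bf) => [b0|/(_ j)//].
  exact: (half f b mf bf b0 x x0).
Qed.

End OscillatingOperator.

(** * Volterra equations in exponentially weighted norms *)

Section Volterra.
Variables (R : realType) (n : nat) (rho : R -> R).
Let mu : {measure set (measurableTypeR R) -> \bar R} := lebesgue_measure.
Let D0 : set (measurableTypeR R) := `[0%R, +oo[%classic.
Let mD0 : measurable D0 := @measurable_0y R.
Let V := R -> 'I_n -> R[i].
Let Mx := R -> 'M[R[i]]_n.
Hypothesis cI : cond_I rho.

(** The weight is the exponential of twice the integral of k over [x, +oo[. From w' = - 2 k w, the
    integral of k w over [x, +oo[ is (w(x) - 1) / 2; the 2 in the exponent becomes the contraction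
    constant 1/2. *)
Lemma integral_exp_tail (k : R -> R) : mu.-integrable D0 (EFin \o k) -> (forall t, 0 <= k t) ->
  let m := (\int[mu]_(t in D0) k t)%R in
  exists w : R -> R, [/\ measurable_fun D0 w,
    forall x, 0 <= x -> 1 <= w x,
    forall x, 0 <= x -> w x <= expR (2 * m),
    mu.-integrable D0 (EFin \o (fun t => k t * w t)) &
    forall x, 0 <= x -> (\int[mu]_(t in `[x, +oo[) (k t * w t) <= w x / 2)%R].
Proof.
move=> ik k0 m; pose kC t : R[i] := (k t)%:C.
have ikC : cintegrable D0 kC by exact: cintegrable_real.
have lkC := cintegrable_cloc ikC.
pose S x := (\int[mu]_(t in `[0%R, x]) k t)%R.
have SE x : cint `[0, x] kC = (S x)%:C by rewrite cint_real.
have sub x : `[0%R, x]%classic `<=` D0 by exact: sub_itv0y.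
have S0 x : 0 <= S x by apply: Rintegral_ge0.
have Sm x : S x <= m.
  rewrite /S /m /Rintegral fine_le//; [|exact: integrable_fin_num|].
    by apply: integrable_fin_num => //; apply: integrableS ik.
  apply: ge0_subset_integral => //; first exact: (measurable_int mu ik).
  by move=> t _; rewrite lee_fin.
pose w x := expR (2 * (m - S x)).
pose G x := cexp (2 * (m%:C - cint `[0, x] kC)).
have GE x : G x = (w x)%:C.
  rewrite /G SE -rmorphB; apply: complexP.
    by rewrite Re_cexp ReM ImM /= !(mulr0, mul0r, subr0, addr0) cos0 mulr1.
  by rewrite Im_cexp ReM ImM /= !(mulr0, mul0r, subr0, addr0) sin0 mulr0.
have dG : ACder G (fun x => -2 * (G x * kC x)).
  have H := ACder_cexp (ACderZ 2 (ACderB (ACder_cst m%:C) (ACder_cint lkC))).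
  by apply: ACder_eq H _ => x _; rewrite /G; ring.
have mG := ACder_cmeas dG.
have mw : measurable_fun D0 w.
  have [h _] := mG; apply: eq_measurable_fun h => x _.
  by rewrite /comp GE.
have w1 x : 1 <= w x by rewrite -expR0 ler_expR mulr_ge0// subr_ge0.
have wm x : w x <= expR (2 * m) by rewrite ler_expR ler_wpM2l// gerBl.
have w0 y : 0 <= w y by exact: expR_ge0.
have mk : measurable_fun D0 k by have /measurable_int/measurable_EFinP := ik.
have ikw : mu.-integrable D0 (EFin \o (fun t => k t * w t)).
  apply: (@le_integrable _ _ _ mu _ mD0 _ (EFin \o (fun t => expR (2 * m) * k t))).
  - by apply/measurable_EFinP; exact: measurable_funM.
  - move=> t _ /=; rewrite lee_fin !ger0_norm ?mulr_ge0 ?expR_ge0//.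
    by rewrite mulrC ler_wpM2r.
  - exact: integrable_fctZ.
have ikwC := cintegrable_real ikw.
exists w; split => // x x0.
apply/ler_addgt0Pr => e e0.
have [X X0 HX] := tail_small ikw (fun t => mulr_ge0 (k0 t) (w0 t)) e0.
pose v := Num.max x X.
have xv : x <= v by rewrite le_max lexx.
have v0 : 0 <= v by exact: le_trans xv.
have lGk : cloc (fun t => G t * kC t) by exact: (ACder_cloc_mul dG).
have := ACder_FTC dG (clocZ (-2) lGk) x0 xv.
rewrite cintZ//; last exact: clocP.
rewrite (@eq_cint _ _ (fun t => G t * kC t) (fun t => (k t * w t)%:C)); last first.
  by move=> t _; rewrite GE rmorphM /= mulrC.
rewrite cint_real !GE -rmorphB.
rewrite (_ : (-2 : R[i]) = (-2)%:C); last by rewrite rmorphN rmorph_nat.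
rewrite -rmorphM => /complexI FTC.
have split : (\int[mu]_(t in `[x, +oo[) (k t * w t))%R =
   (\int[mu]_(t in `[x, v]) (k t * w t) + \int[mu]_(t in `[v, +oo[) (k t * w t))%R.
  have A := cint_itvy x0 ikwC; have A2 := cint_itvy v0 ikwC.
  have A3 := cint_itvB x0 xv (cintegrable_cloc ikwC).
  have E : cint `[x, +oo[ (fun t => (k t * w t)%:C) =
      cint `[x, v] (fun t => (k t * w t)%:C) + cint `[v, +oo[ (fun t => (k t * w t)%:C).
    by rewrite A A2 -A3; ring.
  by move: E; rewrite !cint_real -rmorphD => /complexI.
have h := HX v; rewrite le_max lexx orbT in h; have {}h := h isT.
rewrite split; have := w0 v; move: FTC h.
move: (Rintegral _ _ _) (Rintegral _ _ _) => I1 I2 FTC h wv.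
move: (w v) (w x) FTC h wv => p q FTC h wv.
by lra.
Qed.

(** The mirror image: the exponential of twice the integral of k over [0, x], with w' = 2 k w. *)
Lemma integral_exp_head (k : R -> R) : mu.-integrable D0 (EFin \o k) -> (forall t, 0 <= k t) ->
  let m := (\int[mu]_(t in D0) k t)%R in
  exists w : R -> R, [/\ measurable_fun D0 w,
    forall x, 0 <= x -> 1 <= w x,
    forall x, 0 <= x -> w x <= expR (2 * m),
    mu.-integrable D0 (EFin \o (fun t => k t * w t)) &
    forall x, 0 <= x -> (\int[mu]_(t in `[0%R, x]) (k t * w t) <= w x / 2)%R].
Proof.
move=> ik k0 m; pose kC t : R[i] := (k t)%:C.
have ikC : cintegrable D0 kC by exact: cintegrable_real.
have lkC := cintegrable_cloc ikC.
pose S x := (\int[mu]_(t in `[0%R, x]) k t)%R.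
have SE x : cint `[0, x] kC = (S x)%:C by rewrite cint_real.
have sub x : `[0%R, x]%classic `<=` D0 by exact: sub_itv0y.
have S0 x : 0 <= S x by apply: Rintegral_ge0.
have Sm x : S x <= m.
  rewrite /S /m /Rintegral fine_le//; [|exact: integrable_fin_num|].
    by apply: integrable_fin_num => //; apply: integrableS ik.
  apply: ge0_subset_integral => //; first exact: (measurable_int mu ik).
  by move=> t _; rewrite lee_fin.
pose w x := expR (2 * S x).
pose G x := cexp (2 * cint `[0, x] kC).
have GE x : G x = (w x)%:C.
  rewrite /G SE; apply: complexP.
    by rewrite Re_cexp ReM ImM /= !(mulr0, mul0r, subr0, addr0) cos0 mulr1.
  by rewrite Im_cexp ReM ImM /= !(mulr0, mul0r, subr0, addr0) sin0 mulr0.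
have dG : ACder G (fun x => 2 * (G x * kC x)).
  have H := ACder_cexp (ACderZ 2 (ACder_cint lkC)).
  by apply: ACder_eq H _ => x _; rewrite /G; ring.
have mw : measurable_fun D0 w.
  have [h _] := ACder_cmeas dG; apply: eq_measurable_fun h => x _.
  by rewrite /comp GE.
have w1 x : 1 <= w x by rewrite -expR0 ler_expR mulr_ge0.
have wm x : w x <= expR (2 * m) by rewrite ler_expR ler_wpM2l.
have w0 y : 0 <= w y by exact: expR_ge0.
have mk : measurable_fun D0 k by have /measurable_int/measurable_EFinP := ik.
have ikw : mu.-integrable D0 (EFin \o (fun t => k t * w t)).
  apply: (@le_integrable _ _ _ mu _ mD0 _ (EFin \o (fun t => expR (2 * m) * k t))).
  - by apply/measurable_EFinP; exact: measurable_funM.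
  - move=> t _ /=; rewrite lee_fin !ger0_norm ?mulr_ge0 ?expR_ge0//.
    by rewrite mulrC ler_wpM2r.
  - exact: integrable_fctZ.
exists w; split => // x x0.
have lGk : cloc (fun t => G t * kC t) by exact: (ACder_cloc_mul dG).
have := ACder_FTC dG (clocZ 2 lGk) (lexx 0) x0.
rewrite cintZ//; last exact: clocP.
rewrite (@eq_cint _ _ (fun t => G t * kC t) (fun t => (k t * w t)%:C)); last first.
  by move=> t _; rewrite GE rmorphM /= mulrC.
rewrite cint_real !GE -rmorphB.
rewrite (_ : (2 : R[i]) = (2 : R)%:C); last by rewrite rmorph_nat.
rewrite -rmorphM => /complexI FTC.
move: FTC (w0 0); move: (Rintegral _ _ _) => I1 FTC wv.
move: (w 0) (w x) FTC wv => p q FTC wv.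
by lra.
Qed.

(* In the supremum norm weighted by [w], which grows along the direction of
   integration, the operator is a contraction. *)
Lemma volterra_solvable (dir : bool) (Q : Mx) : L1mx Q ->
  solvable (Top rho (fun=> dir) (fun=> 0) Q) ((1 + 2^-1) * 2 * expR (2 * mass Q)).
Proof.
move=> iQ; pose e0 : 'I_n -> R[i] := fun=> 0; pose s0 : 'I_n -> bool := fun=> dir.
have ad : admissible s0 e0 by move=> j; rewrite /s0 /e0 /=; case: ifP.
have gk := good_expker cI ad.
have isn := integrable_sumnorm iQ.
have [w [mw w1 wm isw wI]] : exists w : R -> R, [/\ measurable_fun D0 w,
    forall x, 0 <= x -> 1 <= w x,
    forall x, 0 <= x -> w x <= expR (2 * mass Q),
    mu.-integrable D0 (EFin \o (fun t => sumnorm Q t * w t)) &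
    forall x, 0 <= x -> (\int[mu]_(t in Jset dir x) (sumnorm Q t * w t) <= w x / 2)%R].
  by clear ad gk s0; case: dir; [exact: integral_exp_head isn (sumnorm_ge0 Q)|exact: integral_exp_tail isn (sumnorm_ge0 Q)].
have w0 x : 0 <= x -> 0 <= w x by move=> /w1; apply: le_trans.
have b2 (f : V) b : bndw w b f -> bnd (`|b| * expR (2 * mass Q)) f.
  move=> bf x x0 j; rewrite mulr1 (le_trans (bf x x0 j))//.
  apply: (@le_trans _ _ (`|b| * w x)); first by rewrite ler_wpM2r ?ler_norm ?w0.
  by rewrite ler_wpM2l// wm.
have nb (f : V) b : bndw w b f -> 0 <= b \/ (forall (j : 'I_n), False).
  move=> bf; have [|b0] := leP 0 b; first by left.
  right => j; have := bf 0 (lexx _) j => h.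
  have := le_trans (normc_ge0 _) h; rewrite leNgt nmulr_rlt0//.
  by rewrite (lt_le_trans ltr01)// w1.
have Tb f b : mV f -> bndw w b f -> bndw w (2^-1 * b) (Top rho s0 e0 Q f).
  move=> mf bf x x0 j; case: (nb _ _ bf) => [b0|/(_ j)//].
  rewrite /Top /Kop normcM.
  have -> : normc (if s0 j then 1 else -1) = 1 :> R.
    by case: (s0 j); rewrite ?normcN normc1.
  rewrite mul1r; have [mk kk] := gk j x x0.
  have mJ := measurable_Jset (s0 j) x.
  have sub := @Jset_sub _ (s0 j) x x0.
  apply: (@le_trans _ _ (\int[mu]_(t in Jset (s0 j) x) (b * (sumnorm Q t * w t)))%R).
    apply: (cint_le mJ mJ) => //.
    - apply: cmeasM => //; apply: (cmeasS mD0 sub); exact: cmeas_row_mul.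
    - by apply: (integrableS mD0 mJ sub); exact: integrable_fctZ.
    - move=> t /(JsetP x0)[t0 _].
      by rewrite mulr_ge0// mulr_ge0 ?sumnorm_ge0// w0.
    - move=> t Jt; have [t0 _] := JsetP x0 Jt; rewrite normcM.
      apply: (@le_trans _ _ (normc (row_mul Q f t j))).
        by rewrite ler_piMl ?normc_ge0// kk.
      rewrite (mulrC (sumnorm _ _)) mulrA; apply: normc_row_mul => m; exact: bf.
  rewrite RintegralZl//; last by apply: (integrableS mD0 mJ sub).
  rewrite -mulrA mulrCA ler_wpM2l// mulrC; exact: wI.
apply: (@contraction_solvable R n (Top rho s0 e0 Q) w (expR (2 * mass Q)) 2^-1) => //.
- by move=> f b mf bf; exact: (Top_mV cI ad iQ mf (b2 _ _ bf)).
- move=> f g b mf mg bf bg x x0 j.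
  exact: (Kop_sub j gk iQ mf mg (b2 _ _ bf) (b2 _ _ bg) x0).
(* Two applications contract by 1/4, within the required 1/2. *)
- move=> f b mf bf x x0 j; case: (nb _ _ bf) => [b0|/(_ j)//].
  have mT : mV (Top rho s0 e0 Q f) by exact: (Top_mV cI ad iQ mf (b2 _ _ bf)).
  have := Tb _ _ mT (Tb _ _ mf bf) x x0 j => /le_trans; apply.
  by rewrite ler_wpM2r ?w0//; lra.
Qed.

End Volterra.

(** * The block-diagonal frame *)

Section CutOff.
Variables (R : realType) (n : nat).
Let mu : {measure set (measurableTypeR R) -> \bar R} := lebesgue_measure.
Let D0 : set (measurableTypeR R) := `[0%R, +oo[%classic.
Let mD0 : measurable D0 := @measurable_0y R.
Let Mx := R -> 'M[R[i]]_n.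
Implicit Types (X Y : Mx) (I : set (measurableTypeR R)).

Definition cut I X : Mx := fun t => (\1_I t)%:C *: X t.

Lemma le_mass X Y (c : R) : L1mx X -> L1mx Y ->
  (forall t, 0 <= t -> sumnorm X t <= c * sumnorm Y t) -> mass X <= c * mass Y.
Proof.
move=> iX iY XY; rewrite /mass -RintegralZl//; last exact: integrable_sumnorm.
apply: le_Rintegral => //; first exact: integrable_sumnorm.
  by apply: integrable_fctZ => //; exact: integrable_sumnorm.
by move=> t; rewrite /D0 /= in_itv/= andbT; exact: XY.
Qed.

Lemma massD X Y : L1mx X -> L1mx Y -> mass (fun t => X t + Y t) <= mass X + mass Y.
Proof.
move=> iX iY; have iXY := L1mxD iX iY; apply: le_trans (mass_triangle iXY iX) _.
rewrite lerD2l; have -> // : (fun t => X t + Y t - X t) = Y.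
by apply/funext => t; rewrite addrAC subrr add0r.
Qed.

Lemma sumnormZ (c : R[i]) X t : sumnorm (fun t => c *: X t) t = normc c * sumnorm X t.
Proof.
rewrite /sumnorm mulr_sumr; apply: eq_bigr => j _; rewrite mulr_sumr.
by apply: eq_bigr => m _; rewrite mxE normcM.
Qed.

Lemma massZ (c : R[i]) X : L1mx X -> mass (fun t => c *: X t) <= normc c * mass X.
Proof.
by move=> iX; apply: le_mass => //; [exact: L1mxZ|move=> t _; rewrite sumnormZ].
Qed.

Lemma normc_indic I (t : R) : normc ((\1_I t)%:C : R[i]) <= 1.
Proof. by rewrite normc_real indicE; case: (t \in I); rewrite ?normr0 ?normr1. Qed.

Lemma L1mx_cut I X : measurable I -> L1mx X -> L1mx (cut I X).
Proof.
move=> mI iX j m; have -> : (fun t => cut I X t j m) = (fun t => (\1_I t)%:C * X t j m).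
  by apply/funext => t; rewrite mxE.
apply: (@cintegrableM _ _ _ _ 1) => //; last by move=> x _; exact: normc_indic.
by apply: cmeas_real; exact: measurable_indic.
Qed.

Lemma mass_cut I X : measurable I -> L1mx X -> mass (cut I X) <= mass X.
Proof.
move=> mI iX; rewrite -[leRHS]mul1r; apply: le_mass => //; first exact: L1mx_cut.
move=> t _; rewrite mul1r; apply: ler_sum => j _; apply: ler_sum => m _.
by rewrite mxE normcM ler_piMl ?normc_ge0 ?normc_indic.
Qed.

End CutOff.

(** * Gronwall's estimate, forwards and backwards *)

Section Gronwall.
Variables (R : realType) (n : nat) (rho : R -> R).
Let mu : {measure set (measurableTypeR R) -> \bar R} := lebesgue_measure.
Let D0 : set (measurableTypeR R) := `[0%R, +oo[%classic.
Let mD0 : measurable D0 := @measurable_0y R.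
Let V := R -> 'I_n -> R[i].
Let Mx := R -> 'M[R[i]]_n.
Hypothesis cI : cond_I rho.

(** On [a, X] the differential equation is a Volterra equation anchored at [a] or at [X], and its
    stability constant is the bound. The 3 is (1 + 1/2) * 2; the constant involves neither [a] nor
    [X]. *)
Lemma gronwall (dir : bool) (Q : Mx) (u : V) (a X eps : R) : L1mx Q -> 0 <= a -> a <= X ->
  (forall j, ACder (fun x => u x j) (fun x => row_mul Q u x j)) ->
  0 <= eps -> (forall j, normc (u (if dir then a else X) j) <= eps) ->
  forall x, a <= x <= X -> forall j, normc (u x j) <= 3 * expR (2 * mass Q) * eps.
Proof.
move=> iQ a0 aX du eps0 ueps.
have X0 : 0 <= X by exact: le_trans aX.
pose A : set (measurableTypeR R) := `[a, X]%classic.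
have mA : measurable A by exact: measurable_itv.
pose u1 : V := restr A u.
have mu_ : mV u by move=> j; exact: ACder_cmeas (du j).
have mu1 : mV u1 by exact: mV_restr.
have [B B0 uB] : exists2 B, 0 <= B & forall x j, 0 <= x <= X -> normc (u x j) <= B.
  pose Bj j := projT1 (cid2 (ACder_bounded X0 (du j))).
  have BjP j : 0 < Bj j /\ forall x, 0 <= x <= X -> normc (u x j) <= Bj j.
    by rewrite /Bj; case: (cid2 _).
  exists (\sum_j Bj j); first by apply: sumr_ge0 => j _; have [/ltW] := BjP j.
  move=> x j xX; apply: le_trans ((BjP j).2 x xX) _.
  by rewrite (bigD1 j)//= lerDl sumr_ge0// => i _; have [/ltW] := BjP i.
have bu1 : bnd B u1.
  move=> x x0 j; rewrite mulr1 /u1 /restr normcM normc_real indicE.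
  have [xA|xA] := boolP (x \in A); last by rewrite normr0 mul0r.
  rewrite normr1 mul1r uB//; move: xA; rewrite inE /A /= in_itv/= => /andP[_ ->].
  by rewrite x0.
pose s0 : 'I_n -> bool := fun=> dir; pose e0 : 'I_n -> R[i] := fun=> 0.
have ad : admissible s0 e0 by move=> j; rewrite /s0 /e0 /=; case: ifP.
pose cst_ : V := fun=> u (if dir then a else X).
have mcst : mV cst_ by move=> j; exact: cmeas_cst.
have bcst : bnd eps cst_ by move=> x _ j; rewrite mulr1 ueps.
(* Equal to [u] on [a, X], but bounded on the whole half-line, as the fixed-point theorem
   demands. *)
pose ut := addV cst_ (Top rho s0 e0 Q u1).
have mut : mV ut by apply: mV_add => //; exact: (Top_mV cI ad iQ mu1 bu1).
have but : bnd (eps + mass Q * B) ut by apply: bnd_add => //; exact: (Top_bnd cI ad B0 iQ mu1 bu1).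
have lrow j : cloc (fun t => row_mul Q u t j).
  apply: cloc_sum => m.
  apply: eq_cloc (ACder_cloc_mul (du m) (cintegrable_cloc (iQ j m))) => x _.
  by rewrite mulrC.
have ker j x t : expker rho e0 j x t = 1 by rewrite /expker /e0 mul0r cexp0.
have rowE j t : row_mul Q u1 t j = (\1_A t)%:C * row_mul Q u t j.
  by rewrite /row_mul mulr_sumr; apply: eq_bigr => m _; rewrite /u1 /restr; ring.
have utE x j : a <= x <= X -> ut x j = u x j.
  move=> /andP[ax xX]; rewrite /ut /addV /cst_ /Top /Kop /s0.
  have x0 : 0 <= x by exact: le_trans ax.
  rewrite (@eq_cint _ _ _ (fun t => (\1_A t)%:C * row_mul Q u t j)); last first.
    by move=> t _; rewrite ker mul1r rowE.
  rewrite cint_indic; last exact: measurable_Jset.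
  case: dir {ueps s0 ad cst_ mcst bcst ut mut but}.
    have -> : Jset true x `&` A = `[a, x]%classic.
      apply/seteqP; split => t; rewrite /A /Jset /= !in_itv/=.
        by move=> [/andP[_ ->] /andP[-> _]].
      by move=> /andP[at_ tx]; rewrite at_ tx (le_trans a0 at_) (le_trans tx).
    by rewrite mul1r -(ACder_FTC (du j) (lrow j) a0 ax) subrKC.
  have -> : Jset false x `&` A = `[x, X]%classic.
    apply/seteqP; split => t; rewrite /A /Jset /= !in_itv/= andbT.
      by move=> [-> /andP[_ ->]].
    by move=> /andP[xt tX]; rewrite xt tX (le_trans ax xt).
  by rewrite mulN1r -(ACder_FTC (du j) (lrow j) x0 xX); ring.
pose Q1 : Mx := cut A Q.
have iQ1 : L1mx Q1 by exact: L1mx_cut.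
have sol : solves_eq (Top rho s0 e0 Q1) ut cst_.
  move=> x x0 j; rewrite /ut /addV; congr (_ + _).
  rewrite /Top /Kop; congr (_ * _); apply: eq_cint => t _; congr (_ * _).
  rewrite rowE /row_mul mulr_sumr; apply: eq_bigr => m _; rewrite /Q1 /cut mxE.
  rewrite -mulrA; have [tA|tA] := boolP (t \in A); last by rewrite indicE (negbTE tA) !mul0r.
  rewrite -[_ + _]/(ut t m) utE//.
  by move: tA; rewrite inE /A /= in_itv.
have massQ1 : mass Q1 <= mass Q by exact: mass_cut.
move=> x xaX j; have x0 : 0 <= x by case/andP: xaX => ax _; exact: le_trans ax.
have := (volterra_solvable cI dir iQ1).2 ut cst_ _ _ mut mcst but bcst sol x x0 j.
rewrite mulr1 (utE _ _ xaX) => H; apply: le_trans H _; rewrite ler_wpM2r//.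
apply: ler_pM; rewrite ?expR_ge0//.
  by lra.
by rewrite ler_expR ler_wpM2l.
Qed.

End Gronwall.

(** * Measurability of inverse matrices *)

Section MatrixMeasurability.
Variable R : realType.
Implicit Types (D : set (measurableTypeR R)).

Lemma cmeas_conj D (f : R -> R[i]) : cmeas D f -> cmeas D (fun x => (f x)^*).
Proof.
move=> [mr mi]; split.
  by apply: eq_measurable_fun mr => x _ /=; case: (f x).
have H : measurable_fun D (fun x => - Im (f x)) by exact: measurable_funN.
by apply: eq_measurable_fun H => x _ /=; case: (f x).
Qed.

(** The inverse is the conjugate divided by |f|^2, and the real reciprocal is written as exp(- ln),
    a composition of measurable functions. *)
Lemma cmeas_inv D (f : R -> R[i]) : cmeas D f -> (forall x, D x -> f x != 0) ->
  cmeas D (fun x => (f x)^-1).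
Proof.
move=> mf f0; pose k x := expR (- ln (normc (f x) ^+ 2)).
have mk : measurable_fun D k.
  apply: (measurableT_comp (f := expR)); first exact: measurable_expR.
  apply: measurableT_comp => //.
  apply: (measurableT_comp (f := @ln R)); first exact: measurable_ln.
  by apply: measurable_funX; exact: measurable_normc.
apply: (@eq_cmeas _ _ (fun x => (k x)%:C * (f x)^*)); last first.
  by apply: cmeasM; [exact: cmeas_real|exact: cmeas_conj].
move=> x Dx; have fx := f0 x Dx.
have nf : 0 < normc (f x) ^+ 2 by rewrite exprn_gt0// normc_gt0.
apply: (mulfI fx); rewrite divff//.
rewrite /k expRN lnK// mulrCA.
have -> : f x * (f x)^* = (normc (f x) ^+ 2)%:C.
  case: (f x) => a b; rewrite /normc sqr_sqrtr ?addr_ge0 ?sqr_ge0//.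
  by apply: complexP => /=; ring.
by rewrite -rmorphM /= mulVf ?gt_eqF.
Qed.

Lemma cmeas_det D n (A : R -> 'M[R[i]]_n) : (forall j k, cmeas D (fun x => A x j k)) ->
  cmeas D (fun x => \det (A x)).
Proof.
move=> mA; apply: cmeas_sum => s.
by apply: cmeasM; [exact: cmeas_cst|apply: cmeas_prod => i].
Qed.

Lemma cmeas_invmx D n (A : R -> 'M[R[i]]_n) : (forall j k, cmeas D (fun x => A x j k)) ->
  (forall x, D x -> A x \in unitmx) -> forall j k, cmeas D (fun x => invmx (A x) j k).
Proof.
move=> mA uA j k.
apply: (@eq_cmeas _ _ (fun x => (\det (A x))^-1 * cofactor (A x) k j)).
  by move=> x Dx; rewrite /invmx uA// !mxE.
apply: cmeasM.
  apply: cmeas_inv; first exact: cmeas_det.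
  by move=> x /uA; rewrite unitmxE unitfE.
apply: cmeasM; first exact: cmeas_cst.
by apply: cmeas_det => a b; under eq_fun do rewrite !mxE; exact: mA.
Qed.

End MatrixMeasurability.

Section BlockDiagonalFrame.
Variables (R : realType) (n : nat) (rho : R -> R).
Let mu : {measure set (measurableTypeR R) -> \bar R} := lebesgue_measure.
Let D0 : set (measurableTypeR R) := `[0%R, +oo[%classic.
Let mD0 : measurable D0 := @measurable_0y R.
Let V := R -> 'I_n -> R[i].
Let Mx := R -> 'M[R[i]]_n.
Hypothesis cI : cond_I rho.
Variables (b : 'I_n -> R[i]) (A : Mx).
Hypothesis iA : L1mx A.
Let D : Mx := Dmx b A.

(** The base point [a] does not occur: this uniformity is what lets the thresholds tend to 0. The 1
    covers the identity matrix used before a. *)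
Definition frame_bound : R := 3 * expR (2 * mass D) + 1.

Lemma L1mx_Dmx : L1mx D.
Proof.
move=> j m; have -> : (fun t => D t j m) = (fun t => if b j == b m then A t j m else 0).
  by apply/funext => t; rewrite mxE.
case: (b j == b m); first exact: iA.
exact: cintegrable0.
Qed.

(** [Mh] is [M] from [a] on and the identity before, so the bounds hold on all of [0, +oo[.
    Gronwall's estimate forwards from a bounds M, backwards from x it bounds the inverse. *)
Lemma Malpha_frame (a : R) (M : Mx) : 0 <= a -> is_Malpha b A a M ->
  exists Mh : Mx, [/\
    forall x, a <= x -> Mh x = M x,
    forall j k, cmeas D0 (fun x => Mh x j k) /\ cmeas D0 (fun x => invmx (Mh x) j k),
    forall x, 0 <= x -> Mh x \in unitmx,
    forall x j k, 0 <= x -> normc (Mh x j k) <= frame_bound /\ normc (invmx (Mh x) j k) <= frame_bound &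
    forall x j k, 0 <= x -> b j != b k -> Mh x j k = 0 /\ invmx (Mh x) j k = 0].
Proof.
move=> a0 [[acM dM] Ma].
have iD := L1mx_Dmx.
pose col_ k : V := fun x j => M x j k.
have dcol k j : ACder (fun x => col_ k x j) (fun x => row_mul D (col_ k) x j).
  split; first by move=> T; exact: acM.
  have := dM; apply: (@filterS _ _ (ae_filter_ringOfSetsType mu)) => x dx x0.
  by have := dx x0 j k; rewrite mxE.
pose K := 3 * expR (2 * mass D).
have K0 : 0 <= K by rewrite /K mulr_ge0// expR_ge0.
have bM x j k : a <= x -> normc (M x j k) <= K.
  move=> ax; rewrite -[K]mulr1.
  apply: (gronwall (dir := true) (u := col_ k) cI iD a0 ax) => //.
    by move=> i; rewrite /col_ Ma mxE; case: eqP; rewrite ?normc1 ?normc0.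
  by rewrite ax lexx.
(* The entries of column k outside its block, completed by zeros, solve the same linear system and
   vanish at [a]. *)
have block x j k : a <= x -> b j != b k -> M x j k = 0.
  move=> ax bjk; pose u : V := fun x i => if b i == b k then 0 else M x i k.
  have du i : ACder (fun x => u x i) (fun x => row_mul D u x i).
    have E y : row_mul D u y i = if b i == b k then 0 else row_mul D (col_ k) y i.
      rewrite /row_mul; have [bi|bi] := eqVneq (b i) (b k).
        rewrite big1// => m _; rewrite /D mxE bi /u [b m == b k]eq_sym.
        by case: ifP; rewrite ?mulr0 ?mul0r.
      apply: eq_bigr => m _; rewrite /D mxE /u /col_.
      have [bim|bim] := eqVneq (b i) (b m); last by rewrite !mul0r.
      by rewrite -bim (negbTE bi).
    rewrite (funext E) /u; case: (b i == b k); first exact: ACder_cst.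
    exact: dcol.
  have u0 i : normc (u a i) <= 0.
    rewrite /u; case: ifP => bi; first by rewrite normc0.
    by rewrite Ma mxE; case: eqP => [ik|]; [rewrite ik eqxx in bi|rewrite normc0].
  have := gronwall (dir := true) (u := u) cI iD a0 ax du (lexx 0) u0 (x := x).
  rewrite ax lexx mulr0 => /(_ isT j); rewrite {1}/u (negbTE bjk) => H.
  by apply/eqP; rewrite -normc_eq0 eq_le normc_ge0 H.
(* M v is a solution with value v at [a], so the backward estimate bounds v by M(x) v. With bound 0
   this gives invertibility; applied to the columns of the inverse, it bounds them. *)
have inj x (v : 'cV[R[i]]_n) eps : a <= x -> 0 <= eps -> (forall j, normc ((M x *m v) j 0) <= eps) ->
    forall j, normc (v j 0) <= K * eps.
  move=> ax eps0 Mv j; pose u : V := fun x i => (M x *m v) i 0.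
  have uE y i : u y i = \sum_k v k 0 * col_ k y i.
    by rewrite /u mxE; apply: eq_bigr => k _; rewrite mulrC.
  have du i : ACder (fun x => u x i) (fun x => row_mul D u x i).
    have -> : (fun y => u y i) = (fun y => \sum_k v k 0 * col_ k y i) by apply/funext => y.
    apply: (ACder_eq (f' := fun y => \sum_k v k 0 * row_mul D (col_ k) y i)).
      by apply: ACder_sum => k; apply: ACderZ; exact: dcol.
    move=> y _; rewrite /row_mul.
    under eq_bigr do rewrite mulr_sumr; rewrite exchange_big /=; apply: eq_bigr => m _.
    by rewrite uE mulr_sumr; apply: eq_bigr => k _; ring.
  have := gronwall (dir := false) (u := u) cI iD a0 ax du eps0 Mv (x := a).
  by rewrite lexx ax => /(_ isT j); rewrite /u Ma mul1mx.
have unitM x : a <= x -> M x \in unitmx.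
  move=> ax; rewrite -unitmx_tr unitmxE unitfE; apply/negP => /det0P[v v0 vM].
  have /eqP/(_ _)[] := v0; apply/rowP => j; rewrite [RHS]mxE.
  have := inj x v^T 0 ax (lexx 0) _ j; rewrite mxE mulr0 => H.
  apply/eqP; rewrite -normc_eq0 eq_le normc_ge0 andbT; apply: H => i.
  have -> : M x *m v^T = 0 by apply: trmx_inj; rewrite trmx_mul trmxK vM trmx0.
  by rewrite mxE normc0.
pose Mh x := if a <= x then M x else 1%:M.
have uMh x : Mh x \in unitmx by rewrite /Mh; case: ifP => [/unitM//|_]; exact: unitmx1.
have K1 : 1 <= frame_bound by rewrite /frame_bound lerDr.
have KK : K <= frame_bound by rewrite /frame_bound lerDl.
have bid j k : normc ((1%:M : 'M[R[i]]_n) j k) <= 1.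
  by rewrite mxE; case: eqP; rewrite ?normc1 ?normc0.
have mMh j k : cmeas D0 (fun x => Mh x j k).
  pose I : set (measurableTypeR R) := `[a, +oo[%classic.
  have mI : measurable I by exact: measurable_itv.
  apply: (@eq_cmeas _ _ (fun x => (\1_I x)%:C * M x j k + (\1_(~` I) x)%:C * (1%:M : 'M[R[i]]_n) j k)).
    move=> x _; rewrite /Mh !indicE in_setC /I mem_setE in_itv/= andbT.
    by case: (a <= x) => /=; ring.
  apply: cmeasD; apply: cmeasM.
  - by apply: cmeas_real; exact: measurable_indic.
  - exact: ACder_cmeas (dcol k j).
  - by apply: cmeas_real; apply: measurable_indic; exact: measurableC.
  - exact: cmeas_cst.
have bMh x j k : b j != b k -> Mh x j k = 0.
  rewrite /Mh; case: ifP => [ax|_] bjk; first exact: block.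
  by rewrite mxE; case: eqP => // jk; rewrite jk eqxx in bjk.
exists Mh; split.
- by move=> x ax; rewrite /Mh ax.
- by move=> j k; split => //; apply: cmeas_invmx.
- by move=> x _.
- move=> x j k x0; split.
    rewrite /Mh; case: ifP => [ax|_]; first by rewrite (le_trans (bM _ _ _ ax)).
    exact: le_trans (bid _ _) _.
  rewrite /Mh; case: ifP => [ax|_]; last by rewrite invmx1 (le_trans (bid _ _)).
  have := inj x (col k (invmx (M x))) 1 ax ler01 _ j; rewrite mxE mulr1 => H.
  apply: le_trans (H _) KK => i.
  by rewrite colE mulmxA mulmxV ?unitM// mul1mx mxE; case: andP; rewrite ?normc1 ?normc0.
- move=> x j k x0 bjk; split; first exact: bMh.
  (* Being block-diagonal amounts to commuting with diag(b), a property that passes to the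
     inverse. *)
  pose B := diag_mx (\row_j b j).
  have comm : Mh x *m B = B *m Mh x.
    apply/matrixP => i l; rewrite mul_mx_diag mul_diag_mx !mxE.
    by have [->|bil] := eqVneq (b i) (b l); [rewrite mulrC|rewrite bMh// mul0r mulr0].
  have : invmx (Mh x) *m B = B *m invmx (Mh x).
    apply: (can_inj (mulKmx (uMh x))); rewrite mulmxA mulmxV// mul1mx mulmxA comm -mulmxA.
    by rewrite mulmxV// mulmx1.
  move=> /matrixP/(_ j k); rewrite mul_mx_diag mul_diag_mx !mxE => /eqP.
  rewrite mulrC -subr_eq0 -mulrBl mulf_eq0 subr_eq0 eq_sym (negbTE bjk)/=.
  by move/eqP.
Qed.

End BlockDiagonalFrame.

(** * Conjugation of the coefficients by the frame *)

Section Conjugation.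
Variables (R : realType) (n : nat).
Let mu : {measure set (measurableTypeR R) -> \bar R} := lebesgue_measure.
Let D0 : set (measurableTypeR R) := `[0%R, +oo[%classic.
Let mD0 : measurable D0 := @measurable_0y R.
Let Mx := R -> 'M[R[i]]_n.
Variables (a N : R) (Mh : Mx).
Hypothesis mM : forall j k, cmeas D0 (fun x => Mh x j k).
Hypothesis mN : forall j k, cmeas D0 (fun x => invmx (Mh x) j k).
Hypothesis bM : forall (x : R) j k, 0 <= x -> normc (Mh x j k) <= N.
Hypothesis bN : forall (x : R) j k, 0 <= x -> normc (invmx (Mh x) j k) <= N.
Let I : set (measurableTypeR R) := `[a, +oo[%classic.
Implicit Types (X Y : Mx).

(** The cut makes the integrals over [0, x] start effectively at [a]. *)
Definition conj_by X : Mx := cut I (fun t => invmx (Mh t) *m X t *m Mh t).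

Lemma conj_byE X t j k :
  conj_by X t j k = (\1_I t)%:C * \sum_l \sum_i invmx (Mh t) j i * Mh t l k * X t i l.
Proof.
rewrite /conj_by mxE mxE; congr (_ * _); apply: eq_bigr => l _.
by rewrite mxE mulr_suml; apply: eq_bigr => i _; ring.
Qed.

Lemma conj_by_lt X t : t < a -> conj_by X t = 0.
Proof. by move=> ta; rewrite /conj_by /cut indicE mem_setE in_itv/= leNgt ta scale0r. Qed.

Lemma conj_by_ge X t : a <= t -> conj_by X t = invmx (Mh t) *m X t *m Mh t.
Proof. by move=> ta; rewrite /conj_by /cut indicE mem_setE in_itv/= ta scale1r. Qed.

Lemma conj_byB X Y t : conj_by (fun t => X t - Y t) t = conj_by X t - conj_by Y t.
Proof. by rewrite /conj_by /cut mulmxBr mulmxBl scalerBr. Qed.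

Lemma conj_byD X Y t : conj_by (fun t => X t + Y t) t = conj_by X t + conj_by Y t.
Proof. by rewrite /conj_by /cut mulmxDr mulmxDl scalerDr. Qed.

Lemma conj_byZ (c : R[i]) X t : conj_by (fun t => c *: X t) t = c *: conj_by X t.
Proof. by rewrite /conj_by /cut -scalemxAr -scalemxAl !scalerA mulrC. Qed.

Let mI : measurable I. Proof. exact: measurable_itv. Qed.

Lemma L1mx_conj_by X : L1mx X -> L1mx (conj_by X).
Proof.
move=> iX; apply: L1mx_cut => // j k.
have -> : (fun t => (invmx (Mh t) *m X t *m Mh t) j k) =
    (fun t => \sum_l \sum_i invmx (Mh t) j i * Mh t l k * X t i l).
  apply/funext => t; rewrite mxE; apply: eq_bigr => l _.
  by rewrite mxE mulr_suml; apply: eq_bigr => i _; ring.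
apply: cintegrable_sum => // l; apply: cintegrable_sum => // i.
apply: (@cintegrableM _ _ _ _ (N * N)) => //; first exact: cmeasM.
move=> x; rewrite /D0 /= in_itv/= andbT => x0.
by rewrite normcM; apply: ler_pM; rewrite ?normc_ge0 ?bM ?bN.
Qed.

(** Each of the n^2 entries of the product is at most N^2 times the sum of all entries of [X]. *)
Lemma mass_conj_by X : L1mx X -> mass (conj_by X) <= (n%:R * N) ^+ 2 * mass (cut I X).
Proof.
move=> iX; apply: le_mass => [||t t0]; [exact: L1mx_conj_by|exact: L1mx_cut|].
have -> : (n%:R * N) ^+ 2 * sumnorm (cut I X) t = \sum_(j < n) \sum_(k < n) N ^+ 2 * sumnorm (cut I X) t.
  rewrite !sumr_const card_ord -[X in _ = X *+ _]mulr_natl -[RHS]mulr_natl.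
  by move: (sumnorm _ _) => S; rewrite exprMn expr2 -!mulrA.
apply: ler_sum => j _; apply: ler_sum => k _.
rewrite conj_byE normcM.
have -> : sumnorm (cut I X) t = normc ((\1_I t)%:C : R[i]) * sumnorm X t by exact: sumnormZ.
rewrite mulrCA ler_wpM2l ?normc_ge0//.
apply: le_trans (normc_sum _ _ _) _; rewrite /sumnorm exchange_big /= mulr_sumr.
apply: ler_sum => l _; apply: le_trans (normc_sum _ _ _) _; rewrite mulr_sumr.
apply: ler_sum => i _; rewrite normcM ler_wpM2r ?normc_ge0//.
by rewrite normcM expr2; apply: ler_pM; rewrite ?normc_ge0 ?bM ?bN.
Qed.

End Conjugation.

Section OneSidedFTC.
Variable R : realType.

(** Here the derivative is identified only from [a] on, as happens for the forward solution. *)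
Lemma ACder_FTC_from (f f' g : R -> R[i]) a b : ACder f f' -> cloc g -> 0 <= a -> a <= b ->
  (forall x, a <= x -> f' x = g x) -> f b - f a = cint `[a, b] g.
Proof.
move=> df lg a0 ab fg.
have [b0|b0] := ltP 0 b; last first.
  have -> : a = b by apply/eqP; rewrite eq_le ab (le_trans b0).
  by rewrite subrr cint_set1.
have [ach dh] := ACderB df (ACder_cint lg).
have : f b - cint `[0, b] g = f a - cint `[0, a] g.
  apply: (AC_derive0_cst (h := fun x => f x - cint `[0, x] g) ab _ dh) => [e e0|x /andP[ax _]]; last first.
    by rewrite /= => /contrapT /(_ (le_trans a0 ax)); rewrite fg// subrr.
  have [d d0 H] := ach _ b0 _ e0; exists d => // m u v uv; apply: H => i.
  by have [au uv' vb] := uv i; split => //; exact: le_trans au.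
move/eqP; rewrite -subr_eq0 => /eqP E; rewrite -cint_itvB//.
by apply/eqP; rewrite -subr_eq0 -E; apply/eqP; ring.
Qed.
End OneSidedFTC.

(** * The fundamental system *)

Section GluedColumn.
Variables (R : realType) (n : nat) (rho : R -> R).
Let mu : {measure set (measurableTypeR R) -> \bar R} := lebesgue_measure.
Let D0 : set (measurableTypeR R) := `[0%R, +oo[%classic.
Let mD0 : measurable D0 := @measurable_0y R.
Let V := R -> 'I_n -> R[i].
Let Mx := R -> 'M[R[i]]_n.
Let p := primitive rho.
Hypothesis cI : cond_I rho.
Variables (b : 'I_n -> R[i]) (A : Mx) (a : R) (M : Mx).
Hypothesis a_ge0 : 0 <= a.
Hypothesis iA : L1mx A.
Hypothesis MA : is_Malpha b A a M.

Definition unitV (k : 'I_n) : V := fun _ j => (j == k)%:R.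

Definition direction (k j : 'I_n) : bool := (k <= j)%N.

Definition forward (l : R[i]) (k : 'I_n) (z : V) : V := fun x j =>
  cexp (l * b k * (p x - p a)%:C) * \sum_m M x j m * z x m.

(* The values on [0, a[ come from a backward Volterra equation. *)
Definition glued (l : R[i]) (k : 'I_n) (z f : V) : V := fun x j =>
  if a <= x then forward l k z x j else f x j.

Definition coefficients (l : R[i]) (X : Mx) : Mx := fun x => l *: Fmx rho b x + A x + X x.

Let Ip : set (measurableTypeR R) := `[a, +oo[%classic.
Let Im_ : set (measurableTypeR R) := `]-oo, a[%classic.

Lemma row_mulE (Q : Mx) (f : V) t j : row_mul Q f t j = (Q t *m \col_m f t m) j 0.
Proof. by rewrite mxE; apply: eq_bigr => m _; rewrite mxE. Qed.

Lemma cloc_coefficients l X j m : L1mx X -> cloc (fun x => coefficients l X x j m).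
Proof.
move=> iX.
apply: (eq_cloc (f := fun x => (l * (b m *+ (j == m))) * (rho x)%:C + A x j m + X x j m)).
  by move=> x _; rewrite !mxE; case: eqP => [->|_]; rewrite ?mulr1n ?mulr0n; ring.
apply: clocD; last exact: cintegrable_cloc.
apply: clocD; last exact: cintegrable_cloc.
by apply: clocZ; exact: cloc_rho.
Qed.

Variables (Mh : Mx).
Hypothesis MhM : forall x : R, a <= x -> Mh x = M x.
Hypothesis uMh : forall x : R, 0 <= x -> Mh x \in unitmx.
Hypothesis blockM : forall (x : R) j k, 0 <= x -> b j != b k -> Mh x j k = 0.
Variables (l : R[i]) (k : 'I_n) (X : Mx) (z f : V) (Bz Bf : R).
Hypothesis iX : L1mx X.
Let e (j : 'I_n) : R[i] := l * (b j - b k).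
Let Q : Mx := conj_by a Mh (fun t => A t - Dmx b A t + X t).
Let G := coefficients l X.
Hypothesis ad : admissible (direction k) e.
Hypothesis iQ : L1mx Q.
Hypothesis mz : mV z.
Hypothesis bz : bnd Bz z.
Hypothesis zsol : solves_eq (Top rho (direction k) e Q) z (unitV k).
Hypothesis iQf : L1mx (cut Im_ G).
Hypothesis mf : mV f.
Hypothesis bf : bnd Bf f.
Hypothesis fsol : solves_eq (Top rho (fun=> false) (fun=> 0) (cut Im_ G)) f (fun _ j => z a j).

(** For j >= k the integral runs over [0, a], where [Q] vanishes except possibly at the single point
    a. *)
Lemma forward_initial (j : 'I_n) : (k <= j)%N -> z a j = (j == k)%:R.
Proof.
move=> kj; rewrite zsol// /unitV /Top /Kop /direction kj mul1r.
rewrite (@eq_cint _ _ _ (fun t => (\1_Ip t)%:C * (expker rho e j a t * row_mul Q z t j))); last first.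
  move=> t _; rewrite indicE mem_setE in_itv/= andbT; have [ta|ta] := leP a t; first by rewrite mul1r.
  rewrite mul0r /row_mul big1 ?mulr0// => m _.
  by rewrite /Q conj_by_lt// mxE mul0r.
rewrite cint_indic; last exact: measurable_Jset.
have -> : Jset true a `&` Ip = `[a, a]%classic.
  apply/seteqP; split => t; rewrite /Jset /Ip /= !in_itv/= andbT.
    by move=> [/andP[_ ->] ->].
  by move=> /andP[at_ ta]; rewrite at_ ta (le_trans a_ge0).
by rewrite cint_set1 addr0.
Qed.

Lemma ACder_column j :
  ACder (fun x => z x j) (fun x => e j * (rho x)%:C * z x j + row_mul Q z x j).
Proof.
have [g [Tg dg]] := Top_ACder cI j ad iQ mz bz.
have E x : 0 <= x -> z x j = (j == k)%:R + g x by move=> x0; rewrite zsol// Tg.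
have := ACderD (ACder_cst ((j == k)%:R : R[i])) dg => H.
apply: (ACder_eqf (f := fun x => (j == k)%:R + g x)); first by move=> x x0; rewrite E.
apply: ACder_eq H _ => x x0; rewrite E//.
by rewrite /e; case: eqP => [->|_] /=; ring.
Qed.

(** Since M is block-diagonal, the phases l (b_m - b_k) of the components of z become l (b_j - b_k)
    in front of row j of M z. Conjugation turns M Q z into (A - D + X) M z, the D cancels against M'
    = D M, and the exponential factor supplies the missing l b_k. *)
Lemma ACder_forward j : exists2 y' : R -> R[i],
  ACder (fun x => forward l k z x j) y' &
  forall x, a <= x -> y' x = row_mul G (forward l k z) x j.
Proof.
have [[acM dM] Ma] := MA.
have dMe i m : ACder (fun x => M x i m) (fun x => (Dmx b A x *m M x) i m).
  split; first by move=> T; exact: acM.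
  have := dM; apply: (@filterS _ _ (ae_filter_ringOfSetsType mu)) => x dx x0; exact: dx.
have dE := ACder_cexp (ACderZ (l * b k) (ACderB (ACder_primitive cI) (ACder_cst (p a)%:C))).
have dS := ACder_sum (index_enum 'I_n) (fun m => ACderM (dMe j m) (ACder_column m)).
have dy := ACderM dE dS.
eexists; first by apply: ACder_eqf dy => x x0; rewrite /forward rmorphB.
move=> x ax; have x0 := le_trans a_ge0 ax.
have -> : cexp (l * b k * ((p x)%:C - (p a)%:C)) = cexp (l * b k * (p x - p a)%:C) by rewrite rmorphB.
set E := cexp (l * b k * (p x - p a)%:C).
set zc : 'cV[R[i]]_n := \col_m z x m; set w := M x *m zc.
have wE i : \sum_m M x i m * z x m = w i 0.
  by rewrite mxE; apply: eq_bigr => m _; rewrite mxE.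
rewrite wE big_split /=.
have -> : \sum_m (Dmx b A x *m M x) j m * z x m = (Dmx b A x *m w) j 0.
  by rewrite /w mulmxA [RHS]mxE; apply: eq_bigr => m _; rewrite [zc _ _]mxE.
have -> : \sum_m M x j m * (e m * (rho x)%:C * z x m + row_mul Q z x m) =
    l * (b j - b k) * (rho x)%:C * w j 0 + ((A x - Dmx b A x + X x) *m w) j 0.
  under eq_bigr do rewrite mulrDr; rewrite big_split /=; congr (_ + _).
    rewrite -wE mulr_sumr; apply: eq_bigr => m _.
    have [bjm|bjm] := eqVneq (b j) (b m); first by rewrite /e bjm; ring.
    by have -> : M x j m = 0; [rewrite -MhM// blockM|ring].
  transitivity ((M x *m (Q x *m zc)) j 0).
    by rewrite [RHS]mxE; apply: eq_bigr => m _; rewrite row_mulE.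
  by rewrite /Q conj_by_ge// MhM// -!mulmxA mulKVmx// -MhM// uMh.
rewrite row_mulE.
have -> : \col_m forward l k z x m = E *: w.
  by apply/colP => m; rewrite [LHS]mxE [RHS]mxE /forward -/E wE.
have -> : (G x *m (E *: w)) j 0 =
    E * (l * ((rho x)%:C * (b j * w j 0)) + (A x *m w) j 0 + (X x *m w) j 0).
  rewrite -scalemxAr mxE; congr (_ * _).
  by rewrite /G /coefficients !mulmxDl -scalemxAl /Fmx -scalemxAl mul_diag_mx !mxE.
have -> : ((A x - Dmx b A x + X x) *m w) j 0 =
    (A x *m w) j 0 - (Dmx b A x *m w) j 0 + (X x *m w) j 0.
  by rewrite !mulmxDl mulNmx !mxE.
ring.
Qed.

Lemma glued_start j : glued l k z f a j = z a j.
Proof.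
rewrite /glued lexx /forward subrr mulr0 cexp0 mul1r MA.2.
rewrite (bigD1 j)//= mxE eqxx mul1r big1 ?addr0// => m mj.
by rewrite mxE eq_sym (negbTE mj) mul0r.
Qed.

(** The glued function is z(a) plus the operator term of the backward equation plus a primitive that
    starts at [a]. Absolute continuity across a is then automatic, with no one-sided derivatives at
    the junction. *)
Lemma ACder_glued j : ACder (fun x => glued l k z f x j) (fun x => row_mul G (glued l k z f) x j).
Proof.
have [y' dy y'E] := ACder_forward j.
have dyi i : ACder (fun x => forward l k z x i) (projT1 (cid2 (ACder_forward i))).
  by case: cid2.
have lrow : cloc (fun x => row_mul G (forward l k z) x j).
  apply: cloc_sum => m; apply: (eq_cloc (f := fun x => forward l k z x m * G x j m)).
    by move=> x _; rewrite mulrC.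
  exact: ACder_cloc_mul (dyi m) (cloc_coefficients l j m iX).
pose h x := (\1_Ip x)%:C * row_mul G (forward l k z) x j.
have lh : cloc h.
  apply: cloc_mul => //.
    by apply: cmeas_real; apply: measurable_indic; exact: measurable_itv.
  by move=> T _; exists 1 => x _; rewrite normc_indic.
have ad0 : admissible (fun _ : 'I_n => false) (fun=> 0 : R[i]) by move=> i /=.
have [g [Tg dg]] := Top_ACder cI j ad0 iQf mf bf.
have fE x : 0 <= x -> f x j = z a j + g x by move=> x0; rewrite fsol// Tg.
(* From [a] on the coefficients of the backward equation are cut to zero, so its solution stays at
   the matching value z(a). *)
have fa x : a <= x -> f x j = z a j.
  move=> ax; have x0 := le_trans a_ge0 ax; rewrite fsol// /Top /Kop mulN1r.
  rewrite (@eq_cint _ _ _ (fun=> 0)); last first.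
    move=> t /(JsetP x0)[_ xt]; rewrite /row_mul big1 ?mulr0// => m _.
    by rewrite /cut mxE indicE mem_setE in_itv/= ltNge (le_trans ax xt) mul0r mul0r.
  by rewrite /cint /Rintegral integral0 /= (_ : 0 +i* 0 = 0)// oppr0 addr0.
have glE x : 0 <= x -> z a j + g x + cint `[0, x] h = glued l k z f x j.
  move=> x0; rewrite -fE// /h cint_indic; last exact: measurable_itv.
  rewrite /glued; case: leP => ax.
    have -> : `[0, x] `&` Ip = `[a, x]%classic.
      apply/seteqP; split => t; rewrite /Ip /= !in_itv/= andbT.
        by move=> [/andP[_ ->] ->].
      by move=> /andP[at_ ta]; rewrite at_ ta (le_trans a_ge0).
    rewrite -(ACder_FTC_from dy lrow a_ge0 ax y'E) fa// -glued_start /glued lexx.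
    by rewrite subrKC.
  have -> : `[0, x] `&` Ip = set0.
    rewrite -subset0 => t; rewrite /Ip /= !in_itv/= andbT => -[/andP[_ tx] at_].
    by have := le_lt_trans (le_trans at_ tx) ax; rewrite ltxx.
  by rewrite cint_set0 addr0.
apply: ACder_eqf glE _.
apply: ACder_eq (ACderD (ACderD (ACder_cst (z a j)) dg) (ACder_cint lh)) _ => x x0.
rewrite mul0r mul0r !add0r /h indicE mem_setE in_itv/= andbT.
have [ax|ax] := leP a x.
  rewrite mul1r [X in X + _](_ : _ = 0) ?add0r; last first.
    by rewrite /row_mul big1// => m _; rewrite /cut mxE indicE mem_setE in_itv/= ltNge ax mul0r mul0r.
  by apply: eq_bigr => m _; rewrite /glued ax.
rewrite mul0r addr0; apply: eq_bigr => m _; rewrite /glued leNgt ax /=.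
by rewrite /cut mxE indicE mem_setE in_itv/= ax mul1r.
Qed.

End GluedColumn.

(** * Coefficients differentiable in the parameter with respect to the L1 norm *)

Section L1Derivative.
Variables (R : realType) (n : nat).
Let mu : {measure set (measurableTypeR R) -> \bar R} := lebesgue_measure.
Let D0 : set (measurableTypeR R) := `[0%R, +oo[%classic.
Let mD0 : measurable D0 := @measurable_0y R.
Let Mx := R -> 'M[R[i]]_n.
Implicit Types (X : R[i] -> Mx) (l : R[i]).

Definition quotient X l0 l : Mx := fun t => (l - l0)^-1 *: (X l t - X l0 t).

(** Integrability is asked for near [l0] only, since the perturbation is controlled for l different
    from 0. *)
Definition L1_derivative X (X' : Mx) l0 : Prop := L1mx X' /\
  forall eps, 0 < eps -> exists2 d, 0 < d & forall l, normc (l - l0) < d ->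
    L1mx (X l) /\ (l != l0 -> mass (fun t => quotient X l0 l t - X' t) <= eps).

Lemma L1mx_quotient X l0 l : L1mx (X l) -> L1mx (X l0) -> L1mx (quotient X l0 l).
Proof. by move=> i1 i0; apply: L1mxZ; exact: L1mxB. Qed.

Lemma mass0 : mass (fun=> 0 : 'M[R[i]]_n) = 0.
Proof.
rewrite /mass (@eq_Rintegral _ _ _ _ _ (fun=> 0)); first by rewrite /Rintegral integral0.
by move=> t _; rewrite /sumnorm big1// => j _; rewrite big1// => m _; rewrite mxE normc0.
Qed.

Lemma L1_derivative_at X (X' : Mx) l0 : L1_derivative X X' l0 -> L1mx (X l0).
Proof.
by move=> [_ /(_ 1 ltr01)[d d0 H]]; have [] := H l0 _; rewrite // subrr normc0.
Qed.

Lemma L1_derivative_continuous X (X' : Mx) l0 : L1_derivative X X' l0 ->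
  forall eps, 0 < eps -> exists2 d, 0 < d & forall l, normc (l - l0) < d ->
    mass (fun t => X l t - X l0 t) <= eps.
Proof.
move=> dX eps eps0; have i0 := L1_derivative_at dX.
have [i' /(_ 1 ltr01)[d d0 H]] := dX.
have m1 : 0 < mass X' + 1 by rewrite ltr_wpDl// mass_ge0.
exists (Num.min d (eps / (mass X' + 1))); first by rewrite lt_min d0 divr_gt0.
move=> l; rewrite lt_min => /andP[ld le_]; have [->|ll0] := eqVneq l l0.
  have -> : (fun t => X l0 t - X l0 t) = (fun=> 0) by apply/funext => t; rewrite subrr.
  by rewrite mass0 ltW.
have [il /(_ ll0) Hl] := H l ld; have iq := L1mx_quotient il i0.
have -> : (fun t => X l t - X l0 t) = (fun t => (l - l0) *: quotient X l0 l t).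
  by apply/funext => t; rewrite scalerA mulfV ?scale1r// subr_eq0.
apply: le_trans (massZ _ iq) _.
apply: (@le_trans _ _ (normc (l - l0) * (mass X' + 1))).
  rewrite ler_wpM2l ?normc_ge0// (le_trans (mass_triangle iq i'))// lerD2l//.
by rewrite -ler_pdivlMr// ltW.
Qed.

Lemma L1_derivative_shift X (X' : Mx) l0 (K : Mx) : L1mx K -> L1_derivative X X' l0 ->
  L1_derivative (fun l t => K t + X l t) X' l0.
Proof.
move=> iK [i' H]; split; first exact: i'.
move=> eps eps0; have [d d0 Hd] := H eps eps0; exists d; first exact: d0.
move=> l ld; have [il Hl] := Hd l ld.
split; first exact: L1mxD.
have -> // : (fun t => quotient (fun l t => K t + X l t) l0 l t - X' t) =
  (fun t => quotient X l0 l t - X' t).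
by apply/funext => t; rewrite /quotient opprD addrACA subrr add0r.
Qed.

Lemma L1_derivative_conj a N (Mh : Mx) X (X' : Mx) l0 :
  (forall j k, cmeas D0 (fun x => Mh x j k)) ->
  (forall j k, cmeas D0 (fun x => invmx (Mh x) j k)) ->
  (forall (x : R) j k, 0 <= x -> normc (Mh x j k) <= N) ->
  (forall (x : R) j k, 0 <= x -> normc (invmx (Mh x) j k) <= N) ->
  L1_derivative X X' l0 ->
  L1_derivative (fun l => conj_by a Mh (X l)) (conj_by a Mh X') l0.
Proof.
move=> mM mN bM bN dX; have [i' H] := dX; have i0 := L1_derivative_at dX.
have C0 : 0 < (n%:R * N) ^+ 2 + 1 by rewrite ltr_wpDl// sqr_ge0.
split; first exact: (L1mx_conj_by a mM mN bM bN).
move=> eps eps0; have [d d0 Hd] := H (eps / ((n%:R * N) ^+ 2 + 1)) (divr_gt0 eps0 C0).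
exists d => // l ld; have [il Hl] := Hd l ld.
split; first exact: (L1mx_conj_by a mM mN bM bN).
move=> ll0; have iq := L1mxB (L1mx_quotient il i0) i'.
have -> : (fun t => quotient (fun l => conj_by a Mh (X l)) l0 l t - conj_by a Mh X' t) =
    conj_by a Mh (fun t => quotient X l0 l t - X' t).
  by apply/funext => t; rewrite conj_byB; congr (_ - _); rewrite conj_byZ conj_byB.
apply: le_trans (mass_conj_by a mM mN bM bN iq) _.
apply: (@le_trans _ _ (((n%:R * N) ^+ 2 + 1) * mass (fun t => quotient X l0 l t - X' t))).
  apply: ler_pM; rewrite ?sqr_ge0 ?mass_ge0//; first by rewrite lerDl.
  by apply: mass_cut => //; exact: measurable_itv.
by rewrite mulrC -ler_pdivlMr// Hl.
Qed.

Lemma L1mx_cut_cloc (a : R) (Y : Mx) : (forall j m, cloc (fun t => Y t j m)) ->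
  L1mx (cut `]-oo, a[%classic Y).
Proof.
move=> lX j m.
have -> : (fun t => cut `]-oo, a[%classic Y t j m) = (fun t => (\1_(`]-oo, a[%classic : set R) t)%:C * Y t j m).
  by apply/funext => t; rewrite mxE.
have mI : measurable (`]-oo, a[%classic : set (measurableTypeR R)) by exact: measurable_itv.
have sub : D0 `&` `]-oo, a[ `<=` `[0, `|a| + 1].
  move=> t; rewrite /D0 /= !in_itv/= => -[/andP[-> _] ta].
  by rewrite (le_trans (ltW ta))// (le_trans (ler_norm a))// lerDl.
have : cintegrable (D0 `&` `]-oo, a[) (fun t => Y t j m).
  have a1 : 0 < `|a| + 1 by rewrite ltr_wpDl.
  by apply: cintegrableS sub (lX j m _ a1) => //; exact: measurableI.
move=> [ir ii]; split.
  have := (integrable_restrict mu mI mD0 _).1 ir; apply: eq_integrable => // t _.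
  by rewrite /patch ReM /= mul0r subr0 indicE; case: (t \in _); rewrite ?mul1r ?mul0r.
have := (integrable_restrict mu mI mD0 _).1 ii; apply: eq_integrable => // t _.
by rewrite /patch ImM /= mul0r addr0 indicE; case: (t \in _); rewrite ?mul1r ?mul0r.
Qed.

End L1Derivative.

(** * Locally uniform constants for families of equations *)

Section Families.
Variables (R : realType) (n : nat) (rho : R -> R).
Let V := R -> 'I_n -> R[i].
Let Mx := R -> 'M[R[i]]_n.
Hypothesis cI : cond_I rho.
Variables (s : 'I_n -> bool) (c : 'I_n -> R[i]) (Lam : set R[i]).
Variables (Q : R[i] -> Mx) (Q' : Mx) (g f : R[i] -> V) (Kf : R -> R) (l0 : R[i]) (cg : R).
Let e l (j : 'I_n) : R[i] := l * c j.
Let T l : V -> V := Top rho s (e l) (Q l).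
Hypothesis n_gt0 : (0 < n)%N.
Hypothesis Lam_l0 : Lam l0.
Hypothesis adm : forall l, Lam l -> admissible s (e l).
Hypothesis iQ : forall l, Lam l -> L1mx (Q l).
Hypothesis dQ : L1_derivative Q Q' l0.
Hypothesis Kf_mono : forall x y, 0 <= x -> x <= y -> 0 <= Kf x <= Kf y.
Hypothesis Tsol : forall l, Lam l -> solvable (T l) (Kf (mass (Q l))).
Hypothesis mf : forall l, Lam l -> mV (f l).
Hypothesis mg : forall l, Lam l -> mV (g l).
Hypothesis fsol : forall l, Lam l -> solves_eq (T l) (f l) (g l).
Hypothesis fbd : forall l, Lam l -> exists B, bnd B (f l).
Hypothesis gbd : bnd cg (g l0).
Hypothesis gcont : forall eps, 0 < eps -> exists2 d, 0 < d & forall l, Lam l -> normc (l - l0) < d ->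
  bnd eps (subV (g l) (g l0)).

Let bnd_nonneg c0 (h : V) : bnd c0 h -> 0 <= c0.
Proof.
move=> bh; have := bh 0 (lexx _) (Ordinal n_gt0).
by rewrite mulr1; apply: le_trans; exact: normc_ge0.
Qed.

Lemma solvable_mono (U : V -> V) K K' : K <= K' -> solvable U K -> solvable U K'.
Proof.
move=> KK [ex st]; split.
  move=> h b0 mh bh; have [u [mu_ us bu]] := ex h b0 mh bh; exists u; split => //.
  by apply: bnd_weaken bu; rewrite ler_wpM2r// (bnd_nonneg bh).
move=> u r e0 B mu_ mr bu br ur; apply: bnd_weaken (st _ _ _ _ mu_ mr bu br ur).
by rewrite ler_wpM2r// (bnd_nonneg br).
Qed.

(** Near [l0] the mass of the coefficients exceeds its value at [l0] by at most 1, which fixes one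
    stability constant for a neighbourhood. *)
Let K := Kf (mass (Q l0) + 1).

Let K0 : 0 <= K.
Proof. by have /andP[] := Kf_mono (addr_ge0 (mass_ge0 (Q l0)) ler01) (lexx _). Qed.

Let cg0 : 0 <= cg. Proof. exact: bnd_nonneg gbd. Qed.

(** Each solution comes with a bound of its own; stability replaces it by a common bound near
    [l0]. *)
Let local : exists2 d, 0 < d & forall l, Lam l -> normc (l - l0) < d ->
  solvable (T l) K /\ bnd (K * (cg + 1)) (f l).
Proof.
have [d1 d10 H1] := L1_derivative_continuous dQ ltr01.
have [d2 d20 H2] := gcont ltr01.
exists (Num.min d1 d2); first by rewrite lt_min d10.
move=> l Ll; rewrite lt_min => /andP[l1 l2].
have sol : solvable (T l) K.
  apply: solvable_mono (Tsol Ll).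
  have h : mass (Q l) <= mass (Q l0) + 1.
    by apply: le_trans (mass_triangle (iQ Ll) (iQ Lam_l0)) _; rewrite lerD2l H1.
  by have /andP[] := Kf_mono (mass_ge0 (Q l)) h.
split=> //; have [B bB] := fbd Ll.
apply: (sol.2 _ _ _ _ (mf Ll) (mg Ll) bB _ (fsol Ll)) => x x0 j.
have := H2 l Ll l2 x x0 j; have := gbd x0 j; rewrite /subV !mulr1 => h1 h2.
have := le_normcD (g l x j - g l0 x j) (g l0 x j); rewrite subrK => h3.
by lra.
Qed.

Lemma family_continuous : forall x j eps, 0 <= x -> 0 < eps -> exists2 d, 0 < d &
    forall l, Lam l -> normc (l - l0) < d -> normc (f l x j - f l0 x j) <= eps.
Proof.
have [d d0 H] := local.
apply: (@solution_continuous R n rho cI s c Lam Q g f l0 d K (K * (cg + 1))) => //.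
- by rewrite mulr_ge0// addr_ge0.
- by move=> l Ll ld; have [] := H l Ll ld.
- by move=> l Ll ld; have [] := H l Ll ld.
- move=> eps /(L1_derivative_continuous dQ)[d1 d10 H1]; exists d1 => // l _; exact: H1.
Qed.

Variables (g' : V) (del d0 : R).
Hypothesis d0_gt0 : 0 < d0.
Hypothesis ball_Lam : forall l, normc (l - l0) < d0 -> Lam l.
Hypothesis del_gt0 : 0 < del.
Hypothesis strict : forall j, c j = 0 \/
  (if s j then Re (l0 * c j) <= - del else del <= Re (l0 * c j)).
Hypothesis mg' : mV g'.
Hypothesis dg : forall eps, 0 < eps -> exists2 d, 0 < d & forall l, l != l0 -> normc (l - l0) < d ->
  bnd eps (fun x j => (l - l0)^-1 * (g l x j - g l0 x j) - g' x j).

Lemma family_derivable : exists f' : V, forall x j eps, 0 <= x -> 0 < eps ->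
  exists2 d, 0 < d & forall l, l != l0 -> normc (l - l0) < d ->
    normc ((l - l0)^-1 * (f l x j - f l0 x j) - f' x j) <= eps.
Proof.
have [d1 d10 H] := local; pose d := Num.min d0 d1.
have dL l : normc (l - l0) < d -> Lam l /\ normc (l - l0) < d1.
  by rewrite lt_min => /andP[/ball_Lam].
have [iQ' HQ] := dQ.
apply: (@solution_derivable R n rho cI s c Q g f l0 d K (K * (cg + 1)) del Q' g') => //.
- by rewrite lt_min d0_gt0.
- by rewrite mulr_ge0// addr_ge0.
- by move=> l /dL[Ll _]; exact: adm.
- by move=> l /dL[Ll _]; exact: iQ.
- by move=> l /dL[Ll _]; exact: mf.
- by move=> l /dL[Ll _]; exact: fsol.
- by move=> l /dL[Ll ld]; have [] := H l Ll ld.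
- by move=> l /dL[Ll ld]; have [] := H l Ll ld.
- move=> eps /HQ[d2 d20 H2]; exists d2 => // l ll0 ld; exact: (H2 l ld).2.
Qed.

End Families.

(** * Continuity and complex differentiability in terms of real radii *)

Section ComplexTopology.
Variable R : realType.
Implicit Types (f g : R[i] -> R[i]) (l : R[i]).

(** The norm of [R[i]] takes values in [R[i]]; this is the passage to real radii. *)
Lemma near_normc (l0 : R[i]) (P : set R[i]) :
  (\forall l \near l0, P l) <-> exists2 d : R, 0 < d & forall l, normc (l - l0) < d -> P l.
Proof.
split=> [/nbhs_normP[e /= e0 H]|[d d0 H]].
  exists (Re e) => [|l ld]; first by move: e0; rewrite ltcE /= => /andP[].
  apply: H; rewrite /= normcE normcB_sym.
  have -> : e = (Re e)%:C.
    by apply: complexP => //=; move: e0; rewrite ltcE /= => /andP[/eqP ->].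
  by rewrite ltcR.
apply/nbhs_normP; exists d%:C => /=; first by rewrite ltcR.
by move=> l /=; rewrite normcE ltcR normcB_sym; exact: H.
Qed.

Lemma pos_complexE (e : R[i]) : 0 < e -> e = (Re e)%:C /\ 0 < Re e.
Proof.
rewrite ltcE /= => /andP[/eqP ie re]; split => //.
by apply: complexP.
Qed.

Lemma within_continuous_normc f (A : set R[i]) :
  (forall l0, A l0 -> forall eps : R, 0 < eps -> exists2 d, 0 < d & forall l, A l ->
    normc (l - l0) < d -> normc (f l - f l0) <= eps) -> {within A, continuous f}.
Proof.
move=> H; apply/subspace_continuousP => l0 Al0; apply/cvgrPdist_le => e /pos_complexE[-> e0].
have [d d0 Hd] := H l0 Al0 _ e0.
apply/near_normc; exists d => // l ld Al.
by rewrite normcE lecR normcB_sym; exact: Hd.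
Qed.

(** Over the field of complex numbers, a derivative in the direction 1 is the complex derivative. *)
Lemma derivable_normc f l0 v :
  (forall eps : R, 0 < eps -> exists2 d, 0 < d & forall l, l != l0 -> normc (l - l0) < d ->
    normc ((l - l0)^-1 * (f l - f l0) - v) <= eps) -> derivable f l0 1.
Proof.
move=> H; apply/cvg_ex; exists v; apply/cvgrPdist_le => /= e /pos_complexE[-> e0].
have [d d0 Hd] := H _ e0.
apply/near_normc; exists d => // h; rewrite subr0 => hd /= h0.
have := Hd (h + l0); rewrite addrK -subr_eq0 addrK => /(_ h0 hd).
by rewrite normcE lecR normcB_sym [h *: 1]mulr1.
Qed.

Lemma derivable_cexp (c l : R[i]) : derivable (fun l => cexp (l * c)) l 1.
Proof.
have [->|c0] := eqVneq c 0.
  under eq_fun do rewrite mulr0 cexp0; exact: derivable_cst.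
apply: (@derivable_normc _ _ (c * cexp (l * c))) => eps eps0.
have nc : 0 < normc c by rewrite normc_gt0.
pose K := normc c ^+ 2 * expR 1 * 4 * expR (Re (l * c)) + 1.
have K1 : 0 <= normc c ^+ 2 * expR 1 * 4 * expR (Re (l * c)).
  by apply: mulr_ge0; [apply: mulr_ge0 => //; apply: mulr_ge0; [exact: sqr_ge0|exact: expR_ge0]|exact: expR_ge0].
have K0 : 0 < K by rewrite ltr_wpDl.
exists (Num.min (normc c)^-1 (eps / K)); first by rewrite lt_min invr_gt0 nc divr_gt0.
move=> m; rewrite -subr_eq0 => h0; rewrite lt_min => /andP[h1 hK].
set h := m - l in h0 h1 hK *.
have -> : h^-1 * (cexp (m * c) - cexp (l * c)) - c * cexp (l * c) =
    h^-1 * (cexp (h * c) - 1 - h * c) * cexp (l * c).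
  have -> : m * c = h * c + l * c by rewrite /h; ring.
  by rewrite cexpD; field.
have nh : 0 < normc h by rewrite normc_gt0.
rewrite normcM normc_cexp normcM.
have -> : normc h^-1 = (normc h)^-1.
  apply: (mulfI (lt0r_neq0 nh)); rewrite -normcM !mulfV ?normc1//; exact: lt0r_neq0.
have hc : normc (h * c) <= 1.
  by rewrite normcM -ler_pdivlMr// div1r ltW.
have e1 : expR (normc (h * c)) <= expR 1 by rewrite ler_expR.
have := cexp_sub1_linear (h * c); set S := normc (_ - _) => HS.
have H2 : S <= normc h ^+ 2 * normc c ^+ 2 * expR 1 * 4.
  apply: le_trans HS _; rewrite -[X in X <= _]mulr_natr ler_wpM2r//.
  rewrite normcM exprMn; apply: ler_wpM2l => //.
    by apply: mulr_ge0; exact: sqr_ge0.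
  by rewrite -normcM.
apply: (@le_trans _ _ (normc h * K)); last by rewrite -ler_pdivlMr// ltW.
apply: (@le_trans _ _ ((normc h)^-1 * (normc h ^+ 2 * normc c ^+ 2 * expR 1 * 4) * expR (Re (l * c)))).
  by rewrite ler_wpM2r ?expR_ge0// ler_wpM2l// invr_ge0 ltW.
rewrite [leLHS](_ : _ = normc h * (K - 1)); last by rewrite /K; field; exact: lt0r_neq0.
by rewrite ler_wpM2l ?gerBl// ltW.
Qed.

Lemma derivable_continuous f (A : set R[i]) : (forall l, derivable f l 1) -> {within A, continuous f}.
Proof.
move=> df; apply: continuous_subspaceT => l.
by apply: differentiable_continuous; apply/derivable1_diffP.
Qed.

Lemma within_continuous_sum (I : Type) (r : seq I) (F : I -> R[i] -> R[i]) (A : set R[i]) :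
  (forall i, {within A, continuous (F i)}) ->
  {within A, continuous (fun l => \sum_(i <- r) F i l)}.
Proof.
move=> cF; elim: r => [|i r ih].
  under eq_fun do rewrite big_nil; move=> l; exact: cvg_cst.
by under eq_fun do rewrite big_cons; move=> l; apply: cvgD; [exact: cF|exact: ih].
Qed.

End ComplexTopology.

(** * The forward equation for large parameters and for large base points *)

Section ForwardEquation.
Variables (R : realType) (n : nat) (rho : R -> R).
Let mu : {measure set (measurableTypeR R) -> \bar R} := lebesgue_measure.
Let D0 : set (measurableTypeR R) := `[0%R, +oo[%classic.
Let mD0 : measurable D0 := @measurable_0y R.
Let V := R -> 'I_n -> R[i].
Let Mx := R -> 'M[R[i]]_n.
Hypothesis cI : cond_I rho.
Variables (b : 'I_n -> R[i]) (A : Mx) (a N : R) (Mh : Mx).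
Hypothesis a_ge0 : 0 <= a.
Hypothesis iA : L1mx A.
Hypothesis mM : forall j k, cmeas D0 (fun x => Mh x j k).
Hypothesis mN : forall j k, cmeas D0 (fun x => invmx (Mh x) j k).
Hypothesis bM : forall (x : R) j k, 0 <= x -> normc (Mh x j k) <= N.
Hypothesis bN : forall (x : R) j k, 0 <= x -> normc (invmx (Mh x) j k) <= N.
Hypothesis blockM : forall (x : R) j k, 0 <= x -> b j != b k -> Mh x j k = 0.
Hypothesis blockN : forall (x : R) j k, 0 <= x -> b j != b k -> invmx (Mh x) j k = 0.

Definition ordered (l : R[i]) : Prop :=
  forall j k : 'I_n, (j <= k)%N -> Re (l * b k) <= Re (l * b j).

Let AD : Mx := fun t => A t - Dmx b A t.
Let Q0 : Mx := conj_by a Mh AD.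
Let c (k j : 'I_n) : R[i] := b j - b k.
Let Q (X : Mx) : Mx := conj_by a Mh (fun t => AD t + X t).
Let T l k (X : Mx) : V -> V := Top rho (direction k) (fun j => l * c k j) (Q X).

Lemma L1mx_AD : L1mx AD.
Proof. by apply: L1mxB => //; exact: L1mx_Dmx. Qed.

Let iQ0 : L1mx Q0. Proof. exact: (L1mx_conj_by a mM mN bM bN L1mx_AD). Qed.

Let iQc X : L1mx X -> L1mx (conj_by a Mh X). Proof. exact: (L1mx_conj_by a mM mN bM bN). Qed.

Let iQ X : L1mx X -> L1mx (Q X).
Proof. by move=> iX; apply: iQc; apply: L1mxD => //; exact: L1mx_AD. Qed.

Let QE X : Q X = (fun t => Q0 t + conj_by a Mh X t).
Proof. by apply/funext => t; rewrite -conj_byD. Qed.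

(** In the double sum for the entry (j, m) the blocks of the frame leave only terms with b_j = b_i
    and b_l = b_m. Together with b_j = b_m this gives b_i = b_l, where A - D vanishes. *)
Lemma conj_by_block t j m : b j = b m -> Q0 t j m = 0.
Proof.
move=> bjm; have [ta|ta] := ltP t a; first by rewrite /Q0 conj_by_lt// mxE.
have t0 := le_trans a_ge0 ta.
rewrite /Q0 conj_byE big1 ?mulr0// => l _; rewrite big1// => i _.
have [bil|bil] := eqVneq (b i) (b l); first by rewrite /AD !mxE bil eqxx subrr mulr0.
have [bji|bji] := eqVneq (b j) (b i); last by rewrite blockN// !mul0r.
by rewrite blockM ?mulr0 ?mul0r// -bjm bji eq_sym.
Qed.

Lemma ordered_admissible l k : ordered l -> admissible (direction k) (fun j => l * c k j).
Proof.
move=> ord j; rewrite /direction /c mulrBr ReB; case: leqP => kj.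
  by rewrite subr_le0 ord.
by rewrite subr_ge0 ord// ltnW.
Qed.

(** The only nonzero component has the phase c k k = 0, for which constants are solutions. *)
Lemma unit_solves_scalar l k : solves_scalar rho (c k) l (@unitV R n k) (fun _ _ => 0).
Proof.
move=> m; exists (fun=> (m == k)%:R); split => //.
apply: ACder_eq (ACder_cst _) _ => x _.
by rewrite /c; case: eqP => [->|_] /=; ring.
Qed.

Lemma bnd_unitV k : bnd 1 (@unitV R n k).
Proof. by move=> x _ j; rewrite /unitV mul1r; case: (j == k); rewrite ?normc1 ?normc0. Qed.

Lemma mV_unitV k : mV (@unitV R n k). Proof. by move=> j; exact: cmeas_cst. Qed.

Let osc_all eps : 0 < eps -> exists r, forall l k, r < normc l -> ordered l ->
  osc_small rho (direction k) (c k) l Q0 eps.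
Proof.
move=> eps0.
have H k : exists r, forall l, r < normc l -> admissible (direction k) (fun j => l * c k j) ->
    osc_small rho (direction k) (c k) l Q0 eps.
  apply: osc_Top => // j m; rewrite /c => /addIr bjm t; exact: conj_by_block.
exists (\sum_k `|projT1 (cid (H k))|) => l k rl ord.
apply: (projT2 (cid (H k))); last exact: ordered_admissible.
apply: le_lt_trans rl; rewrite (bigD1 k)//= (le_trans (ler_norm _))// lerDl sumr_ge0//.
Qed.

(** The route for large [a]: the operator itself contracts because its mass is small. *)
Lemma half_of_mass l k X : ordered l -> L1mx X -> mass (Q X) <= 2^-1 ->
  forall f B, mV f -> bnd B f -> 0 <= B -> bnd (B / 2) (T l k X (T l k X f)).
Proof.
move=> ord iX mQ f B mf bf B0; have ad := ordered_admissible k ord.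
have m0 := mass_ge0 (Q X).
have b1 := Top_bnd cI ad B0 (iQ iX) mf bf.
have := Top_bnd cI ad _ (iQ iX) (Top_mV cI ad (iQ iX) mf bf) b1.
rewrite mulr_ge0// => /(_ isT); apply: bnd_weaken.
apply: (@le_trans _ _ (2^-1 * (1 * B))); last by rewrite mul1r mulrC.
apply: ler_pM => //; first by rewrite mulr_ge0.
by rewrite ler_wpM2r// (le_trans mQ)// invf_le1// ler1n.
Qed.

Let massQ X : L1mx X -> mass (Q X) <= mass Q0 + mass (conj_by a Mh X).
Proof. by move=> iX; rewrite QE; exact: (massD iQ0 (iQc iX)). Qed.

Let small_conj e : 0 < e -> exists2 d, 0 < d & forall X, L1mx X -> mass X <= d ->
  mass (conj_by a Mh X) <= e.
Proof.
move=> e0; have C0 : 0 < (n%:R * N) ^+ 2 + 1 by rewrite ltr_wpDl// sqr_ge0.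
exists (e / ((n%:R * N) ^+ 2 + 1)); first exact: divr_gt0.
move=> X iX mX; apply: le_trans (mass_conj_by a mM mN bM bN iX) _.
apply: (@le_trans _ _ (((n%:R * N) ^+ 2 + 1) * mass X)).
  apply: ler_pM; rewrite ?sqr_ge0 ?mass_ge0//; first by rewrite lerDl.
  by apply: mass_cut => //; exact: measurable_itv.
by rewrite mulrC -ler_pdivlMr.
Qed.

(** The route for fixed [a]: [Q0] oscillates and the conjugate of [X] is small. With e = 1 / (4
    (mass Q0 + 1)) the bound of [Top_square] becomes 2 e (mass Q0 + 1) = 1/2. *)
Lemma half_of_large : exists r d : R, 0 < d /\ forall l k X, r < normc l -> ordered l ->
  L1mx X -> mass X <= d ->
  forall f B, mV f -> bnd B f -> 0 <= B -> bnd (B / 2) (T l k X (T l k X f)).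
Proof.
have m0 := mass_ge0 Q0.
pose e : R := (4 * (mass Q0 + 1))^-1.
have mq : 0 < mass Q0 + 1 by rewrite ltr_wpDl.
have e0 : 0 < e by rewrite invr_gt0 mulr_gt0.
have e1 : e <= 1.
  rewrite invf_le1 ?mulr_gt0//; lra.
have [r Hr] := osc_all e0; have [d d0 Hd] := small_conj e0.
exists r, d; split => // l k X rl ord iX mX f B mf bf B0.
have ad := ordered_admissible k ord.
have := Top_square cI ad iQ0 (iQc iX) (Hr l k rl ord) mf bf B0; rewrite /T QE.
apply: bnd_weaken; have mc := Hd X iX mX; have c0 := mass_ge0 (conj_by a Mh X).
have := massQ iX; rewrite QE => mQ.
apply: (@le_trans _ _ ((e + e) * ((mass Q0 + 1) * B))).
  apply: ler_pM; rewrite ?addr_ge0 ?mulr_ge0 ?mass_ge0 ?(ltW e0)//.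
    by rewrite lerD2l.
  by rewrite ler_wpM2r// (le_trans mQ)// lerD2l (le_trans mc).
rewrite le_eqVlt; apply/orP; left; apply/eqP; rewrite /e; field.
by rewrite lt0r_neq0.
Qed.

Lemma Top_ext s e0 (Q1 : Mx) (f g : V) : (forall x, 0 <= x -> forall j, f x j = g x j) ->
  forall x, 0 <= x -> forall j, Top rho s e0 Q1 f x j = Top rho s e0 Q1 g x j.
Proof.
move=> fg x x0 j; rewrite /Top /Kop; congr (_ * _); apply: eq_cint => t /(JsetP x0)[t0 _].
by congr (_ * _); apply: eq_bigr => m _; rewrite fg.
Qed.

(* [z - e_k = T e_k + T (T z)], and [T e_k] oscillates as well as [T (T z)]
   because [e_k] solves the scalar equations with phases [c k] trivially. *)
Lemma forward_asymptotics eps : 0 < eps -> exists r d : R, 0 < d /\ forall l k X z,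
  r < normc l -> ordered l -> L1mx X -> mass X <= d ->
  mV z -> bnd ((1 + mass (Q X)) * 2) z -> solves_eq (T l k X) z (@unitV R n k) ->
  forall x j, 0 <= x -> normc (z x j - (j == k)%:R) <= eps.
Proof.
move=> eps0; have m0 := mass_ge0 Q0.
(* T e_k contributes 2 e, and T (T z) contributes 2 e times bounds for the mass and for z; the sum
   is 2 e Z. *)
pose Z := 1 + (mass Q0 + 1) * ((1 + (mass Q0 + 1)) * 2).
have Z1 : 0 < Z by rewrite ltr_wpDr// !mulr_ge0 ?addr_ge0.
pose e := Num.min 1 (eps / (2 * Z)).
have e0 : 0 < e by rewrite lt_min ltr01 divr_gt0// mulr_gt0.
have [r Hr] := osc_all e0; have [d d0 Hd] := small_conj e0.
exists r, d; split => // l k X z rl ord iX mX mz bz zsol x j x0.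
have ad := ordered_admissible k ord; have gk := good_expker cI ad.
have mc := Hd X iX mX; have c0 := mass_ge0 (conj_by a Mh X).
have mc1 : mass (conj_by a Mh X) <= 1 by rewrite (le_trans mc)// ge_min lexx.
have mQ : mass (Q X) <= mass Q0 + 1 by rewrite (le_trans (massQ iX))// lerD2l.
have q0 := mass_ge0 (Q X).
have K0 : 0 <= (1 + mass (Q X)) * 2 by rewrite mulr_ge0 ?addr_ge0.
have os := Hr l k rl ord.
have sub y : 0 <= y -> forall i, subV z (@unitV R n k) y i = T l k X z y i.
  by move=> y0 i; rewrite /subV zsol// addrC addKr.
have E : z x j - (j == k)%:R = T l k X (unitV k) x j + T l k X (T l k X z) x j.
  rewrite -[LHS]/(subV z (unitV k) x j) sub// -[T l k X (T l k X z) x j](Top_ext _ _ _ sub x0).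
  have := Kop_sub j gk (iQ iX) mz (@mV_unitV k) bz (@bnd_unitV k) x0.
  by rewrite -/(Top _ _ _ _ _ _) => ->; rewrite addrC subrK.
rewrite E; apply: le_trans (le_normcD _ _) _.
have h1 : normc (T l k X (unitV k) x j) <= e + e.
  rewrite /T QE (Top_Qadd cI j ad iQ0 (iQc iX) (@mV_unitV k) (@bnd_unitV k) x0).
  apply: le_trans (le_normcD _ _) _; apply: lerD.
    have := os (unitV k) (fun _ _ => 0) 1 (@mV_unitV k) (unit_solves_scalar l k) _ _ (@bnd_unitV k) x x0 j.
    rewrite !mulr1; apply => m; first exact: cintegrable0.
    by rewrite /Rintegral (eq_integral (fun=> 0%E)) ?integral0// => t _; rewrite normc0.
  have := Top_bnd cI ad ler01 (iQc iX) (@mV_unitV k) (@bnd_unitV k) x0 j.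
  by rewrite !mulr1 => /le_trans; apply.
have h2 : normc (T l k X (T l k X z) x j) <= (e + e) * ((mass Q0 + 1) * ((1 + (mass Q0 + 1)) * 2)).
  have := Top_square cI ad iQ0 (iQc iX) os mz bz K0 x0 j.
  rewrite mulr1 -QE; move=> H; apply: le_trans H _.
  apply: ler_pM.
  - exact: addr_ge0 (ltW e0) c0.
  - exact: mulr_ge0 q0 K0.
  - by rewrite lerD2l.
  - by apply: (ler_pM q0 K0 mQ); rewrite ler_wpM2r// lerD2l.
apply: le_trans (lerD h1 h2) _.
rewrite [leLHS](_ : _ = e * (2 * Z)); last by rewrite /Z; ring.
by rewrite -ler_pdivlMr ?mulr_gt0// ge_min lexx orbT.
Qed.

End ForwardEquation.

Section FiniteMinimum.
Variable R : realType.

(** The 1 in the witness 1 / (1 + sum of the 1 / F_j) covers the empty family. *)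
Lemma finite_lower_bound (n : nat) (F : 'I_n -> R) : (forall j, 0 < F j) ->
  exists2 d, 0 < d & forall j, d <= F j.
Proof.
move=> F0; have S0 : 0 <= \sum_j (F j)^-1 by apply: sumr_ge0 => j _; rewrite invr_ge0 ltW.
exists (1 + \sum_j (F j)^-1)^-1; first by rewrite invr_gt0 ltr_wpDr.
move=> j; rewrite -[leRHS]invrK lef_pV2 ?posrE ?invr_gt0 ?ltr_wpDr//.
rewrite (bigD1 j)//= addrCA lerDl addr_ge0// sumr_ge0// => i _.
by rewrite invr_ge0 ltW.
Qed.

Lemma finite_radius (n : nat) (l0 : R[i]) (P : 'I_n -> R[i] -> Prop) :
  (forall j, exists2 d : R, 0 < d & forall l, normc (l - l0) < d -> P j l) ->
  exists2 d : R, 0 < d & forall l, normc (l - l0) < d -> forall j, P j l.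
Proof.
move=> H; apply/near_normc.
have K j : \forall l \near l0, P j l by apply/near_normc; exact: H.
exact: (filter_forall _ K).
Qed.

End FiniteMinimum.

Section BackwardFamily.
Variables (R : realType) (n : nat) (rho : R -> R).
Let Mx := R -> 'M[R[i]]_n.
Hypothesis cI : cond_I rho.
Variables (b : 'I_n -> R[i]) (A : Mx) (a : R).
Hypothesis iA : L1mx A.

Definition backward_coefficients (l : R[i]) (X : Mx) : Mx :=
  cut `]-oo, a[%classic (coefficients rho b A l X).

Lemma L1mx_backward l X : L1mx X -> L1mx (backward_coefficients l X).
Proof. by move=> iX; apply: L1mx_cut_cloc => j m; exact: cloc_coefficients. Qed.

(** In the forward equation l F is absorbed into the exponentials; here l enters the coefficients
    linearly, and the derivative gains the term F, integrable thanks to the cut at [a]. *)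
Lemma L1_derivative_backward (CC : R[i] -> Mx) (C' : Mx) l0 : L1_derivative CC C' l0 ->
  L1_derivative (fun l => backward_coefficients l (CC l))
    (cut `]-oo, a[%classic (fun t => Fmx rho b t + C' t)) l0.
Proof.
move=> dC; have [i' H] := dC; have i0 := L1_derivative_at dC.
have mI : measurable (`]-oo, a[%classic : set (measurableTypeR R)) by exact: measurable_itv.
split.
  apply: L1mx_cut_cloc => j m.
  have i00 : @L1mx R n (fun=> 0).
    move=> u v; have -> : (fun t : R => (0 : 'M[R[i]]_n) u v) = (fun=> 0) by apply/funext => t; rewrite mxE.
    exact: cintegrable0.
  apply: (eq_cloc (f := fun t => coefficients rho b (fun=> 0) 1 C' t j m)).
    by move=> x _; rewrite /coefficients !mxE mul1r addr0.
  exact: cloc_coefficients.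
move=> eps eps0; have [d d0 Hd] := H eps eps0.
exists d => // l ld; have [il Hl] := Hd l ld; split; first exact: L1mx_backward.
move=> ll0; apply: le_trans (Hl ll0).
have iq := L1mxB (L1mx_quotient il i0) i'.
apply: le_trans (mass_cut mI iq).
rewrite le_eqVlt; apply/orP; left; apply/eqP; congr mass.
apply/funext => t; apply/matrixP => j m.
rewrite /quotient /backward_coefficients /cut /coefficients !mxE.
have h0 : l - l0 != 0 by rewrite subr_eq0.
by field.
Qed.

End BackwardFamily.

(** * Assembling the fundamental system; [Lam] is the closed truncated sector and [Om] the open
    one *)

Section Construction.
Variables (R : realType) (n : nat) (rho : R -> R).
Let mu : {measure set (measurableTypeR R) -> \bar R} := lebesgue_measure.
Let D0 : set (measurableTypeR R) := `[0%R, +oo[%classic.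
Let V := R -> 'I_n -> R[i].
Let Mx := R -> 'M[R[i]]_n.
Let p := primitive rho.
Hypothesis n_gt0 : (0 < n)%N.
Hypothesis cI : cond_I rho.
Variables (b : 'I_n -> R[i]) (A : Mx) (CC : R[i] -> Mx) (a N : R) (M Mh : Mx).
Variables (Lam Om : set R[i]).
Hypothesis a_ge0 : 0 <= a.
Hypothesis iA : L1mx A.
Hypothesis MA : is_Malpha b A a M.
Hypothesis MhM : forall x : R, a <= x -> Mh x = M x.
Hypothesis uMh : forall x : R, 0 <= x -> Mh x \in unitmx.
Hypothesis mM : forall j k, cmeas D0 (fun x => Mh x j k).
Hypothesis mN : forall j k, cmeas D0 (fun x => invmx (Mh x) j k).
Hypothesis bM : forall (x : R) j k, 0 <= x -> normc (Mh x j k) <= N.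
Hypothesis bN : forall (x : R) j k, 0 <= x -> normc (invmx (Mh x) j k) <= N.
Hypothesis blockM : forall (x : R) j k, 0 <= x -> b j != b k -> Mh x j k = 0.
Hypothesis blockN : forall (x : R) j k, 0 <= x -> b j != b k -> invmx (Mh x) j k = 0.
Hypothesis Lam0 : forall l, Lam l -> l != 0.
Hypothesis Lam_ord : forall l, Lam l -> ordered b l.
Hypothesis Om_ball : forall l0, Om l0 -> exists2 d : R, 0 < d & forall l, normc (l - l0) < d -> Lam l.
Hypothesis Om_off : forall l, Om l -> forall j k, b j != b k -> Re (l * b j) != Re (l * b k).
Hypothesis dC : forall l, l != 0 -> exists C', L1_derivative CC C' l.

Let AD : Mx := fun t => A t - Dmx b A t.
Let c (k j : 'I_n) : R[i] := b j - b k.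
Let Q l : Mx := conj_by a Mh (fun t => AD t + CC l t).
Let T l k : V -> V := Top rho (direction k) (fun j => l * c k j) (Q l).
Hypothesis half : forall l k, Lam l ->
  forall f B, mV f -> bnd B f -> 0 <= B -> bnd (B / 2) (T l k (T l k f)).
Hypothesis small_C : forall d : R, 0 < d -> exists r : R, forall l, l != 0 -> r < normc l ->
  mass (CC l) <= d.

Let iC l : l != 0 -> L1mx (CC l).
Proof. by move=> /dC[C' /L1_derivative_at]. Qed.

Let iQ l : Lam l -> L1mx (Q l).
Proof.
move=> /Lam0 /iC iCl; apply: (L1mx_conj_by a mM mN bM bN).
by apply: L1mxD => //; exact: L1mx_AD.
Qed.

Let adm l k : Lam l -> admissible (direction k) (fun j => l * c k j).
Proof. by move=> /Lam_ord; exact: ordered_admissible. Qed.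

Let Kf (m : R) : R := (1 + m) * 2.

Let Tsol l k : Lam l -> solvable (T l k) (Kf (mass (Q l))).
Proof. by move=> Ll; apply: Top_solvable; [exact: cI|exact: adm|exact: iQ|exact: half]. Qed.

(** Conditional on [Lam l], so that solutions can be chosen for all [l] at once; outside [Lam] any
    function will do. *)
Let z_spec l k (z : V) : Prop := Lam l ->
  [/\ mV z, solves_eq (T l k) z (unitV k) & bnd (Kf (mass (Q l))) z].

Let z_ex l k : exists z, z_spec l k z.
Proof.
have [Ll|nLl] := pselect (Lam l); last by exists (fun _ _ => 0) => /nLl.
have [z [mz sz bz]] := (Tsol k Ll).1 (unitV k) 1 (@mV_unitV R n k) (@bnd_unitV R n k).
by exists z => _; split => //; rewrite mulr1 in bz.
Qed.

Let z l k : V := projT1 (cid (z_ex l k)).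
Let zP l k : z_spec l k (z l k). Proof. exact: projT2 (cid (z_ex l k)). Qed.

Let e0 : 'I_n -> R[i] := fun=> 0.
(** The phase is zero, written as a multiple of [l] to match the shape of the families in the
    parameter. *)
Let Tb l : V -> V := Top rho (fun=> false) (fun j => l * e0 j) (backward_coefficients rho b A a l (CC l)).
Let g l k : V := fun _ j => z l k a j.

Let TbE l : Tb l = Top rho (fun=> false) (fun=> 0) (backward_coefficients rho b A a l (CC l)).
Proof.
have E : (fun j => l * e0 j) = (fun=> 0) by apply/funext => j; rewrite mulr0.
by rewrite /Tb E.
Qed.

Let iQb l : Lam l -> L1mx (backward_coefficients rho b A a l (CC l)).
Proof. by move=> /Lam0/iC; exact: L1mx_backward. Qed.

Let Kb (m : R) : R := (1 + 2^-1) * 2 * expR (2 * m).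

Let Tbsol l : Lam l -> solvable (Tb l) (Kb (mass (backward_coefficients rho b A a l (CC l)))).
Proof. by move=> Ll; rewrite TbE; apply: volterra_solvable => //; exact: iQb. Qed.

Let bg l k : Lam l -> bnd (Kf (mass (Q l))) (g l k).
Proof. by move=> /(zP k)[_ _ bz] x _ j; exact: (bz a a_ge0 j). Qed.

Let f_spec l k (f : V) : Prop := Lam l ->
  [/\ mV f, solves_eq (Tb l) f (g l k) & exists B, bnd B f].

Let f_ex l k : exists f, f_spec l k f.
Proof.
have [Ll|nLl] := pselect (Lam l); last by exists (fun _ _ => 0) => /nLl.
have [|f [mf sf bf]] := (Tbsol Ll).1 (g l k) _ _ (bg k Ll).
  by move=> j; exact: cmeas_cst.
by exists f => _; split => //; exists (Kb (mass (backward_coefficients rho b A a l (CC l))) * Kf (mass (Q l))).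
Qed.

Let f l k : V := projT1 (cid (f_ex l k)).
Let fP l k : f_spec l k (f l k). Proof. exact: projT2 (cid (f_ex l k)). Qed.

Let col_ l k : V := glued rho b a M l k (z l k) (f l k).
Let Y (x : R) (l : R[i]) : 'M[R[i]]_n := \matrix_(j, k) col_ l k x j.

Let YE j k x l : Y x l j k = col_ l k x j. Proof. by rewrite mxE. Qed.

Let col_ACder l k j : Lam l ->
  ACder (fun x => col_ l k x j) (fun x => row_mul (coefficients rho b A l (CC l)) (col_ l k) x j).
Proof.
move=> Ll; have [mz sz bz] := zP k Ll; have [mf sf [B bf]] := fP k Ll.
rewrite TbE in sf.
apply: (ACder_glued cI a_ge0 iA MA MhM uMh blockM (iC (Lam0 Ll)) (adm k Ll) (iQ Ll) mz bz sz _ mf bf sf).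
exact: iQb.
Qed.

Let Y_initial l : Lam l -> forall j k : 'I_n, (k <= j)%N -> Y a l j k = (j == k)%:R.
Proof.
move=> Ll j k kj; have [mz sz bz] := zP k Ll.
by rewrite YE /col_ (glued_start _ MA) (forward_initial a_ge0 sz kj).
Qed.

Let Y_solves l : Lam l -> solves (coefficients rho b A l (CC l)) (fun x => Y x l).
Proof.
move=> Ll; have YEf j k : (fun x => Y x l j k) = (fun x => col_ l k x j).
  by apply/funext => x; rewrite YE.
split=> [T0 j k T00|]; first by rewrite YEf; exact: (col_ACder k j Ll).1.
have H (jk : 'I_n * 'I_n) : {ae mu, forall x : R, 0 <= x ->
    has_cderiv (fun t => Y t l jk.1 jk.2) x ((coefficients rho b A l (CC l) x *m Y x l) jk.1 jk.2)}.
  case: jk => j k /=; have := (col_ACder k j Ll).2.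
  apply: (@filterS _ _ (ae_filter_ringOfSetsType mu)) => x dx x0; rewrite YEf.
  apply: has_cderiv_eq (dx x0) _.
  by rewrite mxE; apply: eq_bigr => m _; rewrite YE.
have := @filter_forall _ _ _ _ (ae_filter_ringOfSetsType mu) H.
apply: (@filterS _ _ (ae_filter_ringOfSetsType mu)) => x dx x0 j k.
exact: (dx (j, k)).
Qed.

(** At [a] the matrix is upper triangular with unit diagonal, hence invertible, and independence at
    one point suffices. *)
Let Y_fundamental l : Lam l -> fundamental_system (coefficients rho b A l (CC l)) (fun x => Y x l).
Proof.
move=> Ll; split; first exact: Y_solves.
move=> v Yv; have init := Y_initial Ll.
have dY : \det (Y a l) = 1.
  rewrite -det_tr det_trig.
    by apply: big1 => i _; rewrite mxE init// eqxx.
  apply/is_trig_mxP => i j ij; rewrite mxE init 1?ltnW//.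
  by case: eqP => // ji; rewrite ji ltnn in ij.
have uY : Y a l \in unitmx by rewrite unitmxE dY unitr1.
by rewrite -[v](mulKmx uY) Yv// mulmx0.
Qed.

(** The deviation of the k-th solution z from e_k, multiplied by M. *)
Let s_ x l : 'M[R[i]]_n := \matrix_(j, k) \sum_m M x j m * (z l k x m - (m == k)%:R).

Let Y_form j k x l : a <= x -> Lam l ->
  Y x l j k = cexp (l * b k * (p x - p a)%:C) * (M x j k + s_ x l j k).
Proof.
move=> ax Ll; rewrite YE /col_ /glued ax /forward; congr (_ * _).
rewrite mxE; under [X in _ = _ + X]eq_bigr do rewrite mulrBr.
rewrite sumrB [X in _ = _ + (_ - X)](bigD1 k)//= eqxx mulr1.
rewrite [X in _ = _ + (_ - (_ + X))]big1 ?addr0; first by ring.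
by move=> m /negbTE ->; rewrite mulr0.
Qed.

Let s_small j k (e : R) : 0 < e -> exists r : R, forall l, Lam l -> r < normc l ->
  forall x, a <= x -> normc (s_ x l j k) < e.
Proof.
move=> e_gt0; have N0 : 0 <= N by apply: le_trans (bM j j a_ge0); exact: normc_ge0.
have nN : 0 < n%:R * N + 1 by rewrite ltr_wpDl// mulr_ge0.
(* The row sums of M are at most n N; the rest of the denominator keeps it positive and the final
   inequality strict. *)
have e1 : 0 < e / (2 * (n%:R * N + 1)) by rewrite divr_gt0// mulr_gt0.
have [r [d [d0 H]]] := forward_asymptotics cI a_ge0 iA mM mN bM bN blockM blockN e1.
have [r' H'] := small_C d0.
exists (Num.max r r') => l Ll; rewrite gt_max => /andP[rl r'l] x ax.
have x0 := le_trans a_ge0 ax; have l0 := Lam0 Ll.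
have [mz sz bz] := zP k Ll.
have Hz := H l k (CC l) (z l k) rl (Lam_ord Ll) (iC l0) (H' l l0 r'l) mz bz sz x.
rewrite mxE; apply: le_lt_trans (normc_sum _ _ _) _.
apply: (@le_lt_trans _ _ (\sum_(m < n) N * (e / (2 * (n%:R * N + 1))))).
  apply: ler_sum => m _; rewrite normcM; apply: ler_pM; rewrite ?normc_ge0//.
    by rewrite -MhM// bM.
  exact: Hz.
rewrite sumr_const card_ord -[_ *+ n]mulr_natl mulrA mulrA ltr_pdivrMr ?mulr_gt0//.
rewrite mulrC ltr_pM2l//; have : 0 <= n%:R * N by rewrite mulr_ge0.
by lra.
Qed.

Let dQ l : l != 0 -> exists Q', L1_derivative Q Q' l.
Proof.
move=> /dC[C' dC']; exists (conj_by a Mh C').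
apply: (L1_derivative_conj a mM mN bM bN).
by apply: L1_derivative_shift => //; exact: L1mx_AD.
Qed.

Let Kf_mono x y : 0 <= x -> x <= y -> 0 <= Kf x <= Kf y.
Proof. by move=> x0 xy; rewrite /Kf; apply/andP; split; lra. Qed.

Let Kb_mono x y : 0 <= x -> x <= y -> 0 <= Kb x <= Kb y.
Proof.
move=> x0 xy; rewrite /Kb; have c0 : 0 <= (1 + 2^-1) * 2 :> R by lra.
by rewrite mulr_ge0 ?expR_ge0//= ler_wpM2l// ler_expR ler_wpM2l.
Qed.

Let z_continuous l0 k : Lam l0 -> forall x j eps, 0 <= x -> 0 < eps -> exists2 d : R, 0 < d &
  forall l, Lam l -> normc (l - l0) < d -> normc (z l k x j - z l0 k x j) <= eps.
Proof.
move=> Ll0; have [Q' dQ'] := dQ (Lam0 Ll0).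
apply: (family_continuous cI (g := fun=> unitV k) (f := fun l => z l k) (s := direction k)
  (c := c k) (Kf := Kf) n_gt0 Ll0 _ iQ dQ' Kf_mono _ _ _ _ _ (@bnd_unitV R n k)).
- by move=> l; exact: adm.
- by move=> l; exact: Tsol.
- by move=> l /(zP k)[].
- by move=> l _; exact: mV_unitV.
- by move=> l /(zP k)[].
- by move=> l /(zP k)[_ _ bz]; exists (Kf (mass (Q l))).
- by move=> eps eps0; exists 1 => // l _ _ x _ j; rewrite /subV subrr normc0 mulr1 ltW.
Qed.

Let g_continuous l0 k : Lam l0 -> forall eps, 0 < eps -> exists2 d : R, 0 < d &
  forall l, Lam l -> normc (l - l0) < d -> bnd eps (subV (g l k) (g l0 k)).
Proof.
move=> Ll0 eps eps0.
have H j : exists2 d : R, 0 < d & forall l, normc (l - l0) < d -> Lam l ->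
    normc (z l k a j - z l0 k a j) <= eps.
  have [d d0 Hd] := z_continuous k Ll0 j a_ge0 eps0.
  by exists d => // l ld Ll; exact: Hd.
have [d d0 Hd] := finite_radius H; exists d => // l Ll ld x _ j.
by rewrite mulr1; exact: Hd.
Qed.

Let dQb l : l != 0 ->
  exists Q', L1_derivative (fun l => backward_coefficients rho b A a l (CC l)) Q' l.
Proof.
move=> /dC[C' dC']; exists (cut `]-oo, a[%classic (fun t => Fmx rho b t + C' t)).
exact: L1_derivative_backward.
Qed.

Let f_continuous l0 k : Lam l0 -> forall x j eps, 0 <= x -> 0 < eps -> exists2 d : R, 0 < d &
  forall l, Lam l -> normc (l - l0) < d -> normc (f l k x j - f l0 k x j) <= eps.
Proof.
move=> Ll0; have [Q' dQ'] := dQb (Lam0 Ll0).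
apply: (family_continuous cI (g := fun l => g l k) (f := fun l => f l k) (s := fun=> false)
  (c := e0) (Kf := Kb) n_gt0 Ll0 _ iQb dQ' Kb_mono Tbsol _ _ _ _ (bg k Ll0)).
- by move=> l _ j; rewrite /= /e0 mulr0.
- by move=> l /(fP k)[].
- by move=> l _ j; exact: cmeas_cst.
- by move=> l /(fP k)[].
- by move=> l /(fP k)[].
- exact: g_continuous.
Qed.

Let z_derivable l0 k : Om l0 -> exists z' : V, forall x j eps, 0 <= x -> 0 < eps ->
  exists2 d : R, 0 < d & forall l, l != l0 -> normc (l - l0) < d ->
    normc ((l - l0)^-1 * (z l k x j - z l0 k x j) - z' x j) <= eps.
Proof.
move=> Ol0; have [d d0 ball] := Om_ball Ol0.
have Ll0 : Lam l0 by apply: ball; rewrite subrr normc0.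
have [Q' dQ'] := dQ (Lam0 Ll0).
(* In the open sector Re(l0 b_j) and Re(l0 b_k) are distinct whenever b_j and b_k are; a positive
   lower bound of the finitely many gaps is the decay rate. *)
have [del del0 strict] : exists2 del : R, 0 < del & forall j, c k j = 0 \/
    (if direction k j then Re (l0 * c k j) <= - del else del <= Re (l0 * c k j)).
  have H j : exists del : R, 0 < del /\ forall del', del' <= del -> c k j = 0 \/
    (if direction k j then Re (l0 * c k j) <= - del' else del' <= Re (l0 * c k j)).
    have [bjk|bjk] := eqVneq (b j) (b k); first by exists 1; split => // ? _; left; rewrite /c bjk subrr.
    have := Om_off Ol0 bjk; have := adm k Ll0 j; rewrite /c mulrBr ReB.
    case: (direction k j) => h1 h2.
      exists (Re (l0 * b k) - Re (l0 * b j)); split.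
        by rewrite subr_gt0 lt_neqAle h2 -subr_le0.
      by move=> del' hd; right; lra.
    exists (Re (l0 * b j) - Re (l0 * b k)); split.
      by rewrite subr_gt0 lt_neqAle eq_sym h2 -subr_ge0.
    by move=> del' hd; right.
  have [del del0 Hdel] := finite_lower_bound (fun j => (projT2 (cid (H j))).1).
  by exists del => // j; exact: (projT2 (cid (H j))).2.
apply: (family_derivable cI (g := fun=> unitV k) (f := fun l => z l k) (s := direction k)
  (c := c k) (Kf := Kf) n_gt0 Ll0 _ iQ dQ' Kf_mono _ _ _ _ _ (@bnd_unitV R n k) _
  (g' := fun _ _ => 0) d0 ball del0 strict).
- by move=> l; exact: adm.
- by move=> l; exact: Tsol.
- by move=> l /(zP k)[].
- by move=> l _; exact: mV_unitV.
- by move=> l /(zP k)[].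
- by move=> l /(zP k)[_ _ bz]; exists (Kf (mass (Q l))).
- by move=> eps eps0; exists 1 => // l _ _ x _ j; rewrite /subV subrr normc0 mulr1 ltW.
- by move=> j; exact: cmeas_cst.
- move=> eps eps0; exists 1 => // l _ _ x _ j.
  by rewrite subrr mulr0 subr0 normc0 mulr1 ltW.
Qed.

(** The parameter enters through the coefficients and through the matching value z(a), whose
    derivative is known by now. The phases being zero, the decay condition holds trivially, and the
    rate is set to 1. *)
Let f_derivable l0 k : Om l0 -> exists f' : V, forall x j eps, 0 <= x -> 0 < eps ->
  exists2 d : R, 0 < d & forall l, l != l0 -> normc (l - l0) < d ->
    normc ((l - l0)^-1 * (f l k x j - f l0 k x j) - f' x j) <= eps.
Proof.
move=> Ol0; have [d d0 ball] := Om_ball Ol0.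
have Ll0 : Lam l0 by apply: ball; rewrite subrr normc0.
have [Q' dQ'] := dQb (Lam0 Ll0); have [z' Hz] := z_derivable k Ol0.
apply: (family_derivable cI (g := fun l => g l k) (f := fun l => f l k) (s := fun=> false)
  (c := e0) (Kf := Kb) n_gt0 Ll0 _ iQb dQ' Kb_mono Tbsol _ _ _ _ (bg k Ll0) _
  (g' := fun _ j => z' a j) d0 ball ltr01).
- by move=> l _ j; rewrite /= /e0 mulr0.
- by move=> l /(fP k)[].
- by move=> l _ j; exact: cmeas_cst.
- by move=> l /(fP k)[].
- by move=> l /(fP k)[].
- exact: g_continuous.
- by move=> j; left.
- by move=> j; exact: cmeas_cst.
- move=> eps eps0.
  have H j : exists2 d : R, 0 < d & forall l, normc (l - l0) < d -> l != l0 ->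
      normc ((l - l0)^-1 * (z l k a j - z l0 k a j) - z' a j) <= eps.
    have [d1 d10 Hd] := Hz a j eps a_ge0 eps0.
    by exists d1 => // l ld Ll; exact: Hd.
  have [d1 d10 Hd] := finite_radius H; exists d1 => // l ll0 ld x _ j.
  by rewrite mulr1; exact: Hd.
Qed.

Let col_topology x j k : 0 <= x -> {within Lam, continuous (fun l => col_ l k x j)} /\
  (forall l, Om l -> derivable (fun l => col_ l k x j) l 1).
Proof.
move=> x0; rewrite /col_ /glued; case: leP => ax.
  have -> : (fun l => forward rho b a M l k (z l k) x j) =
      (fun l => cexp (l * (b k * (p x - p a)%:C)) * \sum_m M x j m * z l k x m).
    by apply/funext => l; rewrite /forward mulrA.
  split.
    have cE : {within Lam, continuous (fun l => cexp (l * (b k * (p x - p a)%:C)))}.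
      by apply: derivable_continuous => l; exact: derivable_cexp.
    have zE : {within Lam, continuous (fun l => \sum_m M x j m * z l k x m)}.
      apply: within_continuous_sum => m l0; apply: cvgM; first exact: cvg_cst.
      have : {within Lam, continuous (fun l => z l k x m)}; last exact.
      by apply: within_continuous_normc => l1 Ll1 eps eps0; exact: z_continuous.
    by move=> l0; apply: cvgM; [exact: cE|exact: zE].
  move=> l Ol; apply: derivableM; first exact: derivable_cexp.
  have -> : (fun l => \sum_m M x j m * z l k x m) = \sum_m (fun l => M x j m * z l k x m).
    by apply/funext => l1; rewrite fct_sumE.
  apply: derivable_sum => m; apply: derivableM; first exact: derivable_cst.
  have [z' Hz] := z_derivable k Ol.
  by apply: (@derivable_normc _ _ _ (z' x m)) => eps eps0; exact: Hz.
split; first by apply: within_continuous_normc => l1 Ll1 eps eps0; exact: f_continuous.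
move=> l Ol; have [f' Hf] := f_derivable k Ol.
by apply: (@derivable_normc _ _ _ (f' x j)) => eps eps0; exact: Hf.
Qed.

Lemma construction : exists Y : R -> R[i] -> 'M[R[i]]_n, [/\
  forall l, Lam l -> fundamental_system (coefficients rho b A l (CC l)) (fun x => Y x l),
  exists s : R -> R[i] -> 'M[R[i]]_n,
    (forall j k x l, a <= x -> Lam l ->
       Y x l j k = cexp (l * b k * (p x - p a)%:C) * (M x j k + s x l j k)) /\
    (forall j k (e : R), 0 < e -> exists r : R, forall l, Lam l -> r < normc l ->
       forall x, a <= x -> normc (s x l j k) < e),
  forall x, 0 <= x -> forall j k,
    {within Lam, continuous (fun l => Y x l j k)} /\
    (forall l, Om l -> derivable (fun l => Y x l j k) l 1) &
  forall l, Lam l -> forall j k : 'I_n, (k <= j)%N -> Y a l j k = (j == k)%:R].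
Proof.
exists Y; split => //.
- by exists s_; split; [exact: Y_form|exact: s_small].
- move=> x x0 j k; have -> : (fun l => Y x l j k) = (fun l => col_ l k x j).
    by apply/funext => l; rewrite YE.
  exact: col_topology.
Qed.

End Construction.

(** * Sectors, norms and thresholds *)

Section Norms.
Variables (R : realType) (n : nat).
Let mu : {measure set (measurableTypeR R) -> \bar R} := lebesgue_measure.
Let D0 : set (measurableTypeR R) := `[0%R, +oo[%classic.
Let mD0 : measurable D0 := @measurable_0y R.
Let Mx := R -> 'M[R[i]]_n.
Implicit Types (X : Mx) (f : R -> R[i]).

Lemma L1normE (a : R) f : 0 <= a -> cintegrable D0 f ->
  L1norm a f = (\int[mu]_(t in `[a, +oo[) normc (f t))%R%:E.
Proof.
move=> a0 cf; have mI : measurable (`[a, +oo[%classic : set (measurableTypeR R)) by exact: measurable_itv.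
have ci : cintegrable `[a, +oo[ f by apply: cintegrableS cf => //; exact: (@Jset_sub _ false).
rewrite /L1norm /Rintegral fineK//; apply: integrable_fin_num => //.
exact: integrable_normc.
Qed.

Lemma mass_sum X : L1mx X -> mass X = \sum_j \sum_m (\int[mu]_(t in D0) normc (X t j m))%R.
Proof.
move=> iX; have ci j m : cintegrable D0 (fun t => (normc (X t j m))%:C).
  by apply: cintegrable_real; exact: integrable_normc.
apply: complexI; rewrite /mass -cint_real.
rewrite (@eq_cint _ _ _ (fun t => \sum_j \sum_m (normc (X t j m))%:C)); last first.
  by move=> t _; rewrite /sumnorm rmorph_sum; apply: eq_bigr => j _; rewrite rmorph_sum.
rewrite cint_sum//; last by move=> j; exact: cintegrable_sum.
rewrite rmorph_sum; apply: eq_bigr => j _; rewrite rmorph_sum cint_sum//.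
by apply: eq_bigr => m _; rewrite cint_real.
Qed.

(** [mxL1norm] takes the largest entry, [mass] the sum of all; the comparison costs n^2. *)
Lemma mass_cut_le (a e : R) X : 0 <= a -> L1mx X -> (mxL1norm a X <= e%:E)%E ->
  mass (cut `[a, +oo[%classic X) <= n%:R ^+ 2 * e.
Proof.
move=> a0 iX Xe; have mI : measurable (`[a, +oo[%classic : set (measurableTypeR R)) by exact: measurable_itv.
rewrite mass_sum; last exact: L1mx_cut.
have -> : n%:R ^+ 2 * e = \sum_(j < n) \sum_(m < n) e.
  by rewrite !sumr_const card_ord -[X in _ = X *+ _]mulr_natl -[RHS]mulr_natl expr2 mulrA.
apply: ler_sum => j _; apply: ler_sum => m _.
have -> : (\int[mu]_(t in D0) normc (cut `[a, +oo[%classic X t j m))%R =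
    (\int[mu]_(t in `[a, +oo[) normc (X t j m))%R.
  apply: complexI; rewrite -!cint_real.
  rewrite (@eq_cint _ _ _ (fun t => (\1_(`[a, +oo[%classic : set R) t)%:C * (normc (X t j m))%:C)).
    rewrite cint_indic//; congr cint; apply/seteqP; split => t; first by move=> [].
    by move=> It; split => //; exact: (@Jset_sub _ false _ a0).
  by move=> t _; rewrite mxE normcM normc_real -rmorphM indicE ger0_norm ?ler0n.
rewrite -lee_fin -L1normE//; apply: le_trans Xe; rewrite /mxL1norm.
apply: le_trans (le_bigmax _ _ j); exact: (le_bigmax _ (fun m => L1norm a (fun x => X x j m)) m).
Qed.

Lemma mass_le (e : R) X : L1mx X -> (mxL1norm 0 X <= e%:E)%E -> mass X <= n%:R ^+ 2 * e.
Proof.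
move=> iX Xe; apply: le_trans (mass_cut_le (lexx 0) iX Xe).
rewrite -[leRHS]mul1r; apply: le_mass => //; first exact: L1mx_cut.
move=> t t0; rewrite mul1r; apply: ler_sum => j _; apply: ler_sum => m _.
by rewrite mxE normcM normc_real indicE mem_setE in_itv/= t0 normr1 mul1r.
Qed.

Lemma cut_tail X : L1mx X -> forall e : R, 0 < e -> exists a0, forall a, a0 <= a ->
  mass (cut `[a, +oo[%classic X) <= e.
Proof.
move=> iX e e0; have [a0 _ Ha] := tail_indic (integrable_sumnorm iX) (sumnorm_ge0 X) e0.
exists a0 => a /Ha /ltW; apply: le_trans; rewrite /mass le_eqVlt; apply/orP; left; apply/eqP.
apply: eq_Rintegral => t _.
have -> : sumnorm (cut `[a, +oo[%classic X) t =
    normc ((\1_(`[a, +oo[%classic : set R) t)%:C : R[i]) * sumnorm X t by exact: sumnormZ.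
by rewrite normc_real indicE ger0_norm ?ler0n.
Qed.

Lemma cvg0_ereal (T : Type) (F : set_system T) (FF : Filter F) (h : T -> \bar R) :
  h x @[x --> F] --> 0%E -> forall e : R, 0 < e -> \forall x \near F, (h x <= e%:E)%E.
Proof.
move=> /fine_cvgP[hfin /cvgrPdist_le h0] e e0.
apply: filterS2 hfin (h0 _ e0) => x hx; rewrite sub0r normrN => hxe.
by rewrite -(fineK hx) lee_fin (le_trans (ler_norm _) hxe).
Qed.

Variables (C : R -> R[i] -> 'M[R[i]]_n).
Let CC (l : R[i]) : Mx := fun x => C x l.

Lemma holomorphic_L1_derivative : (forall j k, holomorphic_L1 (fun l x => C x l j k)) ->
  forall l0, l0 != 0 -> exists C', L1_derivative CC C' l0.
Proof.
move=> hC l0 l00; have iC l : l != 0 -> L1mx (CC l).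
  by move=> ln j m; exact: (hC j m).1.
pose G j k := projT1 (cid2 ((hC j k).2 l0 l00)).
have iG j k : cintegrable D0 (G j k) by rewrite /G; case: cid2.
have cG j k : L1norm 0 (fun x => (l - l0)^-1 * (C x l j k - C x l0 j k) - G j k x) @[l --> l0^'] --> 0%E.
  by rewrite /G; case: cid2.
pose C' : Mx := fun x => \matrix_(j, k) G j k x.
have iC' : L1mx C'.
  move=> j k; have -> : (fun t => C' t j k) = G j k by apply/funext => t; rewrite mxE.
  exact: iG.
exists C'; split=> // eps eps0.
have n1 : 0 < n%:R ^+ 2 + 1 :> R by rewrite ltr_wpDl ?exprn_ge0.
have e1 : 0 < eps / (n%:R ^+ 2 + 1) by rewrite divr_gt0.
have H (jk : 'I_n * 'I_n) : \forall l \near l0, l != l0 ->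
    (L1norm 0 (fun x => (quotient CC l0 l x - C' x)%R jk.1 jk.2) <= (eps / (n%:R ^+ 2 + 1))%:E)%E.
  have E l : (fun x => (quotient CC l0 l x - C' x)%R jk.1 jk.2) =
    (fun x => (l - l0)^-1 * (C x l jk.1 jk.2 - C x l0 jk.1 jk.2) - G jk.1 jk.2 x).
    by apply/funext => x; rewrite !mxE.
  have K := cvg0_ereal _ (cG jk.1 jk.2) e1.
  suff : \forall l \near l0, l != l0 -> (L1norm 0 (fun x => (l - l0)^-1 * (C x l jk.1 jk.2 - C x l0 jk.1 jk.2)
      - G jk.1 jk.2 x)%R <= (eps / (n%:R ^+ 2 + 1))%:E)%E.
    by apply: filterS => l Hl /Hl; rewrite E.
  exact: K.
have [d d0 Hd] := (near_normc _ _).1 (filter_forall _ H).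
(* The second radius keeps l away from 0, where nothing is assumed about C. *)
exists (Num.min d (normc l0)); first by rewrite lt_min d0 normc_gt0.
move=> l; rewrite lt_min => /andP[ld ll].
have ln : l != 0 by apply: contraTneq ll => ->; rewrite sub0r normcN ltxx.
split; first exact: iC.
move=> ll0; have iq := L1mxB (L1mx_quotient (iC _ ln) (iC _ l00)) iC'.
apply: (@le_trans _ _ (n%:R ^+ 2 * (eps / (n%:R ^+ 2 + 1)))).
  apply: mass_le => //; rewrite /mxL1norm.
  apply/bigmax_leP; split => [|j _]; first by rewrite lee_fin ltW.
  apply/bigmax_leP; split => [|k _]; first by rewrite lee_fin ltW.
  exact: (Hd l ld (j, k)).
by rewrite mulrA ler_pdivrMr// mulrC ler_wpM2l ?(ltW eps0)// lerDl.
Qed.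

Lemma vanishing_mass : (forall l, l != 0 -> L1mx (CC l)) ->
  vanishes_at_infinity (fun l => mxL1norm 0 (CC l)) ->
  forall d : R, 0 < d -> exists r : R, forall l, l != 0 -> r < normc l -> mass (CC l) <= d.
Proof.
move=> iC vC d d0; have n1 : 0 < n%:R ^+ 2 + 1 :> R by rewrite ltr_wpDl ?exprn_ge0.
have [r Hr] := vC _ (divr_gt0 d0 n1); exists r => l l0 /Hr/ltW/(mass_le (iC _ l0)).
move=> /le_trans; apply.
by rewrite mulrA ler_pdivrMr// mulrC ler_wpM2l ?(ltW d0)// lerDl.
Qed.

Lemma uniform_tail (phi : R -> R) :
  ereal_sup [set mxL1norm a (CC l) | l in [set l : R[i] | phi a <= normc l]] @[a --> +oo] --> 0%E ->
  forall e : R, 0 < e -> exists a0, forall a, a0 < a -> forall l, phi a <= normc l ->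
    (mxL1norm a (CC l) <= e%:E)%E.
Proof.
move=> /(cvg0_ereal _) H e /H[a0 [_ Ha]]; exists a0 => a /Ha ha l pl.
apply: le_trans ha; apply: ereal_sup_ubound; by exists l.
Qed.

End Norms.

(** * Topology of the sectors *)

Section Sectors.
Variables (R : realType) (n : nat).
Implicit Types (b : 'I_n -> R[i]) (l : R[i]) (Gamma : set R[i]).

(** As long as |l - l0| |b_j - b_k| stays below the gap of the real parts at [l0], this gap cannot
    close. *)
Lemma off_lines_open b l0 : off_lines b l0 ->
  exists2 d : R, 0 < d & forall l, normc (l - l0) < d -> off_lines b l.
Proof.
move=> [l00 Hl0].
have H (jk : 'I_n * 'I_n) : \forall l \near l0, b jk.1 != b jk.2 -> Re (l * b jk.1) != Re (l * b jk.2).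
  case: jk => j k /=; have [bjk|bjk] := eqVneq (b j) (b k).
    by apply/near_normc; exists 1 => // l _; rewrite bjk eqxx.
  apply/near_normc; set u := Re (l0 * b j) - Re (l0 * b k).
  have u0 : 0 < `|u| by rewrite normr_gt0 subr_eq0; exact: Hl0.
  have c0 : 0 < normc (b j - b k) by rewrite normc_gt0 subr_eq0.
  exists (`|u| / normc (b j - b k)); first exact: divr_gt0.
  move=> l; rewrite ltr_pdivlMr// -normcM => hl _; rewrite -subr_eq0.
  have [+ _] := normr_le_normc ((l - l0) * (b j - b k)) => h1.
  apply/negP => /eqP h2; have := le_lt_trans h1 hl.
  have -> : Re ((l - l0) * (b j - b k)) = - u.
    by rewrite mulrBr !mulrBl !ReB /u; move: h2 => /eqP; rewrite subr_eq0 => /eqP ->; ring.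
  by rewrite normrN ltxx.
have [d d0 Hd] := (near_normc _ _).1 (filter_forall _ H).
exists (Num.min d (normc l0)); first by rewrite lt_min d0 normc_gt0.
move=> l; rewrite lt_min => /andP[ld ll]; split.
  by apply: contraTneq ll => ->; rewrite sub0r normcN ltxx.
by move=> j k; exact: (Hd l ld (j, k)).
Qed.

Lemma segment_continuous (l0 w : R[i]) :
  {within `[0, 1], continuous (fun t : R => l0 + t%:C * w)}.
Proof.
apply: continuous_subspaceT => t; apply/cvgrPdist_le => e /pos_complexE[-> e0].
have w1 : 0 < normc w + 1 by rewrite ltr_wpDl// normc_ge0.
have : \forall s \near t, `|t - s| <= Re e / (normc w + 1).
  have := @cvg_id _ (nbhs t) => /cvgrPdist_le; apply; exact: divr_gt0.
apply: filterS => s hs; rewrite normcE lecR.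
have -> : l0 + t%:C * w - (l0 + s%:C * w) = (t - s)%:C * w by rewrite rmorphB; ring.
rewrite normcM normc_real; apply: (@le_trans _ _ (`|t - s| * (normc w + 1))).
  by rewrite ler_wpM2l// lerDl.
by rewrite -ler_pdivlMr.
Qed.

(** In a ball around [l0] that avoids the lines, segments join all points to [l0]; being connected,
    they stay in its component. *)
Lemma sector_open b Gamma l0 : is_sector b Gamma -> Gamma l0 ->
  exists2 d : R, 0 < d & forall l, normc (l - l0) < d -> Gamma l.
Proof.
move=> [l1 ol1 ->] G0; have [d d0 Hd] := off_lines_open (connected_component_sub G0).
exists d => // l ld; rewrite (same_connected_component G0).
pose S := (fun t : R => l0 + t%:C * (l - l0)) @` `[0, 1].
have cS : connected S.
  by apply: connected_continuous_connected; [exact: segment_connected|exact: segment_continuous].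
apply: (@connected_component_max _ _ S) => //.
- by exists 0; [rewrite /= in_itv/= lexx ler01|rewrite rmorph0 mul0r addr0].
- move=> _ [t + <-]; rewrite /= in_itv/= => /andP[t0 t1]; apply: Hd.
  rewrite addrAC subrr add0r normcM normc_real ger0_norm//.
  by apply: le_lt_trans ld; rewrite ler_piMl// normc_ge0.
- by exists 1; [rewrite /= in_itv/= lexx ler01|rewrite rmorph1 mul1r subrKC].
Qed.

Lemma truncated_open b Gamma r l0 : is_sector b Gamma -> truncated Gamma r l0 ->
  exists2 d : R, 0 < d & forall l, normc (l - l0) < d -> truncated Gamma r l.
Proof.
move=> sG [G0 r0]; have [d d0 Hd] := sector_open sG G0.
exists (Num.min d (normc l0 - r)); first by rewrite lt_min d0 subr_gt0.
move=> l; rewrite lt_min => /andP[/Hd Gl ll]; split => //.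
by have := ler_normc_dist l0 l; rewrite normcB_sym; lra.
Qed.

(** The strict inequality |l| > r becomes weak on the closure, and every choice of a threshold has
    to allow for equality. *)
Lemma closure_truncated Gamma r l : closure (truncated Gamma r) l ->
  closure Gamma l /\ r <= normc l.
Proof.
move=> cl; split.
  by apply: (closureS _ cl) => m [].
rewrite leNgt; apply/negP => lr.
have : \forall m \near l, normc (m - l) < r - normc l.
  by apply/near_normc; exists (r - normc l) => //; rewrite subr_gt0.
move=> /cl[m [[_ rm] ml]].
by have := ler_normc_dist m l; lra.
Qed.

End Sectors.

Section Uniqueness.
Variables (R : realType) (n : nat) (rho : R -> R).
Let mu : {measure set (measurableTypeR R) -> \bar R} := lebesgue_measure.
Hypothesis cI : cond_I rho.

(** Gronwall's estimate for the difference, which vanishes at [a]. It lets a threshold found from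
    one M serve for all of them. *)
Lemma Malpha_unique (b : 'I_n -> R[i]) (A M1 M2 : R -> 'M[R[i]]_n) a : L1mx A -> 0 <= a ->
  is_Malpha b A a M1 -> is_Malpha b A a M2 -> forall x, a <= x -> M1 x = M2 x.
Proof.
move=> iA a0 [[ac1 d1] i1] [[ac2 d2] i2] x ax; apply/matrixP => j k.
pose u (y : R) i := M1 y i k - M2 y i k.
have D (M : R -> 'M[R[i]]_n) : (forall (T : R) j k, 0 < T -> absolutely_continuous_on 0 T (fun x => M x j k)) ->
    {ae mu, forall x : R, 0 <= x -> forall j k, has_cderiv (fun t => M t j k) x ((Dmx b A x *m M x) j k)} ->
    forall i, ACder (fun x => M x i k) (fun x => (Dmx b A x *m M x) i k).
  move=> ac d i; split; first by move=> T; exact: ac.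
  by apply: (@filterS _ _ (ae_filter_ringOfSetsType mu)) d => y dy y0; exact: dy.
have du i : ACder (fun y => u y i) (fun y => row_mul (Dmx b A) u y i).
  apply: ACder_eq (ACderB (D _ ac1 d1 i) (D _ ac2 d2 i)) _ => y _.
  by rewrite !mxE -sumrB; apply: eq_bigr => m _; rewrite /u mulrBr.
have u0 i : normc (u (if true then a else x) i) <= 0 by rewrite /u i1 i2 subrr normc0.
have := gronwall (dir := true) cI (L1mx_Dmx b iA) a0 ax du (lexx 0) u0 (x := x).
rewrite ax lexx mulr0 => /(_ isT j) H.
by apply/eqP; rewrite -subr_eq0 -normc_eq0 eq_le H normc_ge0.
Qed.

End Uniqueness.

(** * Choice of the thresholds *)

Section Thresholds.
Variables (R : realType) (n : nat) (rho : R -> R).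
Let Mx := R -> 'M[R[i]]_n.
Hypothesis n_gt0 : (0 < n)%N.
Variables (b : 'I_n -> R[i]) (A : Mx) (C : R -> R[i] -> 'M[R[i]]_n) (Gamma : set R[i]).
Hypothesis cI : cond_I rho.
Hypothesis iA : cond_II A.
Hypothesis cC : cond_III C.
Hypothesis sG : is_sector b Gamma.
Hypothesis ordG : forall l, closure Gamma l -> forall j k : 'I_n, (j <= k)%N ->
  Re (l * b k) <= Re (l * b j).
Let CC (l : R[i]) : Mx := fun x => C x l.

Definition asymptotic_family (a r : R) (M : Mx) : Prop :=
  let Ga := truncated Gamma r in
  exists Y : R -> R[i] -> 'M[R[i]]_n,
  [/\ forall l, closure Ga l ->
        fundamental_system (fun x => l *: Fmx rho b x + A x + C x l) (fun x => Y x l),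
      exists s : R -> R[i] -> 'M[R[i]]_n,
        (forall j k x l, a <= x -> closure Ga l ->
           Y x l j k =
             cexp (l * b k * (primitive rho x - primitive rho a)%:C) * (M x j k + s x l j k)) /\
        (forall j k (e : R), 0 < e -> exists r : R,
           forall l, closure Ga l -> r < normc l ->
           forall x, a <= x -> normc (s x l j k) < e),
      forall x, 0 <= x -> forall j k,
        {within closure Ga, continuous (fun l => Y x l j k)} /\
        (forall l, Ga l -> derivable (fun l => Y x l j k) l 1) &
      forall l, closure Ga l -> forall j k : 'I_n, (k <= j)%N -> Y a l j k = (j == k)%:R].

Let iC l : l != 0 -> L1mx (CC l).
Proof. by move=> l0 j m; exact: ((cC.1 j m).1 l l0). Qed.

Lemma construction_sector (a r N : R) (M Mh : Mx) : 0 <= a -> 0 < r -> is_Malpha b A a M ->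
  (forall x, a <= x -> Mh x = M x) ->
  (forall x, 0 <= x -> Mh x \in unitmx) ->
  (forall j k, cmeas `[0, +oo[ (fun x => Mh x j k) /\ cmeas `[0, +oo[ (fun x => invmx (Mh x) j k)) ->
  (forall x j k, 0 <= x -> normc (Mh x j k) <= N /\ normc (invmx (Mh x) j k) <= N) ->
  (forall x j k, 0 <= x -> b j != b k -> Mh x j k = 0 /\ invmx (Mh x) j k = 0) ->
  (forall l k, closure (truncated Gamma r) l -> ordered b l -> l != 0 ->
     let T := Top rho (direction k) (fun j => l * (b j - b k))
       (conj_by a Mh (fun t => A t - Dmx b A t + CC l t)) in
     forall f B, mV f -> bnd B f -> 0 <= B -> bnd (B / 2) (T (T f))) ->
  asymptotic_family a r M.
Proof.
move=> a0 r0 MA MhM uMh mMN bMN blk half.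
have Lam0 l : closure (truncated Gamma r) l -> l != 0.
  by move=> /closure_truncated[_ rl]; rewrite -normc_gt0; exact: lt_le_trans rl.
have Lam_ord l : closure (truncated Gamma r) l -> ordered b l.
  by move=> /closure_truncated[/ordG].
apply: (construction n_gt0 cI a0 iA MA MhM uMh (fun j k => (mMN j k).1) (fun j k => (mMN j k).2)
  (fun x j k x0 => (bMN x j k x0).1) (fun x j k x0 => (bMN x j k x0).2)
  (fun x j k x0 h => (blk x j k x0 h).1) (fun x j k x0 h => (blk x j k x0 h).2) Lam0 Lam_ord (CC := CC)).
- move=> l0 /(truncated_open sG)[d d0 Hd]; exists d => // l /Hd; exact: subset_closure.
- move=> l [Gl _] j k bjk; have [l1 _ GE] := sG; rewrite GE in Gl.
  by have [_] := connected_component_sub Gl; apply.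
- exact: holomorphic_L1_derivative cC.1.
- by move=> l k Ll; apply: half => //; [exact: Lam_ord|exact: Lam0].
- exact: (vanishing_mass iC cC.2).
Qed.

(** The threshold precedes M in the order of quantifiers, so it is computed from one solution and
    transferred by uniqueness; if there is no solution, the claim is vacuous. *)
Lemma exists_threshold a : 0 <= a -> exists2 r : R, 0 < r &
  forall M, is_Malpha b A a M -> asymptotic_family a r M.
Proof.
move=> a0; have [[M0 MA0]|noM] := pselect (exists M0, is_Malpha b A a M0); last first.
  by exists 1 => // M MA; case: noM; exists M.
have [Mh [MhM mMN uMh bMN blk]] := Malpha_frame cI iA a0 MA0.
have [r1 [d [d0 H]]] := half_of_large cI a0 iA (fun j k => (mMN j k).1) (fun j k => (mMN j k).2)
  (fun x j k x0 => (bMN x j k x0).1) (fun x j k x0 => (bMN x j k x0).2)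
  (fun x j k x0 h => (blk x j k x0 h).1) (fun x j k x0 h => (blk x j k x0 h).2).
have [r2 Hr2] := vanishing_mass iC cC.2 d0.
(* Strictly above both radii, since the closure only yields |l| >= r. *)
pose r := `|r1| + `|r2| + 1.
have r0 : 0 < r by rewrite ltr_wpDl ?addr_ge0.
exists r => // M MA; apply: (construction_sector (Mh := Mh) a0 r0 MA _ uMh mMN bMN blk).
  by move=> x ax; rewrite MhM//; exact: (Malpha_unique cI iA a0 MA0 MA).
move=> l k /closure_truncated[_ rl] ord l0 /=.
have [n1 n2] : r1 < normc l /\ r2 < normc l.
  have := ler_norm r1; have := ler_norm r2; have := normr_ge0 r1; have := normr_ge0 r2.
  by move: rl; rewrite /r => ? ? ? ? ?; split; lra.
by apply: H => //; [exact: iC|exact: Hr2].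
Qed.

(** For large a, both A - D and, for |l| >= phi(a), the perturbation C have mass at most 1 / (4 K)
    on [a, +oo[. Conjugation costs at most K, and 2 K / (4 K) = 1/2 is what [half_of_mass] asks for.
    K does not depend on a because [frame_bound] does not. *)
Lemma eventual_threshold (phi : R -> R) : (forall a, 0 <= a -> 0 < phi a) ->
  ereal_sup [set mxL1norm a (fun x => C x l) | l in [set l : R[i] | phi a <= normc l]]
    @[a --> +oo] --> 0%E ->
  exists a0 : R, forall a, a0 < a -> 0 <= a ->
    forall M, is_Malpha b A a M -> asymptotic_family a (phi a) M.
Proof.
move=> phi0 cphi; pose N := frame_bound b A; pose K := (n%:R * N) ^+ 2 + 1.
have K0 : 0 < K by rewrite ltr_wpDl// sqr_ge0.
pose L : R := n%:R ^+ 2 + 1.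
have L0 : 0 < L by rewrite ltr_wpDl// exprn_ge0.
have e0 : 0 < (4 * K)^-1 by rewrite invr_gt0 mulr_gt0.
have iAD := L1mx_AD b iA.
have [a1 H1] := cut_tail iAD e0.
have [a2 H2] := uniform_tail cphi (divr_gt0 e0 L0).
exists (Num.max a1 a2) => a; rewrite gt_max => /andP[a1a a2a] a0 M MA.
have [Mh [MhM mMN uMh bMN blk]] := Malpha_frame cI iA a0 MA.
apply: (construction_sector (Mh := Mh) a0 (phi0 a a0) MA MhM uMh mMN bMN blk).
move=> l k /closure_truncated[_ rl] ord l0 /=.
have iQ := L1mxD iAD (iC l0).
apply: (half_of_mass cI iA (fun j k => (mMN j k).1) (fun j k => (mMN j k).2)
  (fun x j k x0 => (bMN x j k x0).1) (fun x j k x0 => (bMN x j k x0).2) k ord (iC l0)).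
apply: le_trans (mass_conj_by a (fun j k => (mMN j k).1) (fun j k => (mMN j k).2)
  (fun x j k x0 => (bMN x j k x0).1) (fun x j k x0 => (bMN x j k x0).2) iQ) _.
have mI : measurable (`[a, +oo[%classic : set (measurableTypeR R)) by exact: measurable_itv.
have hC : mass (cut `[a, +oo[%classic (CC l)) <= (4 * K)^-1.
  apply: le_trans (mass_cut_le a0 (iC l0) (H2 a a2a l rl)) _.
  by rewrite mulrA ler_pdivrMr// mulrC ler_wpM2l ?(ltW e0)// lerDl.
have hS : mass (cut `[a, +oo[%classic (fun t => A t - Dmx b A t + CC l t)) <= (4 * K)^-1 + (4 * K)^-1.
  have -> : cut `[a, +oo[%classic (fun t => A t - Dmx b A t + CC l t) =
      (fun t => cut `[a, +oo[%classic (fun t => A t - Dmx b A t) t + cut `[a, +oo[%classic (CC l) t).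
    by apply/funext => t; rewrite /cut scalerDr.
  apply: le_trans (massD (L1mx_cut mI iAD) (L1mx_cut mI (iC l0))) _.
  by apply: lerD => //; exact: H1 (ltW a1a).
apply: (@le_trans _ _ (K * ((4 * K)^-1 + (4 * K)^-1))).
  by apply: ler_pM; rewrite ?sqr_ge0 ?mass_ge0// /K lerDl.
by rewrite le_eqVlt; apply/orP; left; apply/eqP; field; rewrite lt0r_neq0.
Qed.

End Thresholds.

Theorem theorem2 (R : realType) (n : nat) (n_gt0 : (0 < n)%N)
    (rho : R -> R) (b : 'I_n -> R[i]) (A : R -> 'M[R[i]]_n)
    (C : R -> R[i] -> 'M[R[i]]_n) (Gamma : set R[i]) :
  cond_I rho -> cond_II A -> cond_III C -> cond_IV C ->
  is_sector b Gamma ->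
  (forall l, closure Gamma l -> forall j k : 'I_n, (j <= k)%N ->
     complex.Re (l * b k) <= complex.Re (l * b j)) ->
  exists lam : R -> R,
    [/\ forall a, 0 <= a -> 0 < lam a,
        lam a @[a --> +oo] --> 0 &
        forall a, 0 <= a ->
        forall M : R -> 'M[R[i]]_n, is_Malpha b A a M ->
        let Ga := truncated Gamma (lam a) in
        exists Y : R -> R[i] -> 'M[R[i]]_n,
        [/\ forall l, closure Ga l ->
              fundamental_system (fun x => l *: Fmx rho b x + A x + C x l)
                                 (fun x => Y x l),
            exists s : R -> R[i] -> 'M[R[i]]_n,
              (forall j k x l, a <= x -> closure Ga l ->
                 Y x l j k =
                   cexp (l * b k * (primitive rho x - primitive rho a)%:C)
                     * (M x j k + s x l j k)) /\
              (forall j k (e : R), 0 < e -> exists r : R,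
                 forall l, closure Ga l -> r < Normc.normc l ->
                 forall x, a <= x -> Normc.normc (s x l j k) < e),
            forall x, 0 <= x -> forall j k,
              {within closure Ga, continuous (fun l => Y x l j k)} /\
              (forall l, Ga l -> derivable (fun l => Y x l j k) l 1) &
            forall l, closure Ga l -> forall j k : 'I_n, (k <= j)%N ->
              Y a l j k = (j == k)%:R]].

Proof.
move=> cI iA cC [phi [phi0 phi_to0 cphi]] sG ordG.
have [a0 Ha0] := eventual_threshold n_gt0 cI iA cC sG ordG phi0 cphi.
(* The default 1 concerns negative a, for which nothing is claimed. *)
pose threshold a := if pselect (0 <= a) is left h
  then projT1 (cid2 (exists_threshold n_gt0 cI iA cC sG ordG h)) else 1.
(* Beyond [a0] the threshold is phi, which tends to 0; before that, a separate choice for each a is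
   enough. *)
pose lam a := if a0 < a then phi a else threshold a.
exists lam; split.
- move=> a a_ge0; rewrite /lam /threshold; case: ifP => _; first exact: phi0.
  by case: pselect => // h; case: cid2.
- apply: cvg_trans phi_to0; apply: near_eq_cvg.
  by exists a0; split; [exact: num_real|move=> a a0a; rewrite /lam a0a].
- move=> a a_ge0 M MA; rewrite /lam /threshold; case: ifP => [a0a|_].
    exact: Ha0 a0a a_ge0 M MA.
  by case: pselect => // h; case: cid2 => r r0 /= H; exact: H.
Qed.
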